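(* Let $0\le \ell_1,\ell_2<1$ with $\ell_1+\ell_2>0$. For initial data $\phi^0\in H_0^1(I_{t_0})$, $\phi^1\in L^2(I_{t_0})$, let $\phi$ denote the solution of (WP) and $E$ its energy. (1) For every $T\ge 0$ there is a constant $K_\ell(T)$, depending only on $\ell_1,\ell_2$ and $T$, such that every solution of (WP) with initial data $\phi^0\in H_0^1(I_{t_0})$, $\phi^1\in L^2(I_{t_0})$ satisfies the direct inequality $$\int_{t_0}^{t_0+T}\phi_x^2(\ell_2t,t)\,dt\le K_\ell(T)\,E(t_0).$$ (2) If $T\ge T_\ell$, then (WP) is observable at the endpoint $x=\ell_2t$, and every solution of (WP) with initial data $\phi^0\in H_0^1(I_{t_0})$, $\phi^1\in L^2(I_{t_0})$ satisfies $$E(t_0)\le\frac{\alpha_\ell\beta_\ell(1-\ell_2^2)^2}{4(1-L)}\int_{t_0}^{t_0+T}\phi_x^2(\ell_2t,t)\,dt. \qquad ( * )$$ Conversely, if $0\le T<T_\ell$, the inequality $( * )$ does not hold (i.e. it fails for some solution of (WP) with initial data $\phi^0\in H_0^1(I_{t_0})$, $\phi^1\in L^2(I_{t_0})$).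
   Context: Let $L_0>0$, $t_0=L_0/(\ell_1+\ell_2)$, and $I_t=(-\ell_1t,\ell_2t)$ for $t\ge t_0$. All initial data and solutions are real-valued. Problem (WP) is the wave equation $$\phi_{tt}-\phi_{xx}=0 \text{ for } x\in I_t,\ t>t_0,\qquad \phi(-\ell_1t,t)=\phi(\ell_2t,t)=0 \text{ for } t>t_0,\qquad \phi(\cdot,t_0)=\phi^0,\ \phi_t(\cdot,t_0)=\phi^1 \text{ in } I_{t_0}.$$ For $\phi^0\in H^1_0(I_{t_0})$, $\phi^1\in L^2(I_{t_0})$ it has a unique solution with $\phi(\cdot,t)\in H_0^1(I_t)$, $\phi_t(\cdot,t)\in L^2(I_t)$ depending continuously on $t\ge t_0$. Its energy is $E(t)=\frac12\int_{-\ell_1t}^{\ell_2t}\left(\phi_x^2(x,t)+\phi_t^2(x,t)\right)dx$. The function $t\mapsto\phi_x(\ell_2t,t)$ is the boundary trace of $\phi_x$ (defined for general data by continuous extension from smooth solutions). (WP) is called observable at $x=\ell_2t$ in time $T$ if there is a constant $C>0$ such that $E(t_0)\le C\int_{t_0}^{t_0+T}\phi_x^2(\ell_2t,t)\,dt$ for all solutions of (WP). Constants: $L=\max\{\ell_1,\ell_2\}$, $\alpha_\ell=\frac{1+\ell_1}{1-\ell_2}$, $\beta_\ell=\frac{1+\ell_2}{1-\ell_1}$, and $$T_\ell=\frac{2L_0}{(1-\ell_1)(1-\ell_2)}=(\alpha_\ell\beta_\ell-1)t_0.$$ *)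

(* Defs.v *)
(* MathComp-Analysis *)
From HB Require Import structures.
From mathcomp Require Export all_boot all_order all_algebra.
From mathcomp Require Export all_classical all_reals all_analysis.

Set Implicit Arguments.
Unset Strict Implicit.
Unset Printing Implicit Defensive.

Import Order.TTheory GRing.Theory Num.Theory.
Import numFieldNormedType.Exports.

Local Open Scope classical_set_scope.
Local Open Scope ring_scope.

(** Functions of position and time are curried, [u x t]. *)

Section Regularity.
Context {R : realType}.

Definition dx (u : R -> R -> R) : R -> R -> R := fun x t => derive1 (u ^~ t) x.
Definition dt (u : R -> R -> R) : R -> R -> R := fun x t => derive1 (u x) t.

(** [false] stands for a derivative in [x], [true] for one in [t]. *)
Definition partial (w : seq bool) (u : R -> R -> R) : R -> R -> R :=
  foldr (fun b v => if b then dt v else dx v) u w.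

(** [derive1] is a total operator, hence the explicit differentiability
    clause. *)
Definition class_C (k : nat) (u : R -> R -> R) : Prop :=
  forall w : seq bool, (size w <= k)%N ->
    continuous (fun p : R * R => partial w u p.1 p.2) /\
    ((size w < k)%N -> forall x t : R,
       derivable (partial w u ^~ t) x 1 /\ derivable (partial w u x) t 1).

Definition smooth (u : R -> R -> R) : Prop := forall k, class_C k u.

Definition test_function (Q : set (R * R)) (psi : R -> R -> R) : Prop :=
  smooth psi /\
  exists K : set (R * R), [/\ compact K, K `<=` Q &
    forall x t, ~ K (x, t) -> psi x t = 0].

Definition wave_op (u : R -> R -> R) : R -> R -> R :=
  fun x t => dt (dt u) x t - dx (dx u) x t.

End Regularity.

Section FunctionSpaces.
Context {R : realType}.
Local Notation mu := (@lebesgue_measure R).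

Definition L2 (A : set R) (f : R -> R) : Prop :=
  measurable_fun A f /\ (\int[mu]_(x in A) (f x ^+ 2)%:E < +oo)%E.

(** [f], identified with its continuous representative on [[a, b]], belongs to
    H^1(a, b) and [g] is a version of its weak derivative. *)
Definition H1_deriv (a b : R) (f g : R -> R) : Prop :=
  L2 `]a, b[ g /\
  forall x, x \in `[a, b] -> f x = f a + \int[mu]_(y in `[a, x]) g y.

Definition H10_deriv (a b : R) (f g : R -> R) : Prop :=
  [/\ H1_deriv a b f g, f a = 0 & f b = 0].

Definition H10 (a b : R) (f : R -> R) : Prop := exists g, H10_deriv a b f g.

End FunctionSpaces.

Section WaveProblem.
Context {R : realType}.
Variables (l1 l2 t0 : R).
Local Notation mu := (@lebesgue_measure R).

Definition I_ (t : R) : set R := `](- l1 * t), (l2 * t)[.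

Definition domain : set (R * R) := [set p | t0 < p.2 /\ I_ p.2 p.1].

(** Extension by zero outside [I_ t]: functions living on the moving intervals
    are compared in L^2(R) through it. *)
Definition zext (u : R -> R -> R) (t : R) : R -> R := (u ^~ t) \_ (I_ t).

Definition L2_continuous (u : R -> R -> R) : Prop :=
  forall t, t0 <= t ->
    (\int[mu]_x ((zext u s x - zext u t x) ^+ 2)%:E)%E
      @[s --> within [set s | t0 <= s] (nbhs t)] --> 0%E.

(** At [t = t0] the limit is one-sided. *)
Definition L2_derivative (u v : R -> R -> R) : Prop :=
  forall t, t0 <= t ->
    (\int[mu]_x (((zext u s x - zext u t x) / (s - t) - zext v t x) ^+ 2)%:E)%E
      @[s --> within [set s | t0 <= s] t^'] --> 0%E.

(** [phi] is the finite-energy solution of the problem with data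
    [(phi0, phi1)]; [phix] and [phit] are versions of its derivatives in [x]
    and [t].  The wave equation holds in the sense of distributions, and the
    boundary conditions are part of [H10_deriv]. *)
Record wave_solution (phi0 phi1 : R -> R) (phi phix phit : R -> R -> R)
    : Prop := {
  ws_H10 : forall t, t0 <= t ->
    H10_deriv (- l1 * t) (l2 * t) (phi ^~ t) (phix ^~ t) ;
  ws_L2 : forall t, t0 <= t -> L2 (I_ t) (phit ^~ t) ;
  ws_phi_continuous : L2_continuous phi ;
  ws_phix_continuous : L2_continuous phix ;
  ws_phit_continuous : L2_continuous phit ;
  ws_derivative : L2_derivative phi phit ;
  ws_equation : forall psi, test_function domain psi ->
    \int[(mu \x mu)%E]_(p in domain) (phi p.1 p.2 * wave_op psi p.1 p.2) = 0 ;
  ws_init : forall x, I_ t0 x -> phi x t0 = phi0 x ;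
  ws_init_t : {ae mu, forall x, I_ t0 x -> phit x t0 = phi1 x}
}.

Definition energy (phix phit : R -> R -> R) (t : R) : \bar R :=
  ((2^-1)%:E * \int[mu]_(x in I_ t) (phix x t ^+ 2 + phit x t ^+ 2)%:E)%E.

(** Regularity up to the boundary is expressed by [u] being the restriction of
    a function of class C^2 on the plane. *)
Definition classical_solution (u : R -> R -> R) : Prop :=
  [/\ class_C 2 u,
      forall x t, domain (x, t) -> wave_op u x t = 0 &
      forall t, t0 <= t -> u (- l1 * t) t = 0 /\ u (l2 * t) t = 0].

(** [g] is the value at the data [(phi0, phi1)], with [dphi0] the derivative of
    [phi0], of the continuous extension of the map
    [u |-> (t |-> u_x (l2 t, t))] from classical solutions to finite-energy
    ones: data converge in H^1_0 x L^2 (for the norm of the gradient on H^1_0),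
    traces converge in L^2_loc([t0, +oo)). *)
Definition is_trace (dphi0 phi1 g : R -> R) : Prop :=
  (forall T : R, 0 <= T -> L2 `[t0, (t0 + T)] g) /\
  exists u : nat -> R -> R -> R,
  [/\ forall n, classical_solution (u n),
      (\int[mu]_(x in I_ t0) ((dx (u n) x t0 - dphi0 x) ^+ 2)%:E)%E
        @[n --> \oo] --> 0%E,
      (\int[mu]_(x in I_ t0) ((dt (u n) x t0 - phi1 x) ^+ 2)%:E)%E
        @[n --> \oo] --> 0%E &
      forall T : R, 0 <= T ->
        (\int[mu]_(t in `[t0, (t0 + T)%R]) ((dx (u n) (l2 * t) t - g t) ^+ 2)%:E)%E
          @[n --> \oo] --> 0%E].

(** The trace of [phi_x] on [x = l2 t], chosen among almost everywhere equal
    functions. *)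
Definition boundary_trace (phix phit : R -> R -> R) : R -> R :=
  xget (cst 0) [set g | is_trace (phix ^~ t0) (phit ^~ t0) g].

Definition boundary_integral (phix phit : R -> R -> R) (T : R) : \bar R :=
  (\int[mu]_(t in `[t0, (t0 + T)%R]) (boundary_trace phix phit t ^+ 2)%:E)%E.

(** The inequality [E(t0) <= C * boundary integral] for all solutions. *)
Definition inverse_inequality (T C : R) : Prop :=
  forall phi0 phi1 phi phix phit,
    H10 (- l1 * t0) (l2 * t0) phi0 -> L2 (I_ t0) phi1 ->
    wave_solution phi0 phi1 phi phix phit ->
    (energy phix phit t0 <= C%:E * boundary_integral phix phit T)%E.

Definition observable (T : R) : Prop :=
  exists2 C : R, 0 < C & inverse_inequality T C.

End WaveProblem.

Section Constants.
Context {R : realType}.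
Variables (l1 l2 : R).

Definition alpha_l : R := (1 + l1) / (1 - l2).
Definition beta_l : R := (1 + l2) / (1 - l1).
Definition T_l (L0 : R) : R := 2 * L0 / ((1 - l1) * (1 - l2)).
Definition obs_const : R :=
  alpha_l * beta_l * (1 - l2 ^+ 2) ^+ 2 / (4 * (1 - Num.max l1 l2)).

End Constants.

(* Main.v *)
From HB Require Import structures.
From mathcomp Require Import ring lra measurable_realfun.
Require Import Defs.
Import Order.TTheory GRing.Theory Num.Theory.
Import numFieldNormedType.Exports.
Local Open Scope classical_set_scope.
Local Open Scope ring_scope.

Set Implicit Arguments.
Unset Strict Implicit.
Unset Printing Implicit Defensive.

(** Along the lines [x - t = const] the quantity [u_t - u_x] of a solution is
    constant, along [x + t = const] so is [u_t + u_x], and differentiating the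
    boundary conditions gives [u_t = - l2 u_x] on [x = l2 t] and
    [u_t = l1 u_x] on [x = - l1 t].  Each value of the trace
    [Y t = u_x (l2 t, t)] is therefore a constant times one value of the initial
    data: of [u_t - u_x] for [t0 <= t <= alpha t0]
    ([right_trace_data]), and of [u_t + u_x], after one reflection at
    [x = - l1 t], for [alpha t0 <= t <= rho t0], where [rho = alpha beta]
    ([left_trace_data], [right_trace_left]).  Two reflections give
    [rho * Y (rho * t) = Y t] ([right_trace_period]).

    Since [T_l = (rho - 1) t0], the interval [[t0, t0 + T_l]] is exactly one
    period, and on it the two families of characteristics carry each part of
    the data once.  Changing variables, [4 E(t0)] is the sum of the
    square integrals of [Y] over [[t0, alpha t0]] and [[alpha t0, rho t0]], with
    weights [trace_gain] and [trace_gain * trace_skew] ([data_norm_period]).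
    This is the inverse inequality for [T >= T_l], with a constant better than
    the stated one by the factor [(1 - L) / (1 + l2)]; self-similarity bounds
    the integral of [Y ^ 2] over any longer interval by a multiple of the one over a
    period ([sqint_right_trace_le]), which is the direct inequality, with a
    constant that does not depend on [T].

    Both inequalities pass to the limit along the classical solutions that
    define the trace of a finite-energy solution ([trace_direct],
    [trace_inverse]).  The inverse inequality also needs such a sequence to
    exist ([trace_exists]): a boundary integral without trace is 0, and the
    inequality would then fail.  Classical solutions are therefore constructed
    explicitly, as [G (t - x) - G (mirror l2 * (t + x))]: the condition on
    [x = l2 t] holds by the choice of [mirror l2], and the one on [x = - l1 t]
    says that [G (rho * eta) = G eta] ([profile_wave]).  Such a [G] is the sum of the
    dilates of a profile [g] living on one period; the data determine the
    derivative of [g], an L^2 function of mean 0, and derivatives of C^2 profiles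
    are dense among those ([profile_dense]).

    For [T < T_l] there are phases that meet the endpoint only after
    [t0 + T] ([unobserved_wave]); a profile concentrated on them gives a
    classical solution, hence a finite-energy one
    ([classical_wave_solution]), of positive energy whose trace vanishes on
    [[t0, t0 + T]]. *)

(** * Differential calculus in the plane *)

Section PlaneCalculus.
Context {R : realType}.
Implicit Types (f : R -> R) (u v : R -> R -> R).

(** Valid for both orders of [a] and [b]; the intermediate point is only located
    by its distance to [a], which is all that continuity arguments use. *)
Lemma mvt_between f (df : R -> R) (a b : R) :
  (forall x : R, is_derive x 1 f (df x)) ->
  exists2 c, `|c - a| <= `|b - a| & f b - f a = df c * (b - a).
Proof.
move=> fdf.
have cf : continuous f.
  by move=> x; apply/differentiable_continuous/derivable1_diffP; case: (fdf x).
have [ab|ba] := leP a b.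
  have [c] := MVT_segment ab (fun x _ => fdf x) (continuous_subspaceT cf).
  rewrite in_itv /= => /andP[ac cb] E; exists c => //.
  by rewrite !ger0_norm ?subr_ge0// lerD2r.
have [c] := MVT_segment (ltW ba) (fun x _ => fdf x) (continuous_subspaceT cf).
rewrite in_itv /= => /andP[bc ca] E; exists c.
  rewrite !ler0_norm ?subr_le0// ?(ltW ba)//; lra.
by rewrite -opprB E; ring.
Qed.

Lemma class_C_le (k l : nat) u : (k <= l)%N -> class_C l u -> class_C k u.
Proof.
move=> kl Cu w wk; have [cw dw] := Cu w (leq_trans wk kl).
by split=> // wk'; apply: dw; exact: leq_trans wk' kl.
Qed.

Lemma class_C_partial (k : nat) u (b : bool) :
  class_C k.+1 u -> class_C k (if b then dt u else dx u).
Proof.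
move=> Cu w wk; have := Cu (rcons w b); rewrite size_rcons /partial foldr_rcons.
by move=> /(_ wk).
Qed.

Lemma class_C_dx (k : nat) u : class_C k.+1 u -> class_C k (dx u).
Proof. exact: (@class_C_partial k u false). Qed.

Lemma class_C_dt (k : nat) u : class_C k.+1 u -> class_C k (dt u).
Proof. exact: (@class_C_partial k u true). Qed.

Lemma class_C_continuous (k : nat) u : class_C k u ->
  continuous (fun p : R * R => u p.1 p.2).
Proof. by move=> /(_ [::] (leq0n _))[]. Qed.

Lemma class_C_is_derive_dx (k : nat) u (x t : R) : class_C k.+1 u ->
  is_derive x 1 (u ^~ t) (dx u x t).
Proof.
move=> /(_ [::] (leq0n _))[_ /(_ (ltn0Sn _) x t)[ux _]].
by apply: DeriveDef => //; rewrite -derive1E.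
Qed.

Lemma class_C_is_derive_dt (k : nat) u (x t : R) : class_C k.+1 u ->
  is_derive t 1 (u x) (dt u x t).
Proof.
move=> /(_ [::] (leq0n _))[_ /(_ (ltn0Sn _) x t)[_ ut]].
by apply: DeriveDef => //; rewrite -derive1E.
Qed.

Lemma plane_continuousP (F : R * R -> R) x t : {for (x, t), continuous F} ->
  forall e, 0 < e -> exists2 d, 0 < d &
    forall y s, `|y - x| < d -> `|s - t| < d -> `|F (y, s) - F (x, t)| < e.
Proof.
move=> /cvgrPdist_lt cF e e0; have /nbhs_ballP[d /= d0 dF] := cF e e0.
exists d => // y s yx st; rewrite distrC; apply: dF; split => /=.
  by rewrite /ball /= distrC.
by rewrite /ball /= distrC.
Qed.

(** No differentiability lemma is needed for the map of two variables: the mean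
    value theorem, one variable at a time, gives directional derivatives. *)
Lemma class_C1_is_derive_line u (x t c d s : R) : class_C 1 u ->
  is_derive s 1 (fun r => u (x + c * r) (t + d * r))
    (c * dx u (x + c * s) (t + d * s) + d * dt u (x + c * s) (t + d * s)).
Proof.
move=> Cu; set x0 := x + c * s; set t0 := t + d * s.
suff H : h^-1 *: (u (x0 + c * h) (t0 + d * h) - u x0 t0) @[h --> 0^'] -->
    c * dx u x0 t0 + d * dt u x0 t0.
  have E : (fun h : R => h^-1 *: (((fun r => u (x + c * r) (t + d * r)) \o shift s) (h *: 1) -
     u (x + c * s) (t + d * s))) = (fun h => h^-1 *: (u (x0 + c * h) (t0 + d * h) - u x0 t0)).
    apply/funext => h /=; congr (_ *: (u _ _ - _)).
      by rewrite [h *: 1]mulr1 /x0; ring.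
    by rewrite [h *: 1]mulr1 /t0; ring.
  apply: DeriveDef; first by rewrite /derivable E; apply/cvg_ex; eexists; exact: H.
  by rewrite /derive E; apply/cvg_lim => //; exact: Rhausdorff.
apply/cvgrPdist_le => e e0.
pose K := `|c| + `|d| + 1.
have K0 : 0 < K by rewrite /K; have := normr_ge0 c; have := normr_ge0 d; lra.
have eK : 0 < e / K by rewrite divr_gt0.
have [d1 d10 H1] := plane_continuousP (class_C_continuous (class_C_dx Cu) (x := (x0, t0))) eK.
have [d2 d20 H2] := plane_continuousP (class_C_continuous (class_C_dt Cu) (x := (x0, t0))) eK.
near=> h.
have h0 : h != 0 by near: h; exact: nbhs_dnbhs_neq.
have hd : K * `|h| < Num.min d1 d2.
  rewrite mulrC -ltr_pdivlMr//; near: h; apply: dnbhs0_lt.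
  by rewrite divr_gt0// lt_min d10 d20.
have [xi xiE uxi] := mvt_between x0 (x0 + c * h)
  (fun y => class_C_is_derive_dx y (t0 + d * h) Cu).
have [ta taE uta] := mvt_between t0 (t0 + d * h)
  (fun r => class_C_is_derive_dt x0 r Cu).
rewrite lt_min in hd; case/andP: hd => hd1 hd2.
have ch : `|c * h| <= K * `|h|.
  by rewrite normrM ler_wpM2r// /K; have := normr_ge0 d; lra.
have dh : `|d * h| <= K * `|h|.
  by rewrite normrM ler_wpM2r// /K; have := normr_ge0 c; lra.
rewrite [x0 + _]addrC addrK [_ + x0]addrC in xiE uxi.
rewrite [t0 + _]addrC addrK [_ + t0]addrC in taE uta.
have := H1 xi (t0 + d * h) (le_lt_trans xiE (le_lt_trans ch hd1)).
rewrite [t0 + _ - _]addrAC subrr add0r => /(_ (le_lt_trans dh hd1)) /= A1.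
have := H2 x0 ta.
rewrite subrr normr0 => /(_ d20 (le_lt_trans taE (le_lt_trans dh hd2))) /= A2.
have -> : h^-1 *: (u (x0 + c * h) (t0 + d * h) - u x0 t0)
    = c * dx u xi (t0 + d * h) + d * dt u x0 ta.
  rewrite -[LHS]/(h^-1 * _).
  rewrite -(subrK (u x0 (t0 + d * h)) (u (x0 + c * h) _)) -addrA uxi uta.
  by field.
move: (dx u xi _) (dx u x0 t0) (dt u x0 ta) (dt u x0 t0) A1 A2 => a1 a2 b1 b2 A1 A2.
have -> : c * a2 + d * b2 - (c * a1 + d * b1) = - (c * (a1 - a2) + d * (b1 - b2)).
  by ring.
rewrite normrN; apply: (le_trans (ler_normD _ _)); rewrite !normrM.
apply: (@le_trans _ _ (`|c| * (e / K) + `|d| * (e / K))).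
  by rewrite lerD// ler_wpM2l// ltW.
rewrite -mulrDl mulrA ler_pdivrMr// mulrC ler_pM2l// /K; lra.
Unshelve. all: by end_near. Qed.

Lemma second_difference_eq (a b h S S' : R) : 0 < h ->
  S = a * h * h -> S' = b * h * h -> S = S' -> a = b.
Proof.
move=> h0 -> -> E; have hn : h != 0 by rewrite gt_eqF.
by apply: (mulIf hn); apply: (mulIf hn).
Qed.

(** Both mixed derivatives are limits of the same second difference quotient
    over shrinking squares. *)
Lemma class_C2_mixed u x t : class_C 2 u -> dx (dt u) x t = dt (dx u) x t.
Proof.
move=> Cu; have Cx := class_C_dx Cu; have Ct := class_C_dt Cu.
apply/eqP; rewrite -subr_eq0 -normr_le0; apply/ler_addgt0Pl => e e0.
rewrite addr0.
have e2 : 0 < e / 2 by lra.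
have [d1 d10 H1] := plane_continuousP (class_C_continuous (class_C_dx Ct) (x := (x, t))) e2.
have [d2 d20 H2] := plane_continuousP (class_C_continuous (class_C_dt Cx) (x := (x, t))) e2.
have [h [h0 hd1 hd2]] : exists h : R, [/\ 0 < h, h < d1 & h < d2].
  exists (Num.min d1 d2 / 2); have m0 : 0 < Num.min d1 d2 by rewrite lt_min d10 d20.
  have : Num.min d1 d2 / 2 < Num.min d1 d2 by lra.
  by rewrite lt_min => /andP[? ?]; split=> //; rewrite divr_gt0.
have [xi xiE Exi] := mvt_between x (x + h) (fun y => is_deriveB
  (class_C_is_derive_dx y (t + h) Cu) (class_C_is_derive_dx y t Cu)).
have [ta taE Eta] := mvt_between t (t + h) (fun s => class_C_is_derive_dt xi s Cx).
have [ta' taE' Eta'] := mvt_between t (t + h) (fun s => is_deriveB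
  (class_C_is_derive_dt (x + h) s Cu) (class_C_is_derive_dt x s Cu)).
have [xi' xiE' Exi'] := mvt_between x (x + h) (fun y => class_C_is_derive_dx y ta' Ct).
have hE (z : R) : z + h - z = h by rewrite addrC addKr.
rewrite !hE !(gtr0_norm h0) in xiE taE xiE' taE'.
rewrite !hE /= in Exi Eta Exi' Eta'.
have E : dt (dx u) xi ta = dx (dt u) xi' ta'.
  rewrite fctE Eta in Exi; rewrite fctE Exi' in Eta'.
  apply: (@second_difference_eq _ _ h _ _ h0 Exi Eta'); rewrite !fctE; ring.
have := H1 xi' ta' (le_lt_trans xiE' hd1) (le_lt_trans taE' hd1).
have := H2 xi ta (le_lt_trans xiE hd2) (le_lt_trans taE hd2) => /=.
rewrite E.
move: (dx (dt u) xi' ta') (dx (dt u) x t) (dt (dx u) x t) => a b c A B.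
have -> : b - c = (a - c) - (a - b) by ring.
by apply: (le_trans (ler_normB _ _)); lra.
Qed.

Let derive1_sub f g (x : R) : derivable f x 1 -> derivable g x 1 ->
  derive1 (fun y => f y - g y) x = derive1 f x - derive1 g x.
Proof. by move=> df dg; rewrite !derive1E -deriveB. Qed.

Let partial_sub (b : bool) u v (x t : R) :
  derivable (u ^~ t) x 1 /\ derivable (u x) t 1 ->
  derivable (v ^~ t) x 1 /\ derivable (v x) t 1 ->
  partial [:: b] (fun x t => u x t - v x t) x t = partial [:: b] u x t - partial [:: b] v x t.
Proof.
move=> [ux ut] [vx vt]; case: b.
  by rewrite /partial /= /dt; exact: derive1_sub.
by rewrite /partial /= /dx; exact: (@derive1_sub (u ^~ t) (v ^~ t) x ux vx).
Qed.

Lemma class_CB (k : nat) u v : class_C k u -> class_C k v ->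
  class_C k (fun x t => u x t - v x t) /\
  forall w, (size w <= k)%N -> partial w (fun x t => u x t - v x t) =
    (fun x t => partial w u x t - partial w v x t).
Proof.
move=> Cu Cv.
have H w : (size w <= k)%N -> partial w (fun x t => u x t - v x t) =
    (fun x t => partial w u x t - partial w v x t).
  elim: w => [//|b w IH] wk.
  have [_ /(_ wk) du] := Cu w (ltnW wk); have [_ /(_ wk) dv] := Cv w (ltnW wk).
  have E z : partial (b :: w) z = partial [:: b] (partial w z) by [].
  rewrite !E (IH (ltnW wk)); apply/funext => x; apply/funext => t.
  exact: partial_sub.
split; last exact: H.
move=> w wk; rewrite (H w wk).
have [] := Cu w wk; have [] := Cv w wk; move: (partial w u) (partial w v) => f g.
move=> cg dg cf df; split.
  by move=> p; apply: (@continuousB _ _ _ (fun p : R * R => f p.1 p.2)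
    (fun p : R * R => g p.1 p.2)); [exact: cf|exact: cg].
move=> wk' x t; have [fx ft] := df wk' x t; have [gx gt] := dg wk' x t.
by split; apply: derivableB.
Qed.

End PlaneCalculus.

(** * Square integrals and affine substitutions *)

Section AffineChange.
Context {R : realType}.
Local Notation mu := (@lebesgue_measure R).

Lemma measurable_affine (c d : R) (D : set R) : measurable_fun D (fun x : R => c * x + d).
Proof. by apply: measurable_funD => //; apply: measurable_funM. Qed.

(** By uniqueness of the Lebesgue measure: the rescaled image measure has the
    right value on half-open intervals. *)
Lemma lebesgue_measure_affine (c d : R) (A : set R) : c != 0 -> measurable A ->
  (`|c|%:E * mu ((fun x : R => (c * x + d)%R) @^-1` A) = mu A)%E.
Proof.
move=> c0 mA; pose phi : measurableTypeR R -> measurableTypeR R := fun x : R => c * x + d.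
have mphi : measurable_fun [set: measurableTypeR R] phi.
  exact: measurable_affine.
have [p pE] : exists p : {measure set (measurableTypeR R) -> \bar R},
    forall B, p B = mu (phi @^-1` B).
  by unshelve refine (ex_intro _
    (pushforward mu phi : {measure set (measurableTypeR R) -> \bar R}) _).
pose m := mscale (NngNum (normr_ge0 c)) p.
have mE B : m B = (`|c|%:E * mu (phi @^-1` B))%E by rewrite /m /mscale pE.
have muE := @lebesgue_measure_unique R (mscale (NngNum (normr_ge0 c)) p) _ A mA.
rewrite muE -?[mscale _ _]/m ?mE //= => _ [[a b]] _ <-; rewrite -?[mscale _ _]/m mE /= /phi.
have [ab|ba] := ltP a b; last first.
  rewrite set_itv_ge ?bnd_simp -?leNgt// preimage_set0 !measure0 mule0//.
case: (ltgtP c 0) c0 => // [c0 _|c0 _].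
  have -> : (fun x : R => c * x + d) @^-1` `]a, b] = `[(b - d) / c, (a - d) / c[%classic.
    apply/seteqP; split=> x /=; rewrite !in_itv/=.
      by rewrite ler_ndivrMr// ltr_ndivlMr//; move=> /andP[? ?]; apply/andP; lra.
    by rewrite ler_ndivrMr// ltr_ndivlMr//; move=> /andP[? ?]; apply/andP; lra.
  rewrite !lebesgue_measure_itv /= !lte_fin ab.
  rewrite ltr_ndivrMr// mulrVK ?unitfE ?lt_eqF// ltrD2r ab.
  rewrite -EFinB -EFinM ltr0_norm//; congr EFin; field.
  by rewrite lt_eqF.
have -> : (fun x : R => c * x + d) @^-1` `]a, b] = `](a - d) / c, (b - d) / c]%classic.
  apply/seteqP; split=> x /=; rewrite !in_itv/=.
    by rewrite ler_pdivlMr// ltr_pdivrMr//; move=> /andP[? ?]; apply/andP; lra.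
  by rewrite ler_pdivlMr// ltr_pdivrMr//; move=> /andP[? ?]; apply/andP; lra.
rewrite !lebesgue_measure_itv /= !lte_fin ab.
rewrite ltr_pdivrMr// mulrVK ?unitfE ?gt_eqF// ltrD2r ab.
rewrite -EFinB -EFinM gtr0_norm//; congr EFin; field.
by rewrite gt_eqF.
Qed.

Lemma ge0_integral_affine (c d : R) (A B : set R) (f : R -> \bar R) :
  c != 0 -> measurable A -> (forall x, B x <-> A (c * x + d)) ->
  measurable_fun A f -> (forall x, A x -> (0 <= f x)%E) ->
  (\int[mu]_(x in A) f x = `|c|%:E * \int[mu]_(x in B) f (c * x + d)%R)%E.
Proof.
move=> c0 mA BA mf f0; pose phi : measurableTypeR R -> measurableTypeR R := fun x : R => c * x + d.
have mphi : measurable_fun [set: measurableTypeR R] phi.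
  exact: measurable_affine.
have -> : B = phi @^-1` A by apply/seteqP; split => x /BA.
rewrite -[X in (_ * X)%E](@ge0_integral_pushforward _ _ _ _ R phi mphi mu A f mA mf);
  last by move=> y /[!inE]; exact: f0.
have [p pE] : exists p : {measure set (measurableTypeR R) -> \bar R},
    p = pushforward mu phi :> (set (measurableTypeR R) -> \bar R).
  by unshelve refine (ex_intro _
    (pushforward mu phi : {measure set (measurableTypeR R) -> \bar R}) _).
rewrite -pE -[X in (X%:E * _)%E]/((NngNum (normr_ge0 c))%:num).
rewrite -ge0_integral_mscale//.
apply: eq_measure_integral => /= C mC _; rewrite -(lebesgue_measure_affine d c0 mC).
by rewrite /mscale pE.
Qed.

End AffineChange.

Section SquareIntegral.
Context {R : realType}.
Local Notation mu := (@lebesgue_measure R).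
Implicit Types (A B : set R) (f g h : R -> R).

Definition sqint A f : \bar R := (\int[mu]_(x in A) (f x ^+ 2)%:E)%E.

Lemma sqint_ge0 A f : (0 <= sqint A f)%E.
Proof. by apply: integral_ge0 => x _; rewrite lee_fin sqr_ge0. Qed.

Lemma measurable_sqr A f : measurable_fun A f ->
  measurable_fun A (fun x => (f x ^+ 2)%:E).
Proof. by move=> mf; apply/measurable_EFinP; apply: measurable_funX. Qed.

Lemma eq_sqint A f g : {in A, f =1 g} -> sqint A f = sqint A g.
Proof. by move=> fg; apply: eq_integral => x xA; rewrite fg. Qed.

Lemma sqint_affine (c d : R) A B f : c != 0 -> measurable A ->
  (forall x, B x <-> A (c * x + d)) -> measurable_fun A f ->
  sqint A f = (`|c|%:E * sqint B (fun x => f (c * x + d)%R))%E.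
Proof.
move=> c0 mA BA mf.
by apply: (@ge0_integral_affine _ c d A B (fun x => (f x ^+ 2)%:E)) => //;
  [exact: measurable_sqr|move=> x _; rewrite lee_fin sqr_ge0].
Qed.

Lemma sqintZ A (k : R) f : measurable A -> measurable_fun A f ->
  sqint A (fun x => (k * f x)%R) = ((k ^+ 2)%:E * sqint A f)%E.
Proof.
move=> mA mf; rewrite /sqint -ge0_integralZl_EFin ?sqr_ge0//.
- by apply: eq_integral => x _; rewrite exprMn EFinM.
- by move=> x _; rewrite lee_fin sqr_ge0.
- exact: measurable_sqr.
Qed.

Lemma sqint_subset A B f : measurable A -> measurable B -> A `<=` B ->
  measurable_fun B f -> (sqint A f <= sqint B f)%E.
Proof.
move=> mA mB AB mf; apply: ge0_subset_integral => //; first exact: measurable_sqr.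
by move=> x _; rewrite lee_fin sqr_ge0.
Qed.

Lemma sqint_le_comb A (a b : R) f g h : measurable A ->
  measurable_fun A f -> measurable_fun A g -> measurable_fun A h ->
  0 <= a -> 0 <= b ->
  (forall x, A x -> f x ^+ 2 <= a * g x ^+ 2 + b * h x ^+ 2) ->
  (sqint A f <= a%:E * sqint A g + b%:E * sqint A h)%E.
Proof.
move=> mA mf mg mh a0 b0 fgh.
have sq0 (k : R -> R) : forall x, A x -> (0 <= (k x ^+ 2)%:E)%E.
  by move=> x _; rewrite lee_fin sqr_ge0.
rewrite /sqint -!ge0_integralZl_EFin//; try exact: measurable_sqr; try exact: sq0.
have mZ (c : R) (k : R -> R) : measurable_fun A k -> measurable_fun A (fun x => (c%:E * (k x ^+ 2)%:E)%E).
  by move=> mk; apply: measurable_funeM; exact: measurable_sqr.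
have Z0 (c : R) (k : R -> R) : 0 <= c -> forall x, A x -> (0 <= c%:E * (k x ^+ 2)%:E)%E.
  by move=> c0 x Ax; rewrite mule_ge0// ?lee_fin// sqr_ge0.
rewrite -ge0_integralD//; [|exact: Z0|exact: mZ|exact: Z0|exact: mZ].
apply: ge0_le_integral => //; try exact: sq0; try exact: measurable_sqr.
  by apply: emeasurable_funD; exact: mZ.
Qed.

Lemma sqintD_le A f g : measurable A -> measurable_fun A f -> measurable_fun A g ->
  (sqint A (fun x => (f x + g x)%R) <= 2%:E * sqint A f + 2%:E * sqint A g)%E.
Proof.
move=> mA mf mg; apply: sqint_le_comb => //; first exact: measurable_funD.
by move=> x _; have := sqr_ge0 (f x - g x); lra.
Qed.

Lemma sqintB_le A f g : measurable A -> measurable_fun A f -> measurable_fun A g ->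
  (sqint A (fun x => (f x - g x)%R) <= 2%:E * sqint A f + 2%:E * sqint A g)%E.
Proof.
move=> mA mf mg; apply: sqint_le_comb => //; first exact: measurable_funB.
by move=> x _; have := sqr_ge0 (f x + g x); lra.
Qed.

Lemma L2B A f g : measurable A -> L2 A f -> L2 A g -> L2 A (fun x => f x - g x).
Proof.
move=> mA [mf ff] [mg gg]; split; first exact: measurable_funB.
apply: (le_lt_trans (sqintB_le mA mf mg)).
by rewrite lte_add_pinfty// lte_mul_pinfty// ?sqint_ge0//.
Qed.

Lemma L2D A f g : measurable A -> L2 A f -> L2 A g -> L2 A (fun x => f x + g x).
Proof.
move=> mA [mf ff] [mg gg]; split; first exact: measurable_funD.
apply: (le_lt_trans (sqintD_le mA mf mg)).
by rewrite lte_add_pinfty// lte_mul_pinfty// ?sqint_ge0//.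
Qed.

Lemma L2Z A (k : R) f : measurable A -> L2 A f -> L2 A (fun x => k * f x).
Proof.
move=> mA [mf ff]; split; first exact: measurable_funM.
by have := sqintZ k mA mf; rewrite /sqint => ->; rewrite lte_mul_pinfty// ?sqr_ge0// lee_fin sqr_ge0.
Qed.

(** Pointwise, [|g^2 - f^2| <= e f^2 + (1 + 1/e) (g - f)^2]; this replaces the
    triangle inequality of the L^2 norm. *)
Lemma sqint_cvg (T : Type) (F : set_system T) {FF : Filter F} A f (g : T -> R -> R) :
  measurable A -> L2 A f -> (forall n, measurable_fun A (g n)) ->
  sqint A (fun x => g n x - f x) @[n --> F] --> 0%E ->
  sqint A (g n) @[n --> F] --> sqint A f.
Proof.
move=> mA [mf ff] mg gf.
have fE : sqint A f \is a fin_num by rewrite ge0_fin_numE// sqint_ge0.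
set x := fine (sqint A f); have xE : sqint A f = x%:E by rewrite /x fineK.
have x0 : 0 <= x by rewrite -lee_fin -xE sqint_ge0.
have /fine_cvgP[dfin dcvg] := gf.
rewrite xE; apply/fine_cvgP.
have key e n : 0 < e -> sqint A (fun x => g n x - f x) \is a fin_num ->
   sqint A (g n) \is a fin_num /\
   `|fine (sqint A (g n)) - x| <= e * x + (1 + e^-1) * fine (sqint A (fun x => g n x - f x)).
  move=> e0 dn; set d := fine (sqint A (fun x => g n x - f x)); have dE : sqint A (fun x => g n x - f x) = d%:E.
    by rewrite /d fineK.
  have mgf : measurable_fun A (fun x => g n x - f x) by exact: measurable_funB.
  have ie : 0 < e^-1 by rewrite invr_gt0.
  have ee : e * e^-1 = 1 by rewrite divff// gt_eqF.
  have H1 : (sqint A (g n) <= (1 + e)%:E * sqint A f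
      + (1 + e^-1)%:E * sqint A (fun x => (g n x - f x)%R))%E.
    apply: sqint_le_comb => //; [lra|lra|move=> y _].
    have := sqr_ge0 (e * f y - (g n y - f y)).
    have -> : g n y ^+ 2 = f y ^+ 2 + 2 * f y * (g n y - f y) + (g n y - f y) ^+ 2 by ring.
    set a := f y; set b := g n y - a => H.
    have : 0 <= e^-1 * (e * a - b) ^+ 2 by rewrite mulr_ge0// ltW.
    have -> : e^-1 * (e * a - b) ^+ 2 = (e * e^-1) * e * a ^+ 2 - 2 * (e * e^-1) * a * b + e^-1 * b ^+ 2 by ring.
    rewrite ee; lra.
  have gfin : sqint A (g n) \is a fin_num.
    rewrite ge0_fin_numE ?sqint_ge0//; apply: (le_lt_trans H1).
    by rewrite xE dE -!EFinM -EFinD ltry.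
  set z := fine (sqint A (g n)); have zE : sqint A (g n) = z%:E by rewrite /z fineK.
  have H2 : (sqint A f <= 1%:E * (1%:E * sqint A (g n) + e%:E * sqint A f)
      + e^-1%:E * sqint A (fun x => (g n x - f x)%R))%E.
    rewrite mul1e.
    (* A square equal to [g^2 + e f^2], for two uses of [sqint_le_comb]. *)
    pose k := fun y => Num.sqrt (1 * g n y ^+ 2 + e * f y ^+ 2).
    have k0 y : 0 <= 1 * g n y ^+ 2 + e * f y ^+ 2.
      by rewrite addr_ge0// mulr_ge0// ?sqr_ge0// ltW.
    have mk : measurable_fun A k.
      apply: (measurableT_comp (continuous_measurable_fun (@sqrt_continuous R))) => //.
      apply: measurable_funD; apply: measurable_funM => //; exact: measurable_funX.
    apply: (@le_trans _ _ (1%:E * sqint A k + e^-1%:E * sqint A (fun x => (g n x - f x)%R))%E).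
      apply: sqint_le_comb => //; first exact: ltW.
      move=> y _; rewrite /k sqr_sqrtr ?k0//.
      set a := f y; set b := g n y - a.
      have -> : g n y ^+ 2 = a ^+ 2 + 2 * a * b + b ^+ 2 by rewrite /b; ring.
      have : 0 <= e^-1 * (e * a + b) ^+ 2 by rewrite mulr_ge0// ?sqr_ge0// ltW.
      have -> : e^-1 * (e * a + b) ^+ 2 = (e * e^-1) * e * a ^+ 2 + 2 * (e * e^-1) * a * b + e^-1 * b ^+ 2 by ring.
      rewrite ee; have := sqr_ge0 b; lra.
    rewrite leeD2r// mul1e; apply: sqint_le_comb => //; first exact: ltW.
    by move=> y _; rewrite /k sqr_sqrtr ?k0.
  move: H1 H2; rewrite xE zE dE !mul1e -!EFinM -!EFinD !lee_fin => H1 H2.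
  have d0 : 0 <= d by rewrite -lee_fin -dE sqint_ge0.
  by split=> //; rewrite ler_norml; apply/andP; split; lra.
split.
  by near=> n; apply: (key 1 n ltr01 _).1; near: n.
apply/cvgrPdist_le => eta eta0.
pose e := eta / (2 * (x + 1)).
have e0 : 0 < e by rewrite divr_gt0// mulr_gt0//; lra.
have c0 : 0 < 1 + e^-1 by rewrite addr_gt0// invr_gt0.
have x1 : 0 < x + 1 by rewrite ltr_wpDl.
near=> n.
have dn : sqint A (fun x => g n x - f x) \is a fin_num by near: n.
have [_ H] := key e n e0 dn.
rewrite distrC; apply: (le_trans H).
have : fine (sqint A (fun x => g n x - f x)) <= eta / 2 / (1 + e^-1).
  near: n; move/cvgr0Pnorm_le: dcvg => /(_ (eta / 2 / (1 + e^-1))).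
  rewrite divr_gt0 ?divr_gt0// => /(_ isT); apply: filterS => n /=.
  by apply: le_trans; exact: ler_norm.
rewrite ler_pdivlMr// mulrC => H'.
have : e * x <= eta / 2.
  have -> : e * x = eta / 2 * (x / (x + 1)) by rewrite /e; field; exact: lt0r_neq0.
  by rewrite ler_piMr ?divr_ge0 ?(ltW eta0)// ler_pdivrMr// mul1r lerDl.
by move=> H''; rewrite [eta]splitr lerD.
Unshelve. all: by end_near. Qed.

End SquareIntegral.

(** * Characteristics and reflections *)

Definition trace_on {R : realType} (c : R) (u : R -> R -> R) : R -> R :=
  fun t => dx u (c * t) t.

Section Characteristics.
Context {R : realType}.
Variables (l1 l2 t0 : R).
Hypotheses (l1_ge0 : 0 <= l1) (l1_lt1 : l1 < 1) (l2_ge0 : 0 <= l2) (l2_lt1 : l2 < 1).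
Hypothesis t0_gt0 : 0 < t0.

Local Ltac slra :=
  move: (l1_ge0) (l1_lt1) (l2_ge0) (l2_lt1) (t0_gt0) => ? ? ? ? ?; lra.

Lemma derive_eq0_right (f : R -> R) (x d : R) :
  is_derive x 1 f d -> (forall y, x <= y -> f y = 0) -> d = 0.
Proof.
move=> [df <-] f0; have := cvg_dnbhs_at_right df; move=> H.
suff H0 : h^-1 *: ((f \o shift x) (h *: 1) - f x) @[h --> (0 : R)^'+] --> (0 : R).
  exact: (cvg_unique (@Rhausdorff R) H H0).
apply: cvg_near_cst; near=> h.
have h0 : 0 < h by near: h; exact: nbhs_right_gt.
rewrite /= !f0 ?subrr ?scaler0//.
by rewrite [h *: 1]mulr1 ler_wpDl// ltW.
Unshelve. all: by end_near. Qed.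

Lemma class_C_line_continuous (k : nat) (u : R -> R -> R) (a b c d : R) :
  class_C k u -> continuous (fun s => u (a + b * s) (c + d * s)).
Proof.
move=> /class_C_continuous Cu s.
have aff (p q : R) : (fun s => p + q * s) x @[x --> s] --> p + q * s.
  by apply: cvgD; [exact: cvg_cst|apply: cvgM; [exact: cvg_cst|exact: cvg_id]].
apply: (@continuous_comp _ _ _ (fun s => (a + b * s, c + d * s))
  (fun p : R * R => u p.1 p.2)); last exact: Cu.
have H := cvg_pair (aff a b) (aff c d). exact: H.
Qed.

(** Along a line of slope [- e] the derivative of [u_t + e u_x] is
    [u_tt - e^2 u_xx], the mixed terms cancelling; [e = 1] and [e = -1] give the
    two families of characteristics. *)
Lemma characteristic_const (u : R -> R -> R) (e x t r : R) :
  class_C 2 u -> (forall x t, domain l1 l2 t0 (x, t) -> wave_op u x t = 0) ->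
  e * e = 1 -> 0 <= r ->
  (forall s, 0 < s < r -> domain l1 l2 t0 (x - e * s, t + s)) ->
  dt u (x - e * r) (t + r) + e * dx u (x - e * r) (t + r) =
  dt u x t + e * dx u x t.
Proof.
move=> Cu weq ee r0 dom; have Cx := class_C_dx Cu; have Ct := class_C_dt Cu.
pose W s := dt u (x + (- e) * s) (t + 1 * s) + e * dx u (x + (- e) * s) (t + 1 * s).
have cW : continuous W.
  move=> s; apply: cvgD; first exact: class_C_line_continuous Ct _.
  by apply: cvgM; [exact: cvg_cst|exact: class_C_line_continuous Cx _].
have dW s : s \in `]0, r[ -> is_derive s 1 W 0.
  rewrite in_itv /= => /dom; set y := x - e * s; set tt := t + s => yt.
  have E1 : x + - e * s = y by rewrite mulNr.
  have E2 : t + 1 * s = tt by rewrite mul1r.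
  have H1 := class_C1_is_derive_line x t (- e) 1 s Ct.
  have H2 := class_C1_is_derive_line x t (- e) 1 s Cx.
  rewrite E1 E2 in H1 H2.
  have D := is_deriveD H1 (is_deriveZ e H2).
  apply: (@is_derive_eq _ _ _ _ _ _ _ _ D); rewrite -[_ *: _]/(_ * _).
  have := weq y tt yt; rewrite /wave_op (class_C2_mixed y tt Cu).
  move: (dt (dt u) y tt) (dx (dx u) y tt) (dt (dx u) y tt) => a b c /eqP.
  rewrite subr_eq0 => /eqP ->.
  have -> : - e * c + 1 * b + e * (- e * b + 1 * c) = b - (e * e) * b by ring.
  by rewrite ee mul1r subrr.
have [c _] := MVT_segment r0 dW (continuous_subspaceT cW).
rewrite mul0r => /eqP; rewrite subr_eq0 => /eqP.
by rewrite /W !mulr0 !addr0 !mul1r !mulNr.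
Qed.

(** Both boundaries are slower than waves, so a characteristic stays in the
    domain between its end points; likewise for the other family. *)
Lemma right_moving_const (u : R -> R -> R) (x t r : R) :
  classical_solution l1 l2 t0 u -> t0 <= t -> 0 <= r ->
  - l1 * t <= x -> x + r <= l2 * (t + r) ->
  dt u (x + r) (t + r) - dx u (x + r) (t + r) = dt u x t - dx u x t.
Proof.
move=> [Cu weq _] tt r0 xl xr.
have ee : (-1) * (-1) = 1 :> R by rewrite mulN1r opprK.
have := @characteristic_const u (-1) x t r Cu weq ee r0.
rewrite !mulN1r opprK; apply.
move=> s /andP[s0 sr]; rewrite /domain /= /I_ /= in_itv /=; split; first slra.
rewrite mulN1r opprK; apply/andP; split.
  have := mulr_ge0 l1_ge0 (ltW s0); slra.
have : (1 - l2) * s < (1 - l2) * r by rewrite ltr_pM2l ?subr_gt0.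
slra.
Qed.

Lemma left_moving_const (u : R -> R -> R) (x t r : R) :
  classical_solution l1 l2 t0 u -> t0 <= t -> 0 <= r ->
  x <= l2 * t -> - l1 * (t + r) <= x - r ->
  dt u (x - r) (t + r) + dx u (x - r) (t + r) = dt u x t + dx u x t.
Proof.
move=> [Cu weq _] tt r0 xr xl.
have := @characteristic_const u 1 x t r Cu weq (mulr1 _) r0.
rewrite !mul1r; apply.
move=> s /andP[s0 sr]; rewrite /domain /= /I_ /= in_itv /=; split; first slra.
rewrite mul1r; apply/andP; split; last first.
  have := mulr_ge0 l2_ge0 (ltW s0); slra.
have : (1 - l1) * s < (1 - l1) * r by rewrite ltr_pM2l ?subr_gt0.
slra.
Qed.

(** The derivative of [u] along the boundary of slope [c] vanishes; only times
    after [t] are used, so that the initial time is covered. *)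
Lemma boundary_dt (u : R -> R -> R) (c t : R) : class_C 1 u ->
  (forall s, t <= s -> u (c * s) s = 0) ->
  dt u (c * t) t = - c * dx u (c * t) t.
Proof.
move=> Cu u0; have := @class_C1_is_derive_line R u 0 0 c 1 t Cu.
rewrite !add0r mul1r => H.
have := derive_eq0_right H; rewrite mul1r mulNr => E.
apply/eqP; rewrite -addr_eq0 addrC E// => y ty.
by rewrite !add0r mul1r u0.
Qed.

Section ClassicalSolution.
Variable u : R -> R -> R.
Hypothesis cu : classical_solution l1 l2 t0 u.

Local Notation Y := (trace_on l2 u).
Local Notation Z := (trace_on (- l1) u).
Local Notation al := (alpha_l l1 l2).
Local Notation be := (beta_l l1 l2).

Let Cu : class_C 2 u. Proof. by case: cu. Qed.

Lemma dt_right (t : R) : t0 <= t -> dt u (l2 * t) t = - l2 * Y t.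
Proof.
move=> tt; rewrite /trace_on /=; apply: boundary_dt; first exact: class_C_le Cu.
by move=> s ts; case: cu => _ _ /(_ s (le_trans tt ts))[].
Qed.

Lemma dt_left (t : R) : t0 <= t -> dt u (- l1 * t) t = l1 * Z t.
Proof.
move=> tt; rewrite /trace_on /= -[X in _ = X * _]opprK; apply: boundary_dt.
  exact: class_C_le Cu.
by move=> s ts; case: cu => _ _ /(_ s (le_trans tt ts))[].
Qed.

(** The characteristic through [(l2 t, t)], followed backwards down to time [t0];
    the bound on [t] says that it starts in the initial interval. *)
Lemma right_trace_data (t : R) : t0 <= t -> (1 - l2) * t <= (1 + l1) * t0 ->
  dt u (t0 - (1 - l2) * t) t0 - dx u (t0 - (1 - l2) * t) t0 = - (1 + l2) * Y t.
Proof.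
move=> tt ta.
have := @right_moving_const u (t0 - (1 - l2) * t) t0 (t - t0) cu (lexx _).
have -> : t0 + (t - t0) = t by ring.
have -> : t0 - (1 - l2) * t + (t - t0) = l2 * t by ring.
move=> <- //; [|slra|slra].
rewrite dt_right// -/(Y t); move: (Y t) => y; ring.
Qed.

Lemma left_trace_data (s : R) : t0 <= s -> (1 - l1) * s <= (1 + l2) * t0 ->
  dt u ((1 - l1) * s - t0) t0 + dx u ((1 - l1) * s - t0) t0 = (1 + l1) * Z s.
Proof.
move=> ts sb.
have := @left_moving_const u ((1 - l1) * s - t0) t0 (s - t0) cu (lexx _).
have -> : t0 + (s - t0) = s by ring.
have -> : (1 - l1) * s - t0 - (s - t0) = - l1 * s by ring.
move=> <- //; [|slra|slra].
rewrite dt_left// -/(Z s); move: (Z s) => y; ring.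
Qed.

Let l2n0 : 1 - l2 != 0. Proof. by rewrite gt_eqF ?subr_gt0. Qed.
Let l1n0 : 1 - l1 != 0. Proof. by rewrite gt_eqF ?subr_gt0. Qed.

Lemma alpha_mul : (1 - l2) * al = 1 + l1.
Proof. by rewrite /alpha_l mulrC divfK. Qed.

Lemma beta_mul : (1 - l1) * be = 1 + l2.
Proof. by rewrite /beta_l mulrC divfK. Qed.

Lemma alpha_ge1 : 1 <= al.
Proof.
have H : 1 * (1 - l2) <= 1 + l1 by move: (l1_ge0) (l2_ge0) => ? ?; lra.
by rewrite /alpha_l ler_pdivlMr ?subr_gt0.
Qed.

Lemma beta_ge1 : 1 <= be.
Proof.
have H : 1 * (1 - l1) <= 1 + l2 by move: (l1_ge0) (l2_ge0) => ? ?; lra.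
by rewrite /beta_l ler_pdivlMr ?subr_gt0.
Qed.

(** The right-moving characteristic from the left boundary at time [s] meets the
    right boundary at time [alpha s]. *)
Lemma right_trace_left (s : R) : t0 <= s -> (1 + l2) * Y (al * s) = (1 - l1) * Z s.
Proof.
move=> ts; have a1 := alpha_ge1; have aE := alpha_mul.
have s0 : 0 <= s by slra.
have as0 : s <= al * s by rewrite ler_peMl.
have := @right_moving_const u (- l1 * s) s (al * s - s) cu ts.
have -> : s + (al * s - s) = al * s by ring.
have -> : - l1 * s + (al * s - s) = l2 * (al * s).
  have : (1 - l2) * al * s = (1 + l1) * s by rewrite aE.
  by slra.
move=> H; have := H; rewrite subr_ge0 => /(_ as0 (lexx _) (lexx _)).
rewrite dt_left// dt_right; last slra.
rewrite -/(Y (al * s)) -/(Z s); move: (Y _) (Z s) => y z; slra.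
Qed.

(** The left-moving characteristic from the right boundary at time [r] meets the
    left boundary at time [beta r]. *)
Lemma left_trace_right (r : R) : t0 <= r -> (1 + l1) * Z (be * r) = (1 - l2) * Y r.
Proof.
move=> tr; have b1 := beta_ge1; have bE := beta_mul.
have r0 : 0 <= r by slra.
have br0 : r <= be * r by rewrite ler_peMl.
have := @left_moving_const u (l2 * r) r (be * r - r) cu tr.
have -> : r + (be * r - r) = be * r by ring.
have -> : l2 * r - (be * r - r) = - l1 * (be * r).
  have : (1 - l1) * be * r = (1 + l2) * r by rewrite bE.
  by slra.
move=> H; have := H; rewrite subr_ge0 => /(_ br0 (lexx _) (lexx _)).
rewrite dt_left ?dt_right//; last slra.
rewrite -/(Y r) -/(Z (be * r)); move: (Y _) (Z _) => y z; slra.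
Qed.

(** Self-similarity: one reflection at each boundary multiplies times by
    [al * be] and divides the trace by the same number. *)
Lemma right_trace_period (r : R) : t0 <= r -> (al * be) * Y (al * be * r) = Y r.
Proof.
move=> tr; have b1 := beta_ge1; have r0 : 0 <= r by slra.
have br0 : r <= be * r by rewrite ler_peMl.
have H1 := right_trace_left (le_trans tr br0).
have H2 := left_trace_right tr.
rewrite -[al * be * r]mulrA.
move: (Y (al * (be * r))) (Y r) (Z (be * r)) H1 H2 => y y' z H1 H2.
have ha : al = (1 + l1) / (1 - l2) by [].
have hb : be = (1 + l2) / (1 - l1) by [].
have l2p : 1 + l2 != 0 by rewrite gt_eqF// ltr_wpDr.
have -> : y = (1 - l1) * z / (1 + l2) by rewrite -H1; field.
have -> : y' = (1 + l1) * z / (1 - l2) by rewrite H2; field.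
by rewrite ha hb; field; rewrite ?l1n0 ?l2n0 ?l2p.
Qed.

End ClassicalSolution.

End Characteristics.

(** * The two inequalities for classical solutions *)

Section SquareIntegralItv.
Context {R : realType}.
Local Notation mu := (@lebesgue_measure R).
Implicit Types (f g : R -> R).

Lemma sqint_itv_cc (a b : R) f : measurable_fun `]a, b[ f ->
  sqint `]a, b[ f = sqint `[a, b] f.
Proof.
by move=> mf; rewrite /sqint; have := @integral_itv_bndoo R a b _ true false (measurable_sqr mf).
Qed.

Lemma sqint_itv_split (a b c : R) f : a <= b -> b <= c ->
  measurable_fun `[a, c] f ->
  sqint `[a, c] f = (sqint `[a, b] f + sqint `[b, c] f)%E.
Proof.
move=> ab bc mf.
have mbc : measurable_fun `[b, c] f.
  by apply: measurable_funS mf => //; apply: subset_itv; rewrite bnd_simp.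
have mbc' : measurable_fun `]b, c] f.
  by apply: measurable_funS mbc => //; apply: subset_itv; rewrite bnd_simp.
have E : (`[a, c]%classic : set R) = `[a, b]%classic `|` `]b, c]%classic.
  rewrite -(itv_bndbnd_setU (x := BRight b))// bnd_simp.
have -> : sqint `[b, c] f = sqint `]b, c] f.
  by rewrite /sqint -integral_itv_obnd_cbnd//; exact: measurable_sqr.
rewrite /sqint E ge0_integral_setU//.
- by rewrite -E; exact: measurable_sqr.
- by move=> x _; rewrite lee_fin sqr_ge0.
- apply/disj_setPRL => x /=; rewrite !in_itv /= => /andP[bx _] /andP[_ xb].
  by rewrite ltNge xb in bx.
Qed.

Lemma sqint_continuous_fin (a b : R) f : continuous f ->
  sqint `[a, b] f \is a fin_num.
Proof.
move=> cf; apply: integrable_fin_num => //.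
apply: (@continuous_compact_integrable R (fun x => f x ^+ 2)).
  exact: segment_compact.
by apply: continuous_subspaceT => x; apply: cvgM; exact: cf.
Qed.

(** Passes from the pair [(u_x, u_t)] of the energy to the pair
    [(u_t - u_x, u_t + u_x)] of the characteristics. *)
Lemma sqint_parallelogram (A : set R) f g : measurable A ->
  measurable_fun A f -> measurable_fun A g ->
  (sqint A (fun x => (g x - f x)%R) + sqint A (fun x => (g x + f x)%R) =
   2%:E * (sqint A f + sqint A g))%E.
Proof.
move=> mA mf mg.
have sq0 (k : R -> R) : forall x, A x -> (0 <= (k x ^+ 2)%:E)%E.
  by move=> x _; rewrite lee_fin sqr_ge0.
have mB : measurable_fun A (fun x => g x - f x) by exact: measurable_funB.
have mD : measurable_fun A (fun x => g x + f x) by exact: measurable_funD.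
rewrite /sqint -!ge0_integralD//; try exact: measurable_sqr; try exact: sq0.
rewrite -ge0_integralZl_EFin//.
- by apply: eq_integral => x _; rewrite -!EFinD -EFinM; congr EFin; ring.
- by move=> x Ax; rewrite adde_ge0// sq0.
- by apply: emeasurable_funD; exact: measurable_sqr.
Qed.

End SquareIntegralItv.

Section ClassicalInequalities.
Context {R : realType}.
Variables (l1 l2 t0 : R).
Hypotheses (l1_ge0 : 0 <= l1) (l1_lt1 : l1 < 1) (l2_ge0 : 0 <= l2) (l2_lt1 : l2 < 1).
Hypothesis l12_gt0 : 0 < l1 + l2.
Hypothesis t0_gt0 : 0 < t0.

Local Ltac slra :=
  move: (l1_ge0) (l1_lt1) (l2_ge0) (l2_lt1) (l12_gt0) (t0_gt0) => ? ? ? ? ? ?; lra.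

Local Notation al := (alpha_l l1 l2).
Local Notation be := (beta_l l1 l2).

(** Weights with which the trace measures the data: [trace_gain] for a direct
    ray, [trace_gain * trace_skew] for a ray reflected once on the left. *)
Definition trace_gain : R := (1 - l2) * (1 + l2) ^+ 2.
Definition trace_skew : R := (1 + l1) / (1 - l1).

Lemma trace_gain_gt0 : 0 < trace_gain.
Proof. by rewrite mulr_gt0 ?exprn_gt0 ?subr_gt0// ltr_wpDr. Qed.

Lemma trace_skew_ge1 : 1 <= trace_skew.
Proof.
have H : 1 * (1 - l1) <= 1 + l1 by move: (l1_ge0) => ?; lra.
by rewrite /trace_skew ler_pdivlMr ?subr_gt0.
Qed.

Lemma period_gt1 : 1 < al * be.
Proof.
have H : (1 - l2) * (1 - l1) < (1 + l1) * (1 + l2) by move: (l12_gt0) => ?; lra.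
by rewrite /alpha_l /beta_l mulf_div ltr_pdivlMr ?mulr_gt0 ?subr_gt0// mul1r.
Qed.

Section Solution.
Variable u : R -> R -> R.
Hypothesis cu : classical_solution l1 l2 t0 u.

Local Notation Y := (trace_on l2 u).
Local Notation Z := (trace_on (- l1) u).
Local Notation J := (`[- l1 * t0, l2 * t0]%classic : set R).

Let Cu : class_C 2 u. Proof. by case: cu. Qed.

Lemma right_trace_continuous : continuous Y.
Proof.
have -> : Y = (fun t => dx u (0 + l2 * t) (0 + 1 * t)).
  by apply/funext => t; rewrite !add0r mul1r.
exact: class_C_line_continuous (class_C_dx Cu).
Qed.

Lemma left_trace_continuous : continuous Z.
Proof.
have -> : Z = (fun t => dx u (0 + (- l1) * t) (0 + 1 * t)).
  by apply/funext => t; rewrite !add0r mul1r.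
exact: class_C_line_continuous (class_C_dx Cu).
Qed.

Lemma initial_dx_continuous : continuous (fun x => dx u x t0).
Proof.
have -> : (fun x => dx u x t0) = (fun x => dx u (0 + 1 * x) (t0 + 0 * x)).
  by apply/funext => x; rewrite mul0r addr0 add0r mul1r.
exact: class_C_line_continuous (class_C_dx Cu).
Qed.

Lemma initial_dt_continuous : continuous (fun x => dt u x t0).
Proof.
have -> : (fun x => dt u x t0) = (fun x => dt u (0 + 1 * x) (t0 + 0 * x)).
  by apply/funext => x; rewrite mul0r addr0 add0r mul1r.
exact: class_C_line_continuous (class_C_dt Cu).
Qed.

Let mcont (A : set R) (f : R -> R) : continuous f -> measurable_fun A f.
Proof. by move=> cf; apply: measurable_funTS; exact: continuous_measurable_fun. Qed.

(** The substitution [x = t0 - (1 - l2) t] maps [[t0, alpha t0]] onto the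
    closed initial interval. *)
Lemma sqint_right_data :
  sqint J (fun x => dt u x t0 - dx u x t0) = (trace_gain%:E * sqint `[t0, (al * t0)%R] Y)%E.
Proof.
have p2 : 0 < 1 - l2 by slra.
have aE := alpha_mul l1 l2_lt1.
rewrite (@sqint_affine R (- (1 - l2)) t0 J `[t0, al * t0]); last 4 first.
- by rewrite oppr_eq0 gt_eqF.
- by [].
- move=> x; rewrite /= !in_itv /=.
  have -> : (x <= al * t0) = ((1 - l2) * x <= (1 + l1) * t0).
    by rewrite -aE -[_ * al * t0]mulrA ler_pM2l.
  have -> : (t0 <= x) = ((1 - l2) * t0 <= (1 - l2) * x) by rewrite ler_pM2l.
  split=> /andP[? ?]; apply/andP; split; lra.
- by apply: mcont => x; apply: cvgB; [exact: initial_dt_continuous|exact: initial_dx_continuous].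
rewrite normrN (gtr0_norm p2) (@eq_sqint R _ _ (fun t => - (1 + l2) * Y t)); last first.
  move=> t; rewrite inE /= in_itv /= => /andP[tt ta].
  have ta' : (1 - l2) * t <= (1 + l1) * t0 by rewrite -aE -[_ * al * t0]mulrA ler_pM2l.
  rewrite -(right_trace_data l1_ge0 l1_lt1 l2_ge0 l2_lt1 t0_gt0 cu tt ta').
  by have -> : - (1 - l2) * t + t0 = t0 - (1 - l2) * t by ring.
rewrite sqintZ//; last exact: mcont right_trace_continuous.
by rewrite muleA -EFinM sqrrN.
Qed.

Lemma sqint_left_data :
  sqint J (fun x => dt u x t0 + dx u x t0) =
  (((1 - l1) * (1 + l1) ^+ 2)%:E * sqint `[t0, (be * t0)%R] Z)%E.
Proof.
have p1 : 0 < 1 - l1 by slra.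
have bE := beta_mul l2 l1_lt1.
rewrite (@sqint_affine R (1 - l1) (- t0) J `[t0, be * t0]); last 4 first.
- by rewrite gt_eqF.
- by [].
- move=> x; rewrite /= !in_itv /=.
  have -> : (x <= be * t0) = ((1 - l1) * x <= (1 + l2) * t0).
    by rewrite -bE -[_ * be * t0]mulrA ler_pM2l.
  have -> : (t0 <= x) = ((1 - l1) * t0 <= (1 - l1) * x) by rewrite ler_pM2l.
  split=> /andP[? ?]; apply/andP; split; lra.
- by apply: mcont => x; apply: cvgD; [exact: initial_dt_continuous|exact: initial_dx_continuous].
rewrite (gtr0_norm p1) (@eq_sqint R _ _ (fun t => (1 + l1) * Z t)); last first.
  move=> t; rewrite inE /= in_itv /= => /andP[tt ta].
  have ta' : (1 - l1) * t <= (1 + l2) * t0 by rewrite -bE -[_ * be * t0]mulrA ler_pM2l.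
  by rewrite -(left_trace_data l1_ge0 l1_lt1 l2_ge0 l2_lt1 t0_gt0 cu tt ta').
rewrite sqintZ//; last exact: mcont left_trace_continuous.
by rewrite muleA -EFinM.
Qed.

Let al_gt0 : 0 < al.
Proof. exact: lt_le_trans ltr01 (alpha_ge1 l1_ge0 l2_ge0 l2_lt1). Qed.

Lemma sqint_reflected :
  sqint `[(al * t0)%R, (al * be * t0)%R] Y =
  ((al * ((1 - l1) / (1 + l2)) ^+ 2)%:E * sqint `[t0, (be * t0)%R] Z)%E.
Proof.
have a0 := al_gt0; have l2p : 0 < 1 + l2 by slra.
rewrite (@sqint_affine R al 0 _ `[t0, be * t0]); last 4 first.
- by rewrite gt_eqF.
- by [].
- move=> x; rewrite /= !in_itv /= addr0 ler_pM2l// -[al * be * t0]mulrA ler_pM2l//.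
- exact: mcont right_trace_continuous.
rewrite (gtr0_norm a0) (@eq_sqint R _ _ (fun t => (1 - l1) / (1 + l2) * Z t)); last first.
  move=> t; rewrite inE /= in_itv /= => /andP[tt _].
  have := right_trace_left l1_ge0 l1_lt1 l2_ge0 l2_lt1 t0_gt0 cu tt.
  rewrite addr0; move: (Y _) (Z _) => y z H.
  by rewrite mulrAC -H mulrC mulKf// gt_eqF.
rewrite sqintZ//; last exact: mcont left_trace_continuous.
by rewrite muleA -EFinM.
Qed.

Lemma sqint_left_data_right :
  sqint J (fun x => dt u x t0 + dx u x t0) =
  ((trace_gain * trace_skew)%:E * sqint `[(al * t0)%R, (al * be * t0)%R] Y)%E.
Proof.
rewrite sqint_left_data sqint_reflected muleA -EFinM; congr (_%:E * _)%E.
rewrite /trace_gain /trace_skew /alpha_l.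
have p1 : 1 - l1 != 0 by rewrite gt_eqF// subr_gt0.
have p2 : 1 - l2 != 0 by rewrite gt_eqF// subr_gt0.
have p3 : 1 + l2 != 0 by rewrite gt_eqF// ltr_wpDr.
by field; rewrite p1 p2 p3.
Qed.

Lemma sqint_shifted (s : R) :
  sqint `[(al * be * t0)%R, (al * be * s)%R] Y = ((al * be)^-1%:E * sqint `[t0, s] Y)%E.
Proof.
have r1 : 0 < al * be by exact: lt_trans ltr01 period_gt1.
rewrite (@sqint_affine R (al * be) 0 _ `[t0, s]); last 4 first.
- by rewrite gt_eqF.
- by [].
- by move=> x; rewrite /= !in_itv /= addr0 !ler_pM2l.
- exact: mcont right_trace_continuous.
rewrite (gtr0_norm r1) (@eq_sqint R _ _ (fun t => (al * be)^-1 * Y t)); last first.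
  move=> t; rewrite inE /= in_itv /= => /andP[tt _].
  have := right_trace_period l1_ge0 l1_lt1 l2_ge0 l2_lt1 t0_gt0 cu tt.
  by rewrite addr0 => <-; rewrite mulKf// gt_eqF.
rewrite sqintZ//; last exact: mcont right_trace_continuous.
rewrite muleA -EFinM; congr (_%:E * _)%E.
by rewrite expr2 mulrA divff ?mul1r// gt_eqF.
Qed.

Definition data_norm (f g : R -> R) : \bar R := (sqint J f + sqint J g)%E.

Local Notation N0 := (data_norm (dx u ^~ t0) (dt u ^~ t0)).
Local Notation P := (sqint `[t0, (al * be * t0)%R] Y).

Let Pfin (a b : R) : sqint `[a, b] Y \is a fin_num.
Proof. exact: sqint_continuous_fin right_trace_continuous. Qed.

Let t0al : t0 <= al * t0.
Proof. by rewrite ler_peMl ?(ltW t0_gt0)// alpha_ge1. Qed.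

Let alrho : al * t0 <= al * be * t0.
Proof.
have -> : al * be * t0 = be * (al * t0) by rewrite mulrA [be * al]mulrC.
apply: ler_peMl; first exact: mulr_ge0 (ltW al_gt0) (ltW t0_gt0).
exact: beta_ge1 l1_ge0 l1_lt1 l2_ge0.
Qed.

(** In one period the trace sees both families of characteristics, each with
    its own weight; the two bounds use the smaller and the larger one. *)
Lemma data_norm_period :
  (trace_gain%:E * P <= 2%:E * N0 <= (trace_gain * trace_skew)%:E * P)%E.
Proof.
rewrite /data_norm -sqint_parallelogram//; last 2 first.
- exact: mcont initial_dx_continuous.
- exact: mcont initial_dt_continuous.
rewrite sqint_right_data sqint_left_data_right.
rewrite (sqint_itv_split t0al alrho); last exact: mcont right_trace_continuous.
have := sqint_ge0 `[t0, al * t0] Y; have := sqint_ge0 `[al * t0, al * be * t0] Y.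
move: (Pfin t0 (al * t0)) (Pfin (al * t0) (al * be * t0)).
move: (sqint `[t0, al * t0] Y) (sqint `[al * t0, al * be * t0] Y) => A B /fineK <- /fineK <-.
move: (fine A) (fine B) => a b; rewrite !lee_fin => b0 a0.
have g0 := trace_gain_gt0; have k1 := trace_skew_ge1.
move: trace_gain trace_skew g0 k1 => g k g0 k1.
have ga := mulr_ge0 (ltW g0) a0; have gb := mulr_ge0 (ltW g0) b0.
have k1' : 0 <= k - 1 by lra.
have := mulr_ge0 k1' ga; have := mulr_ge0 k1' gb => H1 H2.
by apply/andP; split; lra.
Qed.

(** By self-similarity, what follows the first period contributes at most
    [(al * be)^-1] times the whole integral, and is absorbed; hence a bound that is
    uniform in the length of the time interval. *)
Lemma sqint_right_trace_le (s : R) : t0 <= s ->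
  (sqint `[t0, s] Y <= ((1 - (al * be)^-1)^-1)%:E * P)%E.
Proof.
move=> ts; have r1 := period_gt1; have r0 : 0 < al * be by exact: lt_trans ltr01 r1.
have ir : (al * be)^-1 < 1 by rewrite invf_lt1.
have mY (A : set R) : measurable_fun A Y by exact: mcont right_trace_continuous.
have le_r (x : R) : 0 <= x -> x <= al * be * x by move=> x0; rewrite ler_peMl// ltW.
have s0 : 0 <= s by exact: le_trans (ltW t0_gt0) ts.
have H : (sqint `[t0, s] Y <= P + (al * be)^-1%:E * sqint `[t0, s] Y)%E.
  rewrite -sqint_shifted -sqint_itv_split//.
  - by apply: sqint_subset => //; apply: subset_itv; rewrite bnd_simp ?lexx ?le_r.
  - by apply: le_r; exact: ltW.
  - by rewrite ler_pM2l.
move: (Pfin t0 s) (Pfin t0 (al * be * t0)) H.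
move: (sqint `[t0, s] Y) P => A B /fineK <- /fineK <-.
rewrite !lee_fin; move: (fine A) (fine B) => j p H.
by rewrite ler_pdivlMl ?subr_gt0// mulrBl mul1r lerBlDr.
Qed.

Lemma classical_direct (T : R) : 0 <= T ->
  (sqint `[t0, (t0 + T)%R] Y <=
    (2 / (trace_gain * (1 - (al * be)^-1)))%:E * N0)%E.
Proof.
move=> T0; apply: (le_trans (sqint_right_trace_le _)); first by rewrite lerDl.
have r1 := period_gt1; have r0 : 0 < al * be by exact: lt_trans ltr01 r1.
have ir : 0 < 1 - (al * be)^-1 by rewrite subr_gt0 invf_lt1.
have g0 := trace_gain_gt0.
have /andP[H _] := data_norm_period.
have -> : 2 / (trace_gain * (1 - (al * be)^-1)) =
   (1 - (al * be)^-1)^-1 * trace_gain^-1 * 2.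
  by rewrite invfM; ring.
rewrite !EFinM -!muleA; apply: lee_wpmul2l.
  by rewrite lee_fin invr_ge0 ltW.
by rewrite lee_pdivlMl.
Qed.

Lemma classical_inverse (T : R) : al * be * t0 <= t0 + T ->
  (N0 <= (trace_gain * trace_skew / 2)%:E * sqint `[t0, (t0 + T)%R] Y)%E.
Proof.
move=> rT; have /andP[_ H] := data_norm_period.
have g0 := trace_gain_gt0; have k1 := trace_skew_ge1.
have k0 : 0 < trace_skew by exact: lt_le_trans ltr01 k1.
rewrite [_ / 2]mulrC EFinM -muleA lee_pdivlMl//.
apply: (le_trans H); apply: lee_wpmul2l; first by rewrite lee_fin mulr_ge0 ?ltW.
apply: sqint_subset => //; last exact: mcont right_trace_continuous.
by apply: subset_itv; rewrite bnd_simp.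
Qed.

End Solution.

End ClassicalInequalities.

(** * Explicit solutions *)

Section AffineComposition.
Context {R : realType}.

Lemma is_derive_comp_affine (A : R -> R) (c d x a : R) :
  is_derive (c * x + d) 1 A a -> is_derive x 1 (fun y => A (c * y + d)) (c * a).
Proof.
move=> [dA <-].
have [dl lE] : is_derive x 1 (fun y : R => c * y + d) c.
  have H := is_deriveD (is_deriveZ c (is_derive_id x (1 : R))) (is_derive_cst d x 1).
  by apply: (@is_derive_eq _ _ _ _ _ _ _ _ H); rewrite addr0; exact: mulr1.
apply: DeriveDef.
  apply/derivable1_diffP; apply: (@differentiable_comp _ _ _ _ (fun y : R => c * y + d) A).
    exact: (derivable1_diffP _ _).1 dl.
  exact: (derivable1_diffP _ _).1 dA.
by rewrite -derive1E (derive1_comp dl dA) !derive1E lE mulrC.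
Qed.

End AffineComposition.

Section ScaledSum.
Context {R : realType}.
Implicit Types (D : R -> R).
Variables (a r : R).
Hypotheses (a_gt0 : 0 < a) (r_gt1 : 1 < r).

Lemma expr_scale_unbounded (eta : R) : exists n : nat, eta < a * r ^+ n.
Proof.
have [n nE] : exists n : nat, `|eta| / (a * (r - 1)) < n%:R.
  by exists (Num.truncn (`|eta| / (a * (r - 1)))).+1; rewrite truncnS_gt.
have r10 : 0 < r - 1 by rewrite subr_gt0.
exists n; apply: (le_lt_trans (ler_norm _)).
rewrite ltr_pdivrMr ?mulr_gt0// in nE; apply: (lt_le_trans nE).
rewrite mulrCA ler_pM2l//.
suff : 1 + n%:R * (r - 1) <= r ^+ n by lra.
elim: n {nE} => [|n IH]; first by rewrite mul0r addr0 expr0.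
rewrite exprS -natr1.
have r0 : 0 <= r by rewrite ltW// (lt_trans ltr01).
have := ler_wpM2l r0 IH; have : 0 <= n%:R * (r - 1) * (r - 1).
  by rewrite !mulr_ge0// ltW.
lra.
Qed.

(** Any rank past which the terms of the scaled sum vanish; by [scaled_sumE] the
    value of the sum does not depend on the choice. *)
Definition scale_rank (eta : R) : nat := xget 0%N [set n | eta < a * r ^+ n].

Lemma scale_rankP eta : eta < a * r ^+ (scale_rank eta).
Proof.
have [n nP] := expr_scale_unbounded eta.
have : exists n, [set n | eta < a * r ^+ n] n by exists n.
exact: xgetPex.
Qed.

(** The sum of [c ^ k * D (eta / r ^ k)] over all [k], which is finite for a [D]
    that vanishes on [(-oo, a]]. *)
Definition scaled_sum (c : R) D (eta : R) : R :=
  \sum_(k < scale_rank eta) c ^+ k * D (eta / r ^+ k).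

Let r_gt0 : 0 < r. Proof. exact: lt_trans ltr01 r_gt1. Qed.

Lemma scaled_sum_vanish D (n k : nat) eta : (forall x, x <= a -> D x = 0) ->
  eta <= a * r ^+ n -> (n <= k)%N -> D (eta / r ^+ k) = 0.
Proof.
move=> D0 en nk; apply: D0; rewrite ler_pdivrMr ?exprn_gt0//.
by apply: (le_trans en); rewrite ler_pM2l// ler_weXn2l// ltW.
Qed.

Lemma scaled_sumE (c : R) D (n : nat) eta : (forall x, x <= a -> D x = 0) ->
  eta <= a * r ^+ n ->
  scaled_sum c D eta = \sum_(k < n) c ^+ k * D (eta / r ^+ k).
Proof.
move=> D0 en; have el := ltW (scale_rankP eta).
have H m N : (m <= N)%N -> eta <= a * r ^+ m ->
    \sum_(k < m) c ^+ k * D (eta / r ^+ k) = \sum_(k < N) c ^+ k * D (eta / r ^+ k).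
  move=> mN em; rewrite -!(big_mkord xpredT (fun k => c ^+ k * D (eta / r ^+ k))).
  rewrite [in RHS](big_cat_nat (n := m))//= [X in _ = _ + X](_ : _ = 0) ?addr0//.
  rewrite big_nat_cond big1// => k; rewrite andbT => /andP[mk _].
  by rewrite (scaled_sum_vanish D0 em mk) mulr0.
rewrite /scaled_sum (H (scale_rank eta) (maxn (scale_rank eta) n)) ?leq_maxl//.
by rewrite (H n (maxn (scale_rank eta) n)) ?leq_maxr.
Qed.

(** Replacing [eta] by [r * eta] shifts the sum by one term, and the new first
    term [D (r * eta)] is 0. *)
Lemma scaled_sum_period (c : R) D eta :
  (forall x, x <= a -> D x = 0) -> (forall x, r * a <= x -> D x = 0) ->
  a <= eta -> scaled_sum c D (r * eta) = c * scaled_sum c D eta.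
Proof.
move=> D0 D1 ae; have el := ltW (scale_rankP eta).
rewrite (@scaled_sumE c D (scale_rank eta).+1 (r * eta))//; last first.
  by rewrite exprS mulrCA ler_pM2l.
rewrite big_ord_recl /= expr0 divr1 D1 ?mulr0 ?add0r; last by rewrite ler_pM2l.
rewrite /scaled_sum mulr_sumr; apply: eq_bigr => k _.
rewrite /bump /= add1n !exprS -mulf_div divff ?gt_eqF// mul1r mulrA//.
Qed.

(** Near [eta] the number of terms can be frozen, so that regularity of the
    sum reduces to that of finite sums. *)
Lemma scaled_sum_near (c : R) D eta : (forall x, x <= a -> D x = 0) ->
  \forall x \near eta, \sum_(k < scale_rank eta) c ^+ k * D (x / r ^+ k) = scaled_sum c D x.
Proof.
move=> D0; near=> x; rewrite (@scaled_sumE c D (scale_rank eta) x)// ltW//.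
by near: x; apply: lt_nbhsl; exact: scale_rankP.
Unshelve. all: by end_near. Qed.

Lemma scaled_sum_is_derive (c : R) D D' (eta : R) : (forall x, x <= a -> D x = 0) ->
  (forall x, x <= a -> D' x = 0) -> (forall x : R, is_derive x 1 D (D' x)) ->
  is_derive eta 1 (scaled_sum c D) (scaled_sum (c / r) D' eta).
Proof.
move=> D0 D0' dD.
apply: near_eq_is_derive (@scaled_sum_near c D eta D0) _.
rewrite /scaled_sum; elim: (scale_rank eta) => [|n IH].
  rewrite big_ord0; under eq_fun do rewrite big_ord0; exact: is_derive_cst.
rewrite big_ord_recr /=; under eq_fun do rewrite big_ord_recr /=.
have D1 : is_derive eta 1 (fun x => c ^+ n * D (x / r ^+ n))
    ((c / r) ^+ n * D' (eta / r ^+ n)).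
  have H := is_derive_comp_affine (c := r ^- n) (d := 0) (x := eta) (dD (r ^- n * eta + 0)).
  have := is_deriveZ (c ^+ n) H; rewrite -![_ *: _]/(_ * _) addr0.
  under eq_fun do rewrite addr0 [r ^- n * _]mulrC.
  by rewrite [r ^- n * eta]mulrC mulrA expr_div_n.
exact: is_deriveD IH D1.
Qed.

Lemma scaled_sum_continuous (c : R) D : (forall x, x <= a -> D x = 0) ->
  continuous D -> continuous (scaled_sum c D).
Proof.
move=> D0 cD eta.
have E := @scaled_sum_near c D eta D0.
have cDn n : continuous (fun x : R => D (x / r ^+ n)).
  move=> x; apply: (@continuous_comp _ _ _ (fun x : R => x / r ^+ n) D); last exact: cD.
  by apply: cvgM; [exact: cvg_id|exact: cvg_cst].
have cS n : continuous (fun x : R => \sum_(k < n) c ^+ k * D (x / r ^+ k)).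
  elim: n => [|n IH] x.
    have -> : (fun x : R => \sum_(k < 0) c ^+ k * D (x / r ^+ k)) = cst 0.
      by apply/funext => y; rewrite big_ord0.
    exact: cvg_cst.
  have -> : (fun x : R => \sum_(k < n.+1) c ^+ k * D (x / r ^+ k)) =
      (fun x : R => \sum_(k < n) c ^+ k * D (x / r ^+ k) + c ^+ n * D (x / r ^+ n)).
    by apply/funext => y; rewrite big_ord_recr.
  apply: cvgD; first exact: IH.
  apply: cvgM; first exact: cvg_cst.
  exact: cDn.
rewrite /continuous_at -(nbhs_singleton E).
exact: cvg_trans (near_eq_cvg E) (cS _ eta).
Qed.

End ScaledSum.

Section PlaneWaves.
Context {R : realType}.

Lemma class_C_step (k : nat) (u : R -> R -> R) :
  continuous (fun p : R * R => u p.1 p.2) ->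
  (forall x t : R, derivable (u ^~ t) x 1 /\ derivable (u x) t 1) ->
  class_C k (dx u) -> class_C k (dt u) -> class_C k.+1 u.
Proof.
move=> cu du Cx Ct w; case/lastP: w => [|w b]; first by split.
rewrite size_rcons /partial foldr_rcons => wk.
have /(_ w wk) : class_C k (if b then dt u else dx u) by case: b.
by rewrite /partial ltnS.
Qed.

Section PlaneWave.
Variables (c d : R).

Definition plane_wave (A : R -> R) : R -> R -> R := fun x t => A (c * x + d * t).

Lemma plane_wave_continuous A : continuous A ->
  continuous (fun p : R * R => plane_wave A p.1 p.2).
Proof.
move=> cA p; rewrite /plane_wave.
apply: (@continuous_comp _ _ _ (fun p : R * R => c * p.1 + d * p.2) A); last exact: cA.
by apply: cvgD; (apply: cvgM; first exact: cvg_cst); [exact: cvg_fst|exact: cvg_snd].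
Qed.

Lemma plane_wave_is_derive_dx A a (x t : R) : (forall y : R, is_derive y 1 A (a y)) ->
  is_derive x 1 (plane_wave A ^~ t) (c * plane_wave a x t).
Proof. by move=> dA; apply: is_derive_comp_affine. Qed.

Lemma plane_wave_is_derive_dt A a (x t : R) : (forall y : R, is_derive y 1 A (a y)) ->
  is_derive t 1 (plane_wave A x) (d * plane_wave a x t).
Proof.
move=> dA; have := is_derive_comp_affine (c := d) (d := c * x) (dA (d * t + c * x)).
rewrite /plane_wave addrC; under eq_fun do rewrite addrC; exact.
Qed.

Lemma plane_wave_dx A a : (forall y : R, is_derive y 1 A (a y)) ->
  dx (plane_wave A) = plane_wave (fun y => c * a y).
Proof.
move=> dA; apply/funext => x; apply/funext => t.
by rewrite /dx derive1E; have [_ ->] := plane_wave_is_derive_dx x t dA.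
Qed.

Lemma plane_wave_dt A a : (forall y : R, is_derive y 1 A (a y)) ->
  dt (plane_wave A) = plane_wave (fun y => d * a y).
Proof.
move=> dA; apply/funext => x; apply/funext => t.
by rewrite /dt derive1E; have [_ ->] := plane_wave_is_derive_dt x t dA.
Qed.

Lemma is_derive_continuous (A a : R -> R) : (forall y : R, is_derive y 1 A (a y)) -> continuous A.
Proof. by move=> dA y; apply/differentiable_continuous/derivable1_diffP; case: (dA y). Qed.

Lemma plane_wave_class_C1 A a : (forall y : R, is_derive y 1 A (a y)) ->
  continuous a -> class_C 1 (plane_wave A).
Proof.
move=> dA ca; apply: class_C_step.
- exact: plane_wave_continuous (is_derive_continuous dA).
- move=> x t; split; first by case: (plane_wave_is_derive_dx x t dA).
  by case: (plane_wave_is_derive_dt x t dA).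
- case=> // _; split=> //; rewrite (plane_wave_dx dA); apply: plane_wave_continuous => y.
  by apply: cvgM; [exact: cvg_cst|exact: ca].
- case=> // _; split=> //; rewrite (plane_wave_dt dA); apply: plane_wave_continuous => y.
  by apply: cvgM; [exact: cvg_cst|exact: ca].
Qed.

Lemma plane_wave_class_C2 A a a' : (forall y : R, is_derive y 1 A (a y)) ->
  (forall y : R, is_derive y 1 a (a' y)) -> continuous a' -> class_C 2 (plane_wave A).
Proof.
move=> dA da ca'; apply: class_C_step.
- exact: plane_wave_continuous (is_derive_continuous dA).
- move=> x t; split; first by case: (plane_wave_is_derive_dx x t dA).
  by case: (plane_wave_is_derive_dt x t dA).
- rewrite (plane_wave_dx dA); apply: (@plane_wave_class_C1 _ (fun y => c * a' y)).
  by move=> y; apply: cvgM; [exact: cvg_cst|exact: ca'].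
- rewrite (plane_wave_dt dA); apply: (@plane_wave_class_C1 _ (fun y => d * a' y)).
  by move=> y; apply: cvgM; [exact: cvg_cst|exact: ca'].
Qed.

End PlaneWave.

(** For a wave [G (t - x)] arriving at [x = l2 t], the Doppler ratio of its
    reflection. *)
Definition mirror (l2 : R) : R := (1 - l2) / (1 + l2).

Section ReflectedWave.
Variable l2 : R.
Local Notation sg := (mirror l2).

(** A right-moving wave [G (t - x)] and its reflection at [x = l2 t], a line on
    which the phases [t - x] and [sg (t + x)] coincide. *)
Definition reflected_wave (G : R -> R) : R -> R -> R :=
  fun x t => G (t - x) - G (mirror l2 * (t + x)).

Variables (G G1 G2 : R -> R).
Hypotheses (dG : forall y : R, is_derive y 1 G (G1 y))
  (dG1 : forall y : R, is_derive y 1 G1 (G2 y)) (cG2 : continuous G2).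

Let refl_planeE (H : R -> R) : (fun x t => H (t - x)) = plane_wave (-1) 1 H.
Proof. by apply/funext=> x; apply/funext=> t; rewrite /plane_wave mulN1r mul1r addrC. Qed.

Let refl_planeE' (H : R -> R) : (fun x t => H (sg * (t + x))) = plane_wave sg sg H.
Proof. by apply/funext=> x; apply/funext=> t; rewrite /plane_wave mulrDr addrC. Qed.

Lemma reflected_wave_class_C2 : class_C 2 (reflected_wave G).
Proof.
have C1 := @plane_wave_class_C2 (-1) 1 _ _ _ dG dG1 cG2.
have C2 := @plane_wave_class_C2 sg sg _ _ _ dG dG1 cG2.
by have [] := class_CB C1 C2; rewrite -refl_planeE -refl_planeE'.
Qed.

Lemma reflected_wave_dx : dx (reflected_wave G) =
  fun x t => - G1 (t - x) - sg * G1 (sg * (t + x)).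
Proof.
have C1 := @plane_wave_class_C2 (-1) 1 _ _ _ dG dG1 cG2.
have C2 := @plane_wave_class_C2 sg sg _ _ _ dG dG1 cG2.
have [_ /(_ [:: false] isT)] := class_CB C1 C2.
rewrite /partial /= (plane_wave_dx _ _ dG) (plane_wave_dx _ _ dG) -refl_planeE -refl_planeE'.
rewrite -[X in dx X]/(reflected_wave G) => ->; apply/funext=> x; apply/funext=> t.
by rewrite -refl_planeE -refl_planeE' mulN1r.
Qed.

Lemma reflected_wave_dt : dt (reflected_wave G) =
  fun x t => G1 (t - x) - sg * G1 (sg * (t + x)).
Proof.
have C1 := @plane_wave_class_C2 (-1) 1 _ _ _ dG dG1 cG2.
have C2 := @plane_wave_class_C2 sg sg _ _ _ dG dG1 cG2.
have [_ /(_ [:: true] isT)] := class_CB C1 C2.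
rewrite /partial /= (plane_wave_dt _ _ dG) (plane_wave_dt _ _ dG) -refl_planeE -refl_planeE'.
rewrite -[X in dt X]/(reflected_wave G) => ->; apply/funext=> x; apply/funext=> t.
by rewrite -refl_planeE -refl_planeE' mul1r.
Qed.

Lemma plane_wave_second (A a b : R -> R) (c d : R) (e : bool) :
  (forall y : R, is_derive y 1 A (a y)) -> (forall y : R, is_derive y 1 a (b y)) ->
  continuous b ->
  partial [:: e; e] (plane_wave c d A) =
  fun x t => (if e then d ^+ 2 else c ^+ 2) * plane_wave c d b x t.
Proof.
move=> dA da cb; rewrite /partial /=; case: e.
  rewrite (plane_wave_dt _ _ dA) (plane_wave_dt _ _ (fun y => is_deriveZ d (da y))).
  by apply/funext=> x; apply/funext=> t; rewrite /plane_wave expr2 -mulrA.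
rewrite (plane_wave_dx _ _ dA) (plane_wave_dx _ _ (fun y => is_deriveZ c (da y))).
by apply/funext=> x; apply/funext=> t; rewrite /plane_wave expr2 -mulrA.
Qed.

Lemma reflected_wave_eq x t : wave_op (reflected_wave G) x t = 0.
Proof.
have C1 := @plane_wave_class_C2 (-1) 1 _ _ _ dG dG1 cG2.
have C2 := @plane_wave_class_C2 sg sg _ _ _ dG dG1 cG2.
have [_ H] := class_CB C1 C2.
have Hx := H [:: false; false] isT; have Ht := H [:: true; true] isT.
rewrite !(plane_wave_second _ _ _ dG dG1 cG2) -refl_planeE -refl_planeE' in Hx Ht.
rewrite /wave_op -[dt (dt _)]/(partial [:: true; true] (reflected_wave G)).
rewrite -[dx (dx _)]/(partial [:: false; false] (reflected_wave G)).
by rewrite Hx Ht sqrrN subrr.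
Qed.

End ReflectedWave.
End PlaneWaves.

Section Profiles.
Context {R : realType}.

(** The derivatives are arguments rather than [derive1] terms, since they are
    the functions that the data prescribe. *)
Definition C2_profile (a b : R) (g g1 g2 : R -> R) : Prop :=
  [/\ forall y : R, is_derive y 1 g (g1 y), forall y : R, is_derive y 1 g1 (g2 y),
      continuous g2 &
      forall y, y <= a \/ b <= y -> [/\ g y = 0, g1 y = 0 & g2 y = 0]].

Variables (l1 l2 t0 : R).
Hypotheses (l1_ge0 : 0 <= l1) (l1_lt1 : l1 < 1) (l2_ge0 : 0 <= l2) (l2_lt1 : l2 < 1).
Hypothesis l12_gt0 : 0 < l1 + l2.
Hypothesis t0_gt0 : 0 < t0.

Local Ltac slra :=
  move: (l1_ge0) (l1_lt1) (l2_ge0) (l2_lt1) (l12_gt0) (t0_gt0) => ? ? ? ? ? ?; lra.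

Local Notation al := (alpha_l l1 l2).
Local Notation be := (beta_l l1 l2).
Local Notation rho := (al * be).
Local Notation sg := (mirror l2).
Local Notation I0 := (I_ l1 l2 t0).

(** Phases [t - x] and [sg (t + x)] of the points of the initial interval fill
    the two halves of [phase_min, phase_max]. *)
Definition phase_min : R := sg * ((1 - l1) * t0).
Definition phase_max : R := (1 + l1) * t0.
Definition phase_mid : R := (1 - l2) * t0.

Let l2p : 0 < 1 + l2. Proof. by rewrite ltr_wpDr. Qed.
Let l2m : 0 < 1 - l2. Proof. by rewrite subr_gt0. Qed.
Let l1m : 0 < 1 - l1. Proof. by rewrite subr_gt0. Qed.

Lemma mirror_gt0 : 0 < sg. Proof. by rewrite divr_gt0. Qed.

Lemma mirror_mul : sg * (1 + l2) = 1 - l2.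
Proof. by rewrite /mirror divfK// gt_eqF. Qed.

Lemma phase_min_gt0 : 0 < phase_min.
Proof. exact: mulr_gt0 mirror_gt0 (mulr_gt0 l1m t0_gt0). Qed.

(** At [x = - l1 t] the phases [t - x] and [sg (t + x)] are in the ratio
    [rho]. *)
Lemma rho_mirror : rho * sg * (1 - l1) = 1 + l1.
Proof.
rewrite /alpha_l /beta_l /mirror; field.
by rewrite ?(gt_eqF l2p) ?(gt_eqF l2m) ?(gt_eqF l1m).
Qed.

Lemma phase_max_min : rho * phase_min = phase_max.
Proof. by rewrite /phase_min /phase_max -rho_mirror; move: rho sg => a b; ring. Qed.

Let mirror_mid : (1 - l2) * t0 = sg * ((1 + l2) * t0).
Proof. by rewrite -mirror_mul; move: sg => a; ring. Qed.

Lemma mirror_initial x : (I0 x) <-> (phase_min < sg * (t0 + x) < phase_mid).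
Proof.
rewrite /I_ /= in_itv /= /phase_min /phase_mid mirror_mid.
rewrite !(ltr_pM2l mirror_gt0).
by split=> /andP[? ?]; apply/andP; split; lra.
Qed.

Lemma direct_initial x : (I0 x) <-> (phase_mid < t0 - x < phase_max).
Proof.
rewrite /I_ /= in_itv /= /phase_max /phase_mid.
by split=> /andP[? ?]; apply/andP; split; lra.
Qed.

Lemma phase_min_mid : phase_min < phase_mid.
Proof.
rewrite /phase_min /phase_mid mirror_mid (ltr_pM2l mirror_gt0) ltr_pM2r//.
by slra.
Qed.

Lemma phase_mid_max : phase_mid < phase_max.
Proof. by rewrite /phase_mid /phase_max ltr_pM2r//; slra. Qed.

Let rho1 : 1 < rho. Proof. exact: period_gt1. Qed.
Let rho0 : 0 < rho. Proof. exact: lt_trans ltr01 rho1. Qed.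

(** On the phases of the initial interval only the term of rank 0 is present, so
    initial data are read off the profile itself. *)
Lemma scaled_sum_period0 (c : R) D eta : (forall x, x <= phase_min -> D x = 0) ->
  eta <= phase_max -> scaled_sum phase_min rho c D eta = D eta.
Proof.
move=> D0 eM; rewrite (@scaled_sumE _ _ _ phase_min_gt0 rho1 c D 1 eta)//.
  by rewrite big_ord_recr big_ord0 /= add0r !expr0 mul1r divr1.
by rewrite expr1 mulrC phase_max_min.
Qed.

Section Wave.
Variables (g g1 g2 : R -> R).
Hypothesis gP : C2_profile phase_min phase_max g g1 g2.

Let gl y : y <= phase_min -> g y = 0.
Proof. by case: gP => _ _ _ H ym; have [] := H y (or_introl ym). Qed.
Let g1l y : y <= phase_min -> g1 y = 0.
Proof. by case: gP => _ _ _ H ym; have [] := H y (or_introl ym). Qed.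
Let g2l y : y <= phase_min -> g2 y = 0.
Proof. by case: gP => _ _ _ H ym; have [] := H y (or_introl ym). Qed.

Local Notation G := (scaled_sum phase_min rho 1 g).
Local Notation G1 := (scaled_sum phase_min rho (1 / rho) g1).
Local Notation G2 := (scaled_sum phase_min rho (1 / rho / rho) g2).

Let dG (y : R) : is_derive y 1 G (G1 y).
Proof. by case: gP => dg _ _ _; exact: (@scaled_sum_is_derive R phase_min rho phase_min_gt0 rho1 1 g g1 y gl g1l dg). Qed.
Let dG1 (y : R) : is_derive y 1 G1 (G2 y).
Proof. by case: gP => _ dg _ _; exact: (@scaled_sum_is_derive R phase_min rho phase_min_gt0 rho1 _ g1 g2 y g1l g2l dg). Qed.
Let cG2 : continuous G2.
Proof. by case: gP => _ _ cg _; exact: (scaled_sum_continuous phase_min_gt0 rho1 g2l cg). Qed.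

(** The dilates of [g] by powers of [rho] sum to a [G] with
    [G (rho * eta) = G eta], which is the boundary condition on
    [x = - l1 t]. *)
Definition profile_wave := reflected_wave l2 G.

Lemma profile_wave_class_C2 : class_C 2 profile_wave.
Proof. exact: reflected_wave_class_C2 dG dG1 cG2. Qed.

Lemma profile_wave_eq x t : wave_op profile_wave x t = 0.
Proof. exact: reflected_wave_eq dG dG1 cG2 _ _. Qed.

Lemma profile_wave_boundary t : t0 <= t ->
  profile_wave (- l1 * t) t = 0 /\ profile_wave (l2 * t) t = 0.
Proof.
move=> tt; rewrite /profile_wave /reflected_wave; split; last first.
  have -> : mirror l2 * (t + l2 * t) = t - l2 * t.
    have -> : t + l2 * t = (1 + l2) * t by ring.
    by rewrite -[t - _](_ : (1 - l2) * t = _); [rewrite -mirror_mul; move: sg => a; ring|ring].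
  by rewrite subrr.
have -> : t - - l1 * t = rho * (sg * ((1 - l1) * t)).
  by move: rho_mirror; move: rho sg => a b E; rewrite !mulrA E; ring.
have -> : t + - l1 * t = (1 - l1) * t by ring.
rewrite (scaled_sum_period phase_min_gt0 rho1) ?mul1r ?subrr//.
- by move=> x; rewrite phase_max_min => xM; case: gP => _ _ _ H; have [] := H x (or_intror xM).
- by rewrite /phase_min (ler_pM2l mirror_gt0) (ler_pM2l l1m).
Qed.

Lemma profile_wave_classical : classical_solution l1 l2 t0 profile_wave.
Proof.
split; [exact: profile_wave_class_C2|by move=> x t _; exact: profile_wave_eq|].
exact: profile_wave_boundary.
Qed.

Lemma profile_wave_initial x : I0 x ->
  dx profile_wave x t0 = - g1 (t0 - x) - sg * g1 (sg * (t0 + x)) /\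
  dt profile_wave x t0 = g1 (t0 - x) - sg * g1 (sg * (t0 + x)).
Proof.
move=> Ix; rewrite (reflected_wave_dx l2 dG dG1 cG2) (reflected_wave_dt l2 dG dG1 cG2).
have /andP[_ d2] := (direct_initial x).1 Ix; have /andP[_ m2] := (mirror_initial x).1 Ix.
have m3 := lt_trans m2 phase_mid_max.
by rewrite !(scaled_sum_period0 _ g1l) ?(ltW d2) ?(ltW m3).
Qed.

Lemma profile_wave_trace t :
  trace_on l2 profile_wave t = - (1 + sg) * G1 ((1 - l2) * t).
Proof.
rewrite /trace_on (reflected_wave_dx l2 dG dG1 cG2).
have -> : mirror l2 * (t + l2 * t) = (1 - l2) * t.
  by rewrite -mirror_mul; move: sg => a; ring.
have -> : t - l2 * t = (1 - l2) * t by ring.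
by ring.
Qed.

End Wave.

End Profiles.

(** * Density of C^2 profiles *)

Section Density.
Context {R : realType}.
Local Notation mu := (@lebesgue_measure R).

Lemma ecvg0_small (u : nat -> \bar R) (e : R) : u n @[n --> \oo] --> 0%E -> 0 < e ->
  exists n, (u n < e%:E)%E.
Proof.
move=> /fine_cvgP[ufin /cvgr0Pnorm_lt/(_ e)] + e0 => /(_ e0) ue.
have [n [un ule]] := filter_ex (filterI ufin ue); exists n.
by rewrite -(fineK un) lte_fin (le_lt_trans (ler_norm _)).
Qed.

Lemma sqint_dominated (A : set R) (f : nat -> R -> R) (h G : R -> R) :
  measurable A -> (forall n, measurable_fun A (f n)) -> measurable_fun A h ->
  L2 A G -> (forall x, A x -> f n x @[n --> \oo] --> h x) ->
  (forall n x, A x -> `|f n x - h x| <= G x) ->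
  sqint A (fun x => f n x - h x) @[n --> \oo] --> 0%E.
Proof.
move=> mA mf mh [mG GG] fh fG.
have E : (\int[mu]_(x in A) (cst 0%E x) = 0)%E by rewrite integral0.
rewrite -[0%E in X in _ --> X]E.
have G2 x : (0 <= (G x ^+ 2)%:E :> \bar R)%E by rewrite lee_fin sqr_ge0.
apply: (@dominated_cvg _ _ _ mu A mA (fun n x => ((f n x - h x) ^+ 2)%:E)
  (cst 0%E) (fun x => (G x ^+ 2)%:E)).
- by move=> n; apply: measurable_sqr; exact: measurable_funB.
- move=> x Ax; rewrite /cst; apply: cvg_EFin; first exact: nearW.
  have H : f n x - h x @[n --> \oo] --> 0.
    by rewrite -[X in _ --> X](subrr (h x)); apply: cvgB; [exact: fh|exact: cvg_cst].
  rewrite -[X in _ --> X](mulr0 (0 : R)).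
  by under eq_fun do rewrite /= expr2; apply: cvgM.
- by [].
- apply/integrableP; split; first exact: measurable_sqr.
  by under eq_integral do rewrite gee0_abs//.
- move=> n x Ax; rewrite gee0_abs ?lee_fin ?sqr_ge0//.
  have := fG n x Ax; have G0 : 0 <= G x := le_trans (normr_ge0 _) (fG n x Ax).
  by move=> H; rewrite -[leLHS]ger0_norm ?sqr_ge0// normrX ler_sqr ?nnegrE.
Qed.

(** Density in L^2 is obtained in four stages: bounded, continuous, compactly
    supported and C^1 functions; [approximable_trans] chains them. *)
Definition approximable (A : set R) (D : R -> R) (P : (R -> R) -> Prop) : Prop :=
  forall e : R, 0 < e -> exists h, [/\ P h, measurable_fun A h &
    (sqint A (fun x => (h x - D x)%R) < e%:E)%E].

Lemma approximable_trans A D (P Q : (R -> R) -> Prop) : measurable A ->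
  measurable_fun A D ->
  approximable A D P -> (forall h, P h -> measurable_fun A h -> approximable A h Q) ->
  approximable A D Q.
Proof.
move=> mA mD DP PQ e e0; have e4 : 0 < e / 4 by rewrite divr_gt0.
have [h [Ph mh hD]] := DP _ e4; have [k [Qk mk kh]] := PQ h Ph mh _ e4.
exists k; split=> //.
have -> : (fun x => k x - D x) = (fun x => (k x - h x) + (h x - D x)).
  by apply/funext => x; ring.
apply: (le_lt_trans (sqintD_le mA (measurable_funB mk mh) (measurable_funB mh mD))).
have -> : e%:E = (2%:E * (e / 4)%:E + 2%:E * (e / 4)%:E)%E.
  by rewrite -!EFinM -EFinD; congr EFin; field.
by apply: lteD; rewrite lte_pmul2l.
Qed.

Definition clip (M : R) (f : R -> R) (x : R) : R := Num.max (- M) (Num.min (f x) M).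

Lemma clip_le (M : R) f x : 0 <= M -> `|clip M f x| <= M.
Proof.
move=> M0; rewrite /clip ler_norml.
have [H|H] := leP (f x) M.
  by have [K|K] := leP (- M) (f x); apply/andP; split; lra.
by have [K|K] := leP (- M) M; apply/andP; split; lra.
Qed.

Lemma clip_sub_le (M : R) f g x : `|g x| <= M -> `|clip M f x - g x| <= `|f x - g x|.
Proof.
rewrite ler_norml => /andP[H1 H2]; rewrite /clip.
have := ler_norm (f x - g x); have := ler_norm (- (f x - g x)).
rewrite normrN ler_norml; move: `|f x - g x| => y K1 K2.
have [H|H] := leP (f x) M.
  by have [K|K] := leP (- M) (f x); apply/andP; split; lra.
by have [K|K] := leP (- M) M; apply/andP; split; lra.
Qed.

Lemma clip_err (M : R) f x : 0 <= M -> `|clip M f x - f x| <= `|f x|.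
Proof.
move=> M0; rewrite /clip.
have := ler_norm (f x); have := ler_norm (- f x).
rewrite normrN ler_norml; move: `|f x| => y K1 K2.
have [H|H] := leP (f x) M.
  by have [K|K] := leP (- M) (f x); apply/andP; split; lra.
by have [K|K] := leP (- M) M; apply/andP; split; lra.
Qed.

Lemma measurable_clip (A : set R) M f : measurable_fun A f -> measurable_fun A (clip M f).
Proof.
by move=> mf; apply: measurable_maxr => //; apply: measurable_minr.
Qed.

Lemma continuous_clip M f : continuous f -> continuous (clip M f).
Proof.
move=> cf x; apply: (@continuous_max _ _ (cst (- M)) (fun y => Num.min (f y) M)).
  exact: cvg_cst.
by apply: (@continuous_min _ _ f (cst M)); [exact: cf|exact: cvg_cst].
Qed.

Section Interval.
Variables (a b : R).
Hypothesis ab : a < b.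
Local Notation A := (`]a, b[%classic : set R).

Let mA : measurable A. Proof. by []. Qed.

Let Afin (k : R) : L2 A (cst k).
Proof.
split=> //; rewrite [X in (X < _)%E](_ : _ = ((k ^+ 2)%:E * mu A)%E); last first.
  by rewrite -integral_cst.
by rewrite lebesgue_measure_itv /= lte_fin ab -EFinB -EFinM ltry.
Qed.

Lemma approximable_bounded (D : R -> R) : L2 A D ->
  approximable A D (fun h => exists M : R, 0 <= M /\ forall x, `|h x| <= M).
Proof.
move=> D2 e e0; have [mD _] := D2.
have mc n : measurable_fun A (clip n%:R D) by exact: measurable_clip.
have H : sqint A (fun x => clip n%:R D x - D x) @[n --> \oo] --> 0%E.
  apply: (@sqint_dominated A (fun n => clip n%:R D) D (fun x => `|D x|)) => //.
  - split; first exact: measurableT_comp.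
    by under eq_integral do rewrite real_normK ?num_real//; case: D2.
  - move=> x _; apply: cvg_near_cst; near=> n.
    have Dn : `|D x| <= n%:R by near: n; exact: nbhs_infty_ger.
    move: Dn; rewrite ler_norml /clip => /andP[D1 D3].
    by rewrite (min_idPl _)// (max_idPr _).
  - by move=> n x _; exact: clip_err.
have [n nE] := ecvg0_small H e0.
exists (clip n%:R D); split=> //; exists n%:R; split=> // x; exact: clip_le.
Unshelve. all: by end_near. Qed.

(** Density of continuous functions in L^1 gives it in L^2 for bounded
    functions: clipping at the bound [M] does not increase the error [e], and
    then [e^2 <= (2 M + 1) e]. *)
Lemma approximable_continuous (D : R -> R) : measurable_fun A D ->
  (exists M : R, 0 <= M /\ forall x, `|D x| <= M) ->
  approximable A D (fun h => continuous h /\ exists M : R, 0 <= M /\ forall x, `|h x| <= M).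
Proof.
move=> mD [M [M0 DM]] e e0.
have muA : (mu A < +oo)%E by rewrite lebesgue_measure_itv /= lte_fin ab -EFinB ltry.
have iD : mu.-integrable A (EFin \o D).
  have H := @measurable_bounded_integrable _ _ R mu D A mA muA mD; apply: H.
  exists M; split; first exact: num_real.
  by move=> y My x _; exact: le_trans (DM x) (ltW My).
have [k [ck ik kD]] := approximation_continuous_integrable mA muA iD.
have M2 : 0 < 2 * M + 1 by lra.
have e2 : 0 < e / (2 * M + 1) by rewrite divr_gt0.
have [n kn] := ecvg0_small kD e2.
exists (clip M (k n)); split.
- split; first exact: continuous_clip.
  by exists M; split=> // x; exact: clip_le.
- by apply: measurable_clip; apply: measurable_funTS; exact: continuous_measurable_fun.
have mk : measurable_fun A (k n) by apply: measurable_funTS; exact: continuous_measurable_fun.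
apply: (@le_lt_trans _ _ ((2 * M + 1)%:E * \int[mu]_(x in A) `|(D x - k n x)%:E|)%E).
  rewrite -ge0_integralZl_EFin ?(ltW M2)//; last first.
    by apply: measurableT_comp => //; apply/measurable_EFinP; exact: measurable_funB.
  apply: ge0_le_integral => //.
  - by move=> x _; rewrite lee_fin sqr_ge0.
  - by apply: measurable_sqr; apply: measurable_funB => //; exact: measurable_clip.
  - apply: measurable_funeM; apply: measurableT_comp => //.
    by apply/measurable_EFinP; exact: measurable_funB.
  move=> x _; rewrite abse_EFin -EFinM lee_fin distrC.
  have H1 := @clip_sub_le M (k n) D x (DM x).
  have H2 : `|clip M (k n) x - D x| <= 2 * M.
    by apply: (le_trans (ler_normB _ _)); have := clip_le (k n) x M0; have := DM x; lra.
  rewrite -[leLHS]ger0_norm ?sqr_ge0// normrX expr2.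
  by apply: ler_pM => //; lra.
have -> : e%:E = ((2 * M + 1)%:E * (e / (2 * M + 1))%:E)%E.
  by rewrite -EFinM mulrC divfK// gt_eqF.
by rewrite lte_pmul2l// lte_fin.
Qed.

Definition vanishes_outside (c d : R) (h : R -> R) : Prop :=
  forall x, x <= c \/ d <= x -> h x = 0.

(** Continuous functions with values in [[0, 1]] that increase to the indicator of
    [(a, b)], each vanishing near the end points. *)
Let cutoff (n : nat) (x : R) : R :=
  Num.max 0 (Num.min (n.+1%:R * ((x - a) * (b - x)) - 1) 1).

Let cutoff_continuous n : continuous (cutoff n).
Proof.
move=> x; apply: (@continuous_max _ _ (cst 0)
  (fun x => Num.min (n.+1%:R * ((x - a) * (b - x)) - 1) 1)); first exact: cvg_cst.
apply: (@continuous_min _ _ (fun x => n.+1%:R * ((x - a) * (b - x)) - 1) (cst 1));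
  last exact: cvg_cst.
apply: cvgB; last exact: cvg_cst.
apply: cvgM; first exact: cvg_cst.
by apply: cvgM; apply: cvgB; [exact: cvg_id|exact: cvg_cst|exact: cvg_cst|exact: cvg_id].
Qed.

Let cutoff_01 n x : 0 <= cutoff n x <= 1.
Proof.
rewrite /cutoff; move: (_ * _ - 1) => y.
have [H|H] := leP y 1; first by have [K|K] := leP 0 y; apply/andP; split; lra.
by rewrite (max_idPr ler01) ler01 lexx.
Qed.

Let cutoff_vanish n : let d := (n.+1%:R * (b - a))^-1 in
  vanishes_outside (a + d) (b - d) (cutoff n).
Proof.
move=> d x xd; have n0 : 0 < n.+1%:R :> R by [].
have ba : 0 < b - a by rewrite subr_gt0.
have d0 : 0 < d by rewrite invr_gt0 mulr_gt0.
have dE : n.+1%:R * (d * (b - a)) = 1.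
  by rewrite mulrCA mulVf// gt_eqF// mulr_gt0.
have H : (x - a) * (b - x) <= d * (b - a).
  have d1 : 0 <= d * (b - a) by rewrite mulr_ge0// ltW.
  have [xa|xa] := leP x a.
    by apply: le_trans d1; rewrite mulr_le0_ge0 ?subr_le0 ?subr_ge0// (le_trans xa)// ltW.
  have [xb|xb] := leP b x.
    by apply: le_trans d1; rewrite mulr_ge0_le0 ?subr_le0 ?subr_ge0// ltW.
  case: xd => xd; first by apply: ler_pM; lra.
  by rewrite mulrC; apply: ler_pM; lra.
have := ler_wpM2l (ltW n0) H; rewrite dE /cutoff; move: (_ * _) => y y1.
by rewrite (min_idPl _) ?(max_idPl _)//; lra.
Qed.

Definition compactly_supported_bounded (h : R -> R) : Prop :=
  [/\ continuous h, exists2 d, 0 < d & vanishes_outside (a + d) (b - d) h &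
      exists M : R, 0 <= M /\ forall x, `|h x| <= M].

Lemma approximable_compact (k : R -> R) : continuous k ->
  (exists M : R, 0 <= M /\ forall x, `|k x| <= M) ->
  approximable A k compactly_supported_bounded.
Proof.
move=> ck [M [M0 kM]] e e0.
have cfk n : continuous (fun x => cutoff n x * k x).
  by move=> x; apply: cvgM; [exact: cutoff_continuous|exact: ck].
have mfk n : measurable_fun A (fun x => cutoff n x * k x).
  by apply: measurable_funTS; exact: continuous_measurable_fun.
have mk : measurable_fun A k by apply: measurable_funTS; exact: continuous_measurable_fun.
have H : sqint A (fun x => cutoff n x * k x - k x) @[n --> \oo] --> 0%E.
  apply: (@sqint_dominated A (fun n x => cutoff n x * k x) k (cst M)) => //.
  - move=> x; rewrite /= in_itv /= => /andP[ax xb]; apply: cvg_near_cst; near=> n.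
    pose c := (x - a) * (b - x).
    have c0 : 0 < c by rewrite mulr_gt0 ?subr_gt0.
    have nc : 2 / c <= n%:R by near: n; exact: nbhs_infty_ger.
    have nc' : 2 <= n%:R * c by rewrite -ler_pdivrMr.
    have nc2 : 1 <= n.+1%:R * c - 1 by rewrite -natr1; lra.
    by rewrite /cutoff -/c (min_idPr nc2) (max_idPr ler01) mul1r.
  - move=> n x _; have /andP[c0 c1] := cutoff_01 n x.
    have -> : cutoff n x * k x - k x = - ((1 - cutoff n x) * k x) by ring.
    rewrite normrN normrM ger0_norm ?subr_ge0//.
    apply: le_trans (kM x); rewrite ler_piMl//; lra.
have [n nE] := ecvg0_small H e0.
exists (fun x => cutoff n x * k x); split=> //; split=> //.
  exists (n.+1%:R * (b - a))^-1; first by rewrite invr_gt0 mulr_gt0 ?subr_gt0.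
  by move=> x xd; rewrite (cutoff_vanish xd) mul0r.
exists M; split=> // x; have /andP[c0 c1] := cutoff_01 n x.
by rewrite normrM ger0_norm//; apply: le_trans (kM x); rewrite ler_piMl.
Unshelve. all: by end_near. Qed.

Lemma compact_integrable (k : R -> R) : continuous k -> vanishes_outside a b k ->
  mu.-integrable setT (EFin \o k).
Proof.
move=> ck k0.
have -> : EFin \o k = (EFin \o k) \_ (`[a, b]%classic).
  apply/funext => x; rewrite patchE; case: ifPn => //.
  rewrite notin_setE /= in_itv /= => /negP; rewrite negb_and -!ltNge => /orP[xa|bx].
    by rewrite k0//; left; exact: ltW.
  by rewrite k0//; right; exact: ltW.
apply/(integrable_mkcond _ _).1 => //.
apply: continuous_compact_integrable; first exact: segment_compact.
exact: continuous_subspaceT.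
Qed.

Lemma compact_antiderivative (k : R -> R) : continuous k -> vanishes_outside a b k ->
  exists K : R -> R, [/\ forall x : R, is_derive x 1 K (k x),
    forall x, x <= a -> K x = 0 &
    forall x, b <= x -> K x = \int[mu]_(t in A) k t].
Proof.
move=> ck k0; pose K x := \int[mu]_(t in `]-oo, x]) k t.
have ik := compact_integrable ck k0.
exists K; split.
- move=> x.
  have iu : mu.-integrable [set` Interval -oo%O (BRight (x + 1))] (EFin \o k).
    exact: integrableS ik.
  have x1 : x < x + 1 by rewrite ltrDl.
  have [|dK KE] := @continuous_FTC1 R k -oo%O x (x + 1) x1 iu _ (ck x).
    exact: ltNyr.
  by apply: (DeriveDef dK); rewrite -derive1E; exact: KE.
- move=> x xa; rewrite /K (_ : (\int[mu]_(t in `]-oo, x]) k t) = \int[mu]_(t in `]-oo, x]) 0).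
    by rewrite Rintegral_cst// mul0r.
  apply: eq_Rintegral => t; rewrite inE /= in_itv /= => tx.
  by rewrite k0//; left; exact: le_trans tx xa.
- move=> x bx; rewrite /K Rintegral_mkcond [RHS]Rintegral_mkcond.
  congr Rintegral; apply/funext => t; rewrite !patchE !mem_setE !in_itv /=.
  have [ta|ta] := leP t a.
    by rewrite k0 ?if_same//; left.
  have [tb|tb] := ltP t b; first by rewrite (le_trans (ltW tb) bx).
  by rewrite /= k0 ?if_same//; right.
Qed.

Definition C1_compact (h : R -> R) : Prop :=
  exists h', [/\ forall x : R, is_derive x 1 h (h' x), continuous h',
     vanishes_outside a b h & vanishes_outside a b h'].

(** Averaging a continuous function over [x, x + s] gains one derivative. *)
Lemma approximable_C1 (k : R -> R) : compactly_supported_bounded k ->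
  approximable A k C1_compact.
Proof.
move=> [ck [d d0 kd] [M [M0 kM]]] e e0.
have k0 : vanishes_outside a b k.
  by move=> x xab; apply: kd; case: xab => ?; [left|right]; lra.
have [K [dK _ _]] := compact_antiderivative ck k0.
pose s n : R := d / 2 / n.+1%:R.
have s0 n : 0 < s n by rewrite !divr_gt0.
have sd n : s n <= d / 2.
  by rewrite /s ler_pdivrMr// ler_peMr ?divr_ge0 ?(ltW d0)// ler1n.
pose r n x := (s n)^-1 * (K (x + s n) - K x).
have rE n x : exists2 c, `|c - x| <= s n & r n x = k c.
  have [c cE KE] := mvt_between x (x + s n) dK; exists c.
    by move: cE; rewrite [x + s n]addrC addrK (gtr0_norm (s0 n)).
  by rewrite /r KE [x + s n]addrC addrK mulrC mulfK// gt_eqF.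
have dr n (x : R) : is_derive x 1 (r n) ((s n)^-1 * (k (x + s n) - k x)).
  have H := is_derive_comp_affine (c := 1) (d := s n) (x := x) (dK (1 * x + s n)).
  have := is_deriveZ (s n)^-1 (is_deriveB H (dK x)); rewrite !mul1r.
  have -> // : (s n)^-1 \*: ((fun y => K (1 * y + s n)) - K) = r n.
  by apply/funext => y; rewrite /r /= !fctE mul1r.
have cr n : continuous (r n) := is_derive_continuous (dr n).
have rv n : vanishes_outside a b (r n).
  move=> x xab; have [c cE ->] := rE n x; apply: kd.
  move: cE; rewrite ler_norml => /andP[H1 H2]; have H3 := sd n.
  by case: xab => ?; [left|right]; lra.
have mk : measurable_fun A k by apply: measurable_funTS; exact: continuous_measurable_fun.
have mr n : measurable_fun A (r n).
  by apply: measurable_funTS; exact: continuous_measurable_fun.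
have H : sqint A (fun x => r n x - k x) @[n --> \oo] --> 0%E.
  apply: (@sqint_dominated A r k (cst (2 * M))) => //.
  - move=> x _; apply/cvgrPdist_lt => eta eta0.
    have /cvgrPdist_lt/(_ eta eta0) := ck x.
    move=> /nbhs_ballP[del /= del0 kdel]; near=> n.
    have [c cE ->] := rE n x; apply: kdel; rewrite /ball /= distrC.
    apply: (le_lt_trans cE); rewrite /s ltr_pdivrMr// [del * _]mulrC -ltr_pdivrMr//.
    apply: (@lt_trans _ _ n%:R); last by rewrite ltr_nat.
    by near: n; exact: nbhs_infty_gtr.
  - move=> n x _; have [c _ ->] := rE n x; rewrite /cst.
    by apply: (le_trans (ler_normB _ _)); have := kM c; have := kM x; lra.
have [n nE] := ecvg0_small H e0.
exists (r n); split=> //; exists (fun x => (s n)^-1 * (k (x + s n) - k x)); split=> //.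
  move=> x; apply: cvgM; first exact: cvg_cst.
  apply: cvgB; last exact: ck.
  apply: (@continuous_comp _ _ _ (fun x => x + s n) k); last exact: ck.
  by apply: cvgD; [exact: cvg_id|exact: cvg_cst].
move=> x xab; have H1 := sd n; have H2 := s0 n.
rewrite (k0 _ xab) kd ?subrr ?mulr0//.
by case: xab => ?; [left|right]; lra.
Unshelve. all: by end_near. Qed.

End Interval.

End Density.

Section Bumps.
Context {R : realType}.
Local Notation mu := (@lebesgue_measure R).

Definition pos_pow (n : nat) (y : R) : R := Num.max 0 y ^+ n.

Lemma pos_pow_continuous n : continuous (pos_pow n).
Proof.
have cm : continuous (fun y : R => Num.max 0 y).
  by move=> y; apply: (@continuous_max _ _ (cst 0) id); [exact: cvg_cst|exact: cvg_id].
elim: n => [|n IH] y.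
  by rewrite /continuous_at /pos_pow expr0; under eq_fun do rewrite expr0; exact: cvg_cst.
have -> : pos_pow n.+1 = (fun y => Num.max 0 y * pos_pow n y).
  by apply/funext => z; rewrite /pos_pow exprS.
by apply: cvgM; [exact: cm|exact: IH].
Qed.

Lemma pos_pow_is_derive n (y : R) : is_derive y 1 (pos_pow n.+2) (n.+2%:R * pos_pow n.+1 y).
Proof.
have [y0|y0|->] := ltgtP y 0.
- apply: (@near_eq_is_derive _ _ _ (cst 0)).
    near=> z; have z0 : z < 0 by near: z; exact: lt_nbhsl.
    by rewrite /pos_pow (max_idPl (ltW z0)) expr0n.
  by rewrite /pos_pow (max_idPl (ltW y0)) expr0n mulr0; exact: is_derive_cst.
- apply: (@near_eq_is_derive R R R (fun z : R => z ^+ n.+2)).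
    near=> z; have z0 : 0 < z by near: z; exact: lt_nbhsr.
    by rewrite /pos_pow (max_idPr (ltW z0)).
  have -> : pos_pow n.+1 y = y ^+ n.+1 by rewrite /pos_pow (max_idPr (ltW y0)).
  apply: DeriveDef; first exact: exprn_derivable.
  by rewrite exp_derive -[LHS]/(n.+2%:R * y ^+ n.+1 * 1) mulr1.
rewrite /pos_pow maxxx expr0n mulr0.
suff H : h^-1 *: (pos_pow n.+2 h - pos_pow n.+2 0) @[h --> (0 : R)^'] --> (0 : R).
  have E : (fun h : R => h^-1 *: ((pos_pow n.+2 \o shift 0) (h *: 1) - pos_pow n.+2 0)) =
      (fun h => h^-1 *: (pos_pow n.+2 h - pos_pow n.+2 0)).
    by apply/funext => h /=; rewrite addr0 [h *: 1]mulr1.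
  apply: DeriveDef; first by rewrite /derivable E; apply/cvg_ex; eexists; exact: H.
  by rewrite /derive E; apply/cvg_lim => //; exact: Rhausdorff.
have P0 : pos_pow n.+1 h @[h --> (0 : R)^'] --> (0 : R).
  have := @pos_pow_continuous n.+1 0; rewrite /continuous_at {2}/pos_pow maxxx expr0n /=.
  by move=> H; apply: cvg_within_filter.
apply/cvgrPdist_le => e e0; near=> h.
have h0 : h != 0 by near: h; exact: nbhs_dnbhs_neq.
have he : `|pos_pow n.+1 h| <= e.
  by near: h; move/cvgr0Pnorm_le: P0 => /(_ e e0).
rewrite sub0r normrN; apply: le_trans he.
rewrite -[_ *: _]/(_ * _) /pos_pow maxxx expr0n subr0.
have [h1|h1] := leP 0 h.
  by rewrite exprS mulKf.
by rewrite !expr0n mulr0.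
Unshelve. all: by end_near. Qed.

Section Interval.
Variables (a b : R).
Hypothesis ab : a < b.
Local Notation A := (`]a, b[%classic : set R).

(** For [n > 0], positive exactly on [(a, b)] and of class C^(n-1). *)
Definition bump_pow (n : nat) (x : R) : R := pos_pow n ((x - a) * (b - x)).

Lemma bump_pow_is_derive n (x : R) : is_derive x 1 (bump_pow n.+2)
  (n.+2%:R * bump_pow n.+1 x * (a + b - 2 * x)).
Proof.
have dq : is_derive x 1 (fun y : R => (y - a) * (b - y)) (a + b - 2 * x).
  have H := is_deriveM (is_deriveB (is_derive_id x (1 : R)) (is_derive_cst a x (1 : R)))
    (is_deriveB (is_derive_cst b x (1 : R)) (is_derive_id x (1 : R))).
  apply: (@is_derive_eq _ _ _ _ _ _ _ _ H); rewrite !fctE -![_ *: _]/(_ * _); ring.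
have [dp pE] := pos_pow_is_derive n ((x - a) * (b - x)).
case: dq => dq qE.
apply: DeriveDef.
  apply/derivable1_diffP; apply: (@differentiable_comp _ _ _ _
    (fun y : R => (y - a) * (b - y)) (pos_pow n.+2)).
    exact: (derivable1_diffP _ _).1 dq.
  exact: (derivable1_diffP _ _).1 dp.
by rewrite -derive1E (derive1_comp dq dp) !derive1E pE qE.
Qed.

Lemma bump_pow_continuous n : continuous (bump_pow n).
Proof.
move=> x; apply: (@continuous_comp _ _ _ (fun y : R => (y - a) * (b - y)) (pos_pow n));
  last exact: pos_pow_continuous.
by apply: cvgM; apply: cvgB; [exact: cvg_id|exact: cvg_cst|exact: cvg_cst|exact: cvg_id].
Qed.

Lemma bump_pow_vanish n : vanishes_outside a b (bump_pow n.+1).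
Proof.
move=> x xab; rewrite /bump_pow /pos_pow (max_idPl _) ?expr0n//.
have [xa|xa] := leP x a.
  by rewrite mulr_le0_ge0 ?subr_le0 ?subr_ge0// (le_trans xa)// ltW.
case: xab => xab; first by move: (le_lt_trans xab xa); rewrite ltxx.
by rewrite mulr_ge0_le0 ?subr_le0 ?subr_ge0// ltW.
Qed.

Lemma bump_pow_gt0 n x : a < x -> x < b -> 0 < bump_pow n x.
Proof.
move=> ax xb; rewrite /bump_pow /pos_pow.
have H : 0 < (x - a) * (b - x) by rewrite mulr_gt0 ?subr_gt0.
by rewrite (max_idPr (ltW H)) exprn_gt0.
Qed.

(** The Cauchy-Schwarz inequality on a bounded interval in the additive form
    [|w| <= eta + w^2 / eta], which needs no square root. *)
Lemma L2_integral_bound (w : R -> R) (eta : R) : L2 A w -> 0 < eta ->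
  mu.-integrable A (EFin \o w) /\
  `|\int[mu]_(x in A) w x| <= eta * (b - a) + fine (sqint A w) / eta.
Proof.
move=> [mw w2] eta0.
have mA : measurable A by [].
have muA : (mu A = (b - a)%:E)%E by rewrite lebesgue_measure_itv /= lte_fin ab EFinB.
have sE : sqint A w = (fine (sqint A w))%:E.
  by rewrite fineK// ge0_fin_numE// sqint_ge0.
have H : (\int[mu]_(x in A) `|(EFin \o w) x| <=
    (eta * (b - a) + fine (sqint A w) / eta)%:E)%E.
  have -> : (eta * (b - a) + fine (sqint A w) / eta)%:E =
      (\int[mu]_(x in A) (eta%:E + (eta^-1)%:E * (w x ^+ 2)%:E))%E.
    rewrite ge0_integralD//.
    - rewrite integral_cst// -[X in (_ * X + _)%E]/(mu A) muA ge0_integralZl_EFin ?invr_ge0 ?(ltW eta0)//.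
      + by rewrite -/(sqint A w) sE -!EFinM -EFinD [eta^-1 * _]mulrC.
      + by move=> x _; rewrite lee_fin sqr_ge0.
      + exact: measurable_sqr.
    - by move=> x _; rewrite lee_fin ltW.
    - by move=> x _; rewrite -EFinM lee_fin mulr_ge0 ?invr_ge0 ?sqr_ge0// ltW.
    - by apply: measurable_funeM; exact: measurable_sqr.
  apply: ge0_le_integral => //.
  - by do 2 apply: measurableT_comp => //.
  - by apply: emeasurable_funD => //; apply: measurable_funeM; exact: measurable_sqr.
  move=> x _ /=; rewrite -EFinM -EFinD lee_fin.
  have e1 : eta * eta^-1 = 1 by rewrite divff// gt_eqF.
  have e2 : 0 < eta^-1 by rewrite invr_gt0.
  rewrite -[w x ^+ 2]real_normK ?num_real//; move: `|w x| (normr_ge0 (w x)) => y y0.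
  have : 0 <= eta^-1 * (y - eta) ^+ 2 by rewrite mulr_ge0 ?sqr_ge0// ltW.
  have -> : eta^-1 * (y - eta) ^+ 2 = eta^-1 * y ^+ 2 - 2 * (eta * eta^-1) * y + (eta * eta^-1) * eta by ring.
  by rewrite e1; lra.
have iw : mu.-integrable A (EFin \o w).
  by apply/integrableP; split; [exact/measurable_EFinP|rewrite (le_lt_trans H)// ltry].
split=> //; have L := @le_normr_Rintegral _ _ _ mu A w mA iw; apply: (le_trans L).
rewrite -lee_fin; apply: le_trans H; rewrite /Rintegral fineK//.
by apply: integrable_fin_num => //; exact: integrable_norm.
Qed.

Lemma approximable_C1_compact (D : R -> R) : L2 A D ->
  approximable A D (C1_compact a b).
Proof.
move=> D2; have [mD _] := D2; have mA : measurable A by [].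
apply: (approximable_trans mA mD (approximable_bounded D2)) => h hM mh.
apply: (approximable_trans mA mh (approximable_continuous ab mh hM)) => k [ck kM] mk.
apply: (approximable_trans mA mk (approximable_compact ab ck kM)) => r rP mr.
exact: approximable_C1.
Qed.

(** The C^1 approximation [r] of [D] is corrected by a multiple of a fixed bump
    [psi], so that its antiderivative is compactly supported as well.  The
    multiple is the mean of [r] divided by that of [psi]: it is small because
    [D] has mean 0. *)
Lemma profile_dense (D : R -> R) (e : R) : L2 A D -> \int[mu]_(x in A) D x = 0 ->
  0 < e -> exists g g1 g2, C2_profile a b g g1 g2 /\
    (sqint A (fun x => (g1 x - D x)%R) < e%:E)%E.
Proof.
move=> D2 Dmean e0; have [mD _] := D2; have mA : measurable A by [].
pose psi := bump_pow 2; pose psi' x := 2 * bump_pow 1 x * (a + b - 2 * x).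
have cpsi : continuous psi by exact: bump_pow_continuous.
have dpsi (x : R) : is_derive x 1 psi (psi' x) := bump_pow_is_derive 0 x.
have cpsi' : continuous psi'.
  move=> x; apply: cvgM; first by apply: cvgM; [exact: cvg_cst|exact: bump_pow_continuous].
  by apply: cvgB; [exact: cvg_cst|apply: cvgM; [exact: cvg_cst|exact: cvg_id]].
have psi0 : vanishes_outside a b psi by exact: bump_pow_vanish.
have psi'0 : vanishes_outside a b psi'.
  by move=> x xab; rewrite /psi' bump_pow_vanish// mulr0 mul0r.
have [Psi [dPsi Psi0 Psi1]] := compact_antiderivative cpsi psi0.
pose P := \int[mu]_(x in A) psi x.
have P0 : 0 < P.
  have [c] := MVT ab (fun x _ => dPsi x) (continuous_subspaceT (is_derive_continuous dPsi)).
  rewrite in_itv /= => /andP[ac cb]; rewrite Psi1// Psi0// subr0 -/P => ->.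
  by rewrite mulr_gt0 ?subr_gt0// bump_pow_gt0.
have mc (f : R -> R) : continuous f -> measurable_fun A f.
  by move=> cf; apply: measurable_funTS; exact: continuous_measurable_fun.
have mpsi := mc _ cpsi.
have Sfin : sqint A psi = (fine (sqint A psi))%:E.
  by rewrite fineK// sqint_itv_cc//; exact: sqint_continuous_fin.
set S := fine (sqint A psi) in Sfin.
have S0 : 0 <= S by rewrite -lee_fin -Sfin sqint_ge0.
have ba : 0 < b - a by rewrite subr_gt0.
(* [th] bounds the mean of [r]: the largest size for which the correction
   costs at most [e / 4] in square integral.  [eta] and [tol] then share [th]
   between the two terms of [L2_integral_bound]. *)
pose th := Num.sqrt (e * P ^+ 2 / (4 * (S + 1))).
have S1 : 0 < 4 * (S + 1) by lra.
have th20 : 0 < e * P ^+ 2 / (4 * (S + 1)) by rewrite divr_gt0// mulr_gt0// exprn_gt0.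
have th0 : 0 < th by rewrite sqrtr_gt0.
have th2 : th ^+ 2 = e * P ^+ 2 / (4 * (S + 1)) by rewrite sqr_sqrtr// ltW.
pose eta := th / (2 * (b - a)).
have eta0 : 0 < eta by rewrite divr_gt0// mulr_gt0.
pose tol := Num.min (e / 4) (eta * th / 2).
have tol0 : 0 < tol by rewrite lt_min !divr_gt0// mulr_gt0.
have [r [[r' [dr cr' r0 r'0]] mr rD]] := approximable_C1_compact D2 tol0.
have cr := is_derive_continuous dr.
have [K [dK K0 K1]] := compact_antiderivative cr r0.
set m := \int[mu]_(x in A) r x in K1.
pose w x := r x - D x.
have wfin : sqint A w = (fine (sqint A w))%:E.
  rewrite fineK// ge0_fin_numE ?sqint_ge0//; apply: lt_trans rD _; exact: ltry.
have wtol : fine (sqint A w) < tol by rewrite -lte_fin -wfin.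
have w2 : L2 A w.
  by split; [exact: measurable_funB|rewrite -[X in (X < _)%E]/(sqint A w) wfin ltry].
have [iw mw] := L2_integral_bound w2 eta0.
have N0 : 0 <= fine (sqint A w) by rewrite -lee_fin -wfin sqint_ge0.
have mE : m = \int[mu]_(x in A) w x.
  have [iD _] := L2_integral_bound D2 ltr01.
  rewrite /w RintegralB//; first by rewrite Dmean subr0.
  exact: integrableS (compact_integrable cr r0).
have mth : `|m| <= th.
  rewrite mE; apply: (le_trans mw).
  have H1 : eta * (b - a) = th / 2 by rewrite /eta; field; rewrite subr_eq0 gt_eqF.
  have H2 : fine (sqint A w) / eta <= th / 2.
    rewrite ler_pdivrMr//; apply: (le_trans (ltW wtol)).
    rewrite /tol ge_min; apply/orP; right.
    by rewrite [th / 2 * eta]mulrAC [th * eta]mulrC.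
  by rewrite H1; lra.
pose c := m / P.
exists (fun x => K x - c * Psi x), (fun x => r x - c * psi x), (fun x => r' x - c * psi' x).
split.
  split.
  - by move=> x; exact: (is_deriveB (dK x) (is_deriveZ c (dPsi x))).
  - by move=> x; exact: (is_deriveB (dr x) (is_deriveZ c (dpsi x))).
  - by move=> x; apply: cvgB; [exact: cr'|apply: cvgM; [exact: cvg_cst|exact: cpsi']].
  move=> y yab; rewrite r0// r'0// psi0// psi'0// !mulr0 !subr0; split=> //.
  case: yab => yab; first by rewrite K0// Psi0// mulr0 subr0.
  by rewrite K1// Psi1// -/P /c divfK ?gt_eqF// subrr.
have -> : (fun x => r x - c * psi x - D x) = (fun x => w x - c * psi x).
  by apply/funext => x; rewrite /w addrAC.
apply: (le_lt_trans (sqintB_le mA w2.1 (measurable_funM (measurable_cst c) mpsi))).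
have H3 : c ^+ 2 * S <= e / 4.
  have -> : c ^+ 2 = m ^+ 2 / P ^+ 2 by rewrite /c expr_div_n.
  have P2 : 0 < P ^+ 2 by rewrite exprn_gt0.
  have H : m ^+ 2 <= e * P ^+ 2 / (4 * (S + 1)).
    by rewrite -th2 -[m ^+ 2]real_normK ?num_real// ler_sqr ?nnegrE ?(ltW th0).
  apply: (@le_trans _ _ (e / (4 * (S + 1)) * S)).
    apply: ler_wpM2r => //; rewrite ler_pdivrMr//; apply: (le_trans H).
    by rewrite mulrAC.
  have -> : e / (4 * (S + 1)) * S = e / 4 * (S / (S + 1)) by field; rewrite gt_eqF//; lra.
  rewrite ler_piMr ?divr_ge0 ?(ltW e0)// ler_pdivrMr ?mul1r ?lerDl//.
  by rewrite ltr_wpDl.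
have wt4 : fine (sqint A w) < e / 4.
  by apply: (lt_le_trans wtol); rewrite /tol ge_min lexx.
rewrite (sqintZ c mA mpsi) Sfin wfin -!EFinM -EFinD lte_fin; lra.
Qed.

End Interval.
End Bumps.

(** * Existence of the trace *)

Section L2Line.
Context {R : realType}.
Local Notation mu := (@lebesgue_measure R).

Lemma sqint_restrict (A : set R) (f : R -> R) : sqint setT (f \_ A) = sqint A f.
Proof.
rewrite /sqint [RHS]integral_mkcond; apply: eq_integral => x _.
by rewrite !patchE; case: ifP => //; rewrite expr0n.
Qed.

Lemma L2_restrict (A : set R) (f : R -> R) : measurable A -> L2 A f -> L2 setT (f \_ A).
Proof.
move=> mA [mf ff]; split; first exact/(measurable_restrictT _ _).1.
by have := sqint_restrict A f; rewrite /sqint => ->.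
Qed.

Lemma sqint_affineT (c d : R) (f : R -> R) : c != 0 -> measurable_fun setT f ->
  sqint setT (fun x => f (c * x + d)) = (`|c|^-1%:E * sqint setT f)%E.
Proof.
move=> c0 mf; rewrite [in RHS](@sqint_affine R c d setT setT f)//.
by rewrite muleA -EFinM mulVf ?normr_eq0// mul1e.
Qed.

Lemma measurable_comp_affine (c d : R) (f : R -> R) : measurable_fun setT f ->
  measurable_fun setT (fun x => f (c * x + d)).
Proof. by move=> mf; apply: measurableT_comp mf _; exact: measurable_affine. Qed.

Lemma L2_comp_affine (c d : R) (f : R -> R) : c != 0 -> L2 setT f ->
  L2 setT (fun x => f (c * x + d)).
Proof.
move=> c0 [mf ff]; split; first exact: measurable_comp_affine.
have := sqint_affineT d c0 mf; rewrite /sqint => ->.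
by rewrite lte_mul_pinfty// ?lee_fin ?invr_ge0.
Qed.

Lemma Rintegral_affineT (c d : R) (f : R -> R) : c != 0 ->
  mu.-integrable setT (EFin \o f) ->
  mu.-integrable setT (EFin \o (fun x => f (c * x + d))) /\
  \int[mu]_x f (c * x + d) = `|c|^-1 * \int[mu]_x f x.
Proof.
move=> c0 /integrableP[mf ff].
have nc : 0 < `|c| by rewrite normr_gt0.
have cov (g : R -> \bar R) : measurable_fun setT g -> (forall x, 0 <= g x)%E ->
   (\int[mu]_x g (c * x + d)%R = `|c|^-1%:E * \int[mu]_x g x)%E.
  move=> mg g0; rewrite [in RHS](@ge0_integral_affine R c d setT setT g)//.
  by rewrite muleA -EFinM mulVf ?gt_eqF// mul1e.
have mfc : measurable_fun setT (EFin \o (fun x => f (c * x + d))).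
  by apply/measurable_EFinP; apply: measurable_comp_affine; exact/measurable_EFinP.
have mab : measurable_fun setT (fun x => `|(EFin \o f) x|)%E.
  exact: measurableT_comp.
split.
  apply/integrableP; split=> //.
  have := cov (fun x => `|(EFin \o f) x|)%E mab (fun x => abse_ge0 _).
  rewrite /comp /= => ->; rewrite lte_mul_pinfty// ?lee_fin ?invr_ge0//.
have iF : mu.-integrable setT (EFin \o f) by apply/integrableP.
have fp : (\int[mu]_x (EFin \o f)^\+ x)%E \is a fin_num.
  exact: integrable_pos_fin_num.
have fn : (\int[mu]_x (EFin \o f)^\- x)%E \is a fin_num.
  exact: integrable_neg_fin_num.
rewrite /Rintegral integralE [in RHS]integralE.
have -> : (\int[mu]_x ((fun x => (f (c * x + d)%R)%:E)^\+ x) =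
   `|c|^-1%:E * \int[mu]_x (EFin \o f)^\+ x)%E.
  rewrite -(cov _ (measurable_funepos mf) (fun x => funepos_ge0 _ x)).
  by apply: eq_integral => x _; rewrite !funeposE.
have -> : (\int[mu]_x ((fun x => (f (c * x + d)%R)%:E)^\- x) =
   `|c|^-1%:E * \int[mu]_x (EFin \o f)^\- x)%E.
  rewrite -(cov _ (measurable_funeneg mf) (fun x => funeneg_ge0 _ x)).
  by apply: eq_integral => x _; rewrite !funenegE.
rewrite -/(EFin \o f); move: fp fn.
move: (\int[mu]_x (EFin \o f)^\+ x)%E (\int[mu]_x (EFin \o f)^\- x)%E.
by move=> X Y /fineK <- /fineK <- /=; ring.
Qed.

Lemma integrable_subr (k1 k2 : R -> R) : mu.-integrable setT (EFin \o k1) ->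
  mu.-integrable setT (EFin \o k2) ->
  mu.-integrable setT (EFin \o (fun x => k1 x - k2 x)).
Proof. by move=> i1 i2; have := integrableB measurableT i1 i2; apply: eq_integrable. Qed.

Lemma integrable_addr (k1 k2 : R -> R) : mu.-integrable setT (EFin \o k1) ->
  mu.-integrable setT (EFin \o k2) ->
  mu.-integrable setT (EFin \o (fun x => k1 x + k2 x)).
Proof. by move=> i1 i2; have := integrableD measurableT i1 i2; apply: eq_integrable. Qed.

Lemma integrable_mulrl (c : R) (k : R -> R) : mu.-integrable setT (EFin \o k) ->
  mu.-integrable setT (EFin \o (fun x => c * k x)).
Proof. by move=> i1; have := integrableZl measurableT c i1; apply: eq_integrable. Qed.

Lemma Rintegral_restrict (A : set R) (f : R -> R) : (forall x, ~ A x -> f x = 0) ->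
  \int[mu]_(x in A) f x = \int[mu]_x f x.
Proof.
move=> f0; rewrite Rintegral_mkcond; congr Rintegral; apply/funext => x.
rewrite patchE; case: ifPn => //; rewrite notin_setE => nA.
by rewrite f0.
Qed.

Lemma ecvg0_squeeze (u e : nat -> \bar R) (C : R) : 0 <= C ->
  (forall n, 0 <= u n)%E -> (forall n, u n <= C%:E * e n)%E ->
  (forall n, 0 <= e n)%E -> (forall n, e n < (n.+1%:R^-1)%:E)%E ->
  u n @[n --> \oo] --> 0%E.
Proof.
move=> C0 u0 uC e0 eh.
have uh n : (u n <= (C * n.+1%:R^-1)%:E)%E.
  by apply: (le_trans (uC n)); rewrite EFinM lee_wpmul2l ?lee_fin// ltW.
have ufin n : u n \is a fin_num.
  by rewrite ge0_fin_numE//; apply: le_lt_trans (uh n) _; exact: ltry.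
apply/fine_cvgP; split; first exact: nearW.
have H : C * (n.+1%:R^-1) @[n --> \oo] --> (0 : R).
  by rewrite -[X in _ --> X](mulr0 C); apply: cvgMr; exact: cvg_harmonic.
apply: (@squeeze_cvgr _ _ _ _ (cst 0) (fun n => C * n.+1%:R^-1)) => //; last exact: cvg_cst.
by apply: nearW => n; rewrite /= -!lee_fin fineK// u0 uh.
Qed.

End L2Line.

Section DataProfile.
Context {R : realType}.
Local Notation mu := (@lebesgue_measure R).
Variables (l1 l2 t0 : R).
Hypotheses (l1_ge0 : 0 <= l1) (l1_lt1 : l1 < 1) (l2_ge0 : 0 <= l2) (l2_lt1 : l2 < 1).
Hypothesis l12_gt0 : 0 < l1 + l2.
Hypothesis t0_gt0 : 0 < t0.

Local Notation rho := (alpha_l l1 l2 * beta_l l1 l2).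
Local Notation sg := (mirror l2).
Local Notation I0 := (I_ l1 l2 t0).
Local Notation pmin := (phase_min l1 l2 t0).
Local Notation pmid := (phase_mid l2 t0).
Local Notation pmax := (phase_max l1 t0).
Local Notation A := (`]pmin, pmax[%classic : set R).

Variables (f h : R -> R).
Hypotheses (f2 : L2 I0 f) (h2 : L2 I0 h).
Hypothesis fmean : \int[mu]_(x in I0) f x = 0.

Let sg0 : 0 < sg. Proof. exact: mirror_gt0. Qed.
Let mI : measurable I0. Proof. exact: measurable_itv. Qed.

(** The derivative of the profile whose reflected wave has initial data
    [(f, h)]: solving the two equations of [profile_wave_initial] for the values
    of [g1] at the phases [t0 - x] and [sg (t0 + x)].  The first kind of phases
    fills [(phase_mid, phase_max)] and the second [(phase_min, phase_mid)], so
    that at most one of the two terms is nonzero. *)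
Definition data_profile (eta : R) : R :=
  ((h \_ I0) (-1 * eta + t0) - (f \_ I0) (-1 * eta + t0)) / 2
  - ((h \_ I0) (sg^-1 * eta + - t0) + (f \_ I0) (sg^-1 * eta + - t0)) / (2 * sg).

Local Notation D := data_profile.

Let fT : L2 setT (f \_ I0). Proof. exact: L2_restrict. Qed.
Let hT : L2 setT (h \_ I0). Proof. exact: L2_restrict. Qed.
Let N1n0 : (-1 : R) != 0. Proof. by rewrite oppr_eq0 oner_eq0. Qed.
Let sgVn0 : sg^-1 != 0. Proof. by rewrite invr_eq0 gt_eqF. Qed.

Lemma data_profile_L2 : L2 setT D.
Proof.
have -> : D = (fun eta => 2^-1 * ((h \_ I0) (-1 * eta + t0) - (f \_ I0) (-1 * eta + t0)) -
   (2 * sg)^-1 * ((h \_ I0) (sg^-1 * eta + - t0) + (f \_ I0) (sg^-1 * eta + - t0))).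
  by apply/funext => x; rewrite /D [_ / 2]mulrC [_ / (2 * sg)]mulrC.
apply: L2B => //; apply: L2Z => //.
  by apply: (@L2B R setT (fun eta => (h \_ I0) (-1 * eta + t0))
    (fun eta => (f \_ I0) (-1 * eta + t0))) => //; exact: L2_comp_affine.
by apply: (@L2D R setT (fun eta => (h \_ I0) (sg^-1 * eta + - t0))
    (fun eta => (f \_ I0) (sg^-1 * eta + - t0))) => //; exact: L2_comp_affine.
Qed.

Let restrict0 (k : R -> R) x : ~ I0 x -> (k \_ I0) x = 0.
Proof. by move=> nI; rewrite patchE memNset. Qed.

Let restrictI (k : R -> R) x : I0 x -> (k \_ I0) x = k x.
Proof. by move=> Ix; rewrite patchE mem_set. Qed.

Let mirrorK x : sg * (t0 + (sg^-1 * x + - t0)) = x.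
Proof. by rewrite addrC subrK mulrA divff ?mul1r// gt_eqF. Qed.

Let directK x : t0 - (-1 * x + t0) = x. Proof. by ring. Qed.

Lemma data_profile_vanish : vanishes_outside pmin pmax D.
Proof.
have mm := phase_min_mid l1_ge0 l1_lt1 l2_ge0 l2_lt1 l12_gt0 t0_gt0.
have mM := phase_mid_max l1_ge0 l1_lt1 l2_ge0 l2_lt1 l12_gt0 t0_gt0.
move=> x xA.
have n1 : ~ I0 (sg^-1 * x + - t0).
  move/(mirror_initial l1 t0 l2_ge0 l2_lt1 _).1.
  by rewrite mirrorK => /andP[H1 H2]; case: xA => ?; lra.
have n2 : ~ I0 (-1 * x + t0).
  move/(direct_initial l1 l2 t0 _).1.
  by rewrite directK => /andP[H1 H2]; case: xA => ?; lra.
by rewrite /D !(restrict0 _ n1) !(restrict0 _ n2) addr0 subr0 !mul0r subr0.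
Qed.

Lemma data_profile_initial x : I0 x ->
  - D (t0 - x) - sg * D (sg * (t0 + x)) = f x /\
  D (t0 - x) - sg * D (sg * (t0 + x)) = h x.
Proof.
move=> Ix.
have /andP[d1 d2] := (direct_initial l1 l2 t0 x).1 Ix.
have /andP[m1 m2] := (mirror_initial l1 t0 l2_ge0 l2_lt1 x).1 Ix.
have n1 : ~ I0 (sg^-1 * (t0 - x) + - t0).
  move/(mirror_initial l1 t0 l2_ge0 l2_lt1 _).1; rewrite mirrorK => /andP[_ H].
  by move: (lt_trans d1 H); rewrite ltxx.
have n2 : ~ I0 (-1 * (sg * (t0 + x)) + t0).
  move/(direct_initial l1 l2 t0 _).1; rewrite directK => /andP[H _].
  by move: (lt_trans m2 H); rewrite ltxx.
have E1 : -1 * (t0 - x) + t0 = x by ring.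
have E2 : sg^-1 * (sg * (t0 + x)) + - t0 = x.
  by rewrite mulKf ?gt_eqF// addrAC subrr add0r.
rewrite /D E1 E2 !(restrict0 _ n1) !(restrict0 _ n2) !(restrictI _ Ix).
have s2 : sg != 0 by rewrite gt_eqF.
by move: (f x) (h x) (sg) s2 => a b c c0; split; field.
Qed.

Lemma L2_integrable_I0 (k : R -> R) : L2 I0 k -> mu.-integrable I0 (EFin \o k).
Proof.
move=> k2; have ab : - l1 * t0 < l2 * t0.
  by rewrite ltr_pM2r// -subr_gt0 opprK addrC.
by have [] := L2_integral_bound ab k2 ltr01.
Qed.

Lemma integrable_restrictT (k : R -> R) : L2 I0 k ->
  mu.-integrable setT (EFin \o (k \_ I0)) /\ \int[mu]_x (k \_ I0) x = \int[mu]_(x in I0) k x.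
Proof.
move=> k2; split; last by rewrite [RHS]Rintegral_mkcond.
rewrite -restrict_EFin; exact: (proj1 (@integrable_mkcond _ _ R mu I0 (EFin \o k) mI) (L2_integrable_I0 k2)).
Qed.

(** The contributions of [h] cancel, and those of [f] add up to its integral,
    which is 0 because the initial displacement vanishes at both ends. *)
Lemma data_profile_mean : \int[mu]_(x in A) D x = 0.
Proof.
rewrite Rintegral_restrict; last first.
  move=> x nA; apply: data_profile_vanish; move: nA => /= /negP.
  by rewrite in_itv /= negb_and -!leNgt => /orP.
have [if_ fE] := integrable_restrictT f2; have [ih hE] := integrable_restrictT h2.
rewrite fmean in fE.
have [f1 f1E] := Rintegral_affineT t0 N1n0 if_.
have [h1 h1E] := Rintegral_affineT t0 N1n0 ih.
have [f3 f3E] := Rintegral_affineT (- t0) sgVn0 if_.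
have [h3 h3E] := Rintegral_affineT (- t0) sgVn0 ih.
have mT : measurable (setT : set R) by [].
rewrite (_ : D = fun eta => 2^-1 * ((h \_ I0) (-1 * eta + t0) - (f \_ I0) (-1 * eta + t0)) -
   (2 * sg)^-1 * ((h \_ I0) (sg^-1 * eta + - t0) + (f \_ I0) (sg^-1 * eta + - t0))); last first.
  by apply/funext => x; rewrite /D [_ / 2]mulrC [_ / (2 * sg)]mulrC.
have iB : mu.-integrable setT (EFin \o (fun eta =>
    (h \_ I0) (-1 * eta + t0) - (f \_ I0) (-1 * eta + t0))).
  exact: integrable_subr.
have iD : mu.-integrable setT (EFin \o (fun eta =>
    (h \_ I0) (sg^-1 * eta + - t0) + (f \_ I0) (sg^-1 * eta + - t0))).
  exact: integrable_addr.
rewrite RintegralB//; last 2 first.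
- exact: integrable_mulrl.
- exact: integrable_mulrl.
rewrite !RintegralZl// RintegralB// RintegralD//.
rewrite f1E h1E f3E h3E fE normrN normr1 gtr0_norm ?invr_gt0//.
have s2 : sg != 0 by rewrite gt_eqF.
by move: (\int[mu]_x _) (sg) s2 => a c c0; field.
Qed.

(** The map from profiles to data is continuous; the error of the profile enters
    through the two phases, one at unit rate and one at rate [sg]. *)
Lemma profile_data_error g g1 g2 : C2_profile pmin pmax g g1 g2 ->
  let err := sqint A (fun x => g1 x - D x) in
  let u := profile_wave l1 l2 t0 g in
  (sqint I0 (fun x => (dx u x t0 - f x)%R) <= (2 + 2 * sg)%:E * err)%E /\
  (sqint I0 (fun x => (dt u x t0 - h x)%R) <= (2 + 2 * sg)%:E * err)%E.
Proof.
move=> gP err u; have [_ dg1 _ gv] := gP.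
have mD := data_profile_L2.1.
have mg1 : measurable_fun setT g1.
  exact: continuous_measurable_fun (is_derive_continuous dg1).
pose e x := g1 x - D x.
have me : measurable_fun setT e by exact: measurable_funB.
have ev x : x <= pmin \/ pmax <= x -> e x = 0.
  by move=> xA; rewrite /e data_profile_vanish// subr0; have [] := gv x xA.
have eE : sqint setT e = err.
  rewrite /err -(sqint_restrict A); apply: eq_sqint => x _; rewrite patchE.
  case: ifPn => //; rewrite notin_setE /= => /negP.
  by rewrite in_itv /= negb_and -!leNgt => /orP/ev.
pose e1 x := e (-1 * x + t0); pose e2 x := sg * e (sg * x + sg * t0).
have me1 : measurable_fun setT e1 by exact: measurable_comp_affine.
have me2' : measurable_fun setT (fun x => e (sg * x + sg * t0)) by exact: measurable_comp_affine.
have me2 : measurable_fun setT e2 by exact: measurable_funM.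
have e1E : sqint setT e1 = err.
  by rewrite /e1 sqint_affineT// normrN normr1 invr1 mul1e.
have e2E : sqint setT e2 = (sg%:E * err)%E.
  rewrite /e2 sqintZ// sqint_affineT ?gt_eqF// gtr0_norm// eE muleA -EFinM.
  by rewrite expr2 mulfK// gt_eqF.
have bound (k : R -> R) : measurable_fun setT k -> (forall x, k x ^+ 2 <= 2 * e1 x ^+ 2 + 2 * e2 x ^+ 2) ->
   (sqint setT k <= (2 + 2 * sg)%:E * err)%E.
  move=> mk kle.
  apply: (@le_trans _ _ (2%:E * sqint setT e1 + 2%:E * sqint setT e2)%E).
    by apply: sqint_le_comb => //.
  have sg2 : 0 <= 2 * sg by rewrite mulr_ge0// ltW.
  by rewrite e1E e2E muleA -EFinM -ge0_muleDl// lee_fin.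
have sub (k : R -> R) : measurable_fun setT k -> (sqint I0 k <= sqint setT k)%E.
  by move=> mk; apply: sqint_subset.
have key x : I0 x -> dx u x t0 - f x = - e1 x - e2 x /\ dt u x t0 - h x = e1 x - e2 x.
  move=> Ix.
  have [-> ->] := profile_wave_initial l1_ge0 l1_lt1 l2_ge0 l2_lt1 l12_gt0 t0_gt0 gP Ix.
  have [<- <-] := data_profile_initial Ix.
  rewrite /e1 /e2 /e; have -> : -1 * x + t0 = t0 - x by ring.
  have -> : sg * x + sg * t0 = sg * (t0 + x) by rewrite mulrDr addrC.
  move: (g1 (t0 - x)) (g1 (sg * (t0 + x))) (D (t0 - x)) (D (sg * (t0 + x))) => a b c d.
  by move: sg => s; split; ring.
split.
  rewrite (@eq_sqint _ _ _ (fun x => - e1 x - e2 x)); last first.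
    by move=> x /[!inE] Ix; case: (key x Ix).
  have mk : measurable_fun setT (fun x => - e1 x - e2 x).
    by apply: measurable_funB => //; exact: measurable_funN.
  apply: (le_trans (sub _ mk)); apply: bound => // x.
  by have := sqr_ge0 (e1 x - e2 x); lra.
rewrite (@eq_sqint _ _ _ (fun x => e1 x - e2 x)); last first.
  by move=> x /[!inE] Ix; case: (key x Ix).
have mk : measurable_fun setT (fun x => e1 x - e2 x) by exact: measurable_funB.
apply: (le_trans (sub _ mk)); apply: bound => // x.
by have := sqr_ge0 (e1 x + e2 x); lra.
Qed.

End DataProfile.

Section ScaledSumL2.
Context {R : realType}.
Local Notation mu := (@lebesgue_measure R).

Lemma scaled_sumB (a r c : R) (D E : R -> R) x :
  scaled_sum a r c (fun y => D y - E y) x = scaled_sum a r c D x - scaled_sum a r c E x.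
Proof. by rewrite /scaled_sum -sumrB; apply: eq_bigr => k _; rewrite mulrBr. Qed.

Lemma scaled_partial_sum_bound (r c k : R) (n : nat) : r != 0 -> k != 0 ->
  exists2 C : R, 0 <= C & forall D : R -> R, measurable_fun setT D ->
    measurable_fun setT (fun t => \sum_(i < n) c ^+ i * D (k * t / r ^+ i)) /\
    (sqint setT (fun t => (\sum_(i < n) c ^+ i * D (k * t / r ^+ i))%R) <= C%:E * sqint setT D)%E.
Proof.
move=> r0 k0; elim: n => [|n [C C0 IH]].
  exists 0 => // D mD.
  have -> : (fun t => \sum_(i < 0) c ^+ i * D (k * t / r ^+ i)) = cst 0.
    by apply/funext => t; rewrite big_ord0.
  split; first exact: measurable_cst.
  rewrite mul0e /sqint /cst expr0n /=.
  by rewrite (_ : (fun=> 0%:E) = cst 0%E)// integral0.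
have kr0 : k / r ^+ n != 0 by rewrite mulf_neq0// invr_eq0 expf_neq0.
pose C' := c ^+ n ^+ 2 * `|k / r ^+ n|^-1.
have C'0 : 0 <= C' by rewrite mulr_ge0 ?sqr_ge0// invr_ge0.
exists (2 * C + 2 * C'); first by rewrite addr_ge0// mulr_ge0.
move=> D mD; have [mS HS] := IH D mD.
have mT : measurable_fun setT (fun t => D (k / r ^+ n * t + 0)) by exact: measurable_comp_affine.
have mcT : measurable_fun setT (fun t => c ^+ n * D (k / r ^+ n * t + 0)) by exact: measurable_funM.
have -> : (fun t => \sum_(i < n.+1) c ^+ i * D (k * t / r ^+ i)) =
   (fun t => \sum_(i < n) c ^+ i * D (k * t / r ^+ i) + c ^+ n * D (k / r ^+ n * t + 0)).
  by apply/funext => t; rewrite big_ord_recr /= addr0 mulrAC.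
split; first exact: measurable_funD.
apply: (le_trans (sqintD_le measurableT mS mcT)).
rewrite (sqintZ (c ^+ n) measurableT mT) (sqint_affineT 0 kr0 mD).
have sD := sqint_ge0 setT D.
have -> : ((2 * C + 2 * C')%:E * sqint setT D =
    2%:E * (C%:E * sqint setT D) + 2%:E * (C'%:E * sqint setT D))%E.
  have C2 : 0 <= 2 * C by exact: mulr_ge0.
  have C2' : 0 <= 2 * C' by exact: mulr_ge0.
  by rewrite [X in (X * _ = _)%E](EFinD (2 * C) (2 * C')) ge0_muleDl ?lee_fin// !muleA.
apply: leeD; first by rewrite lee_wpmul2l.
by rewrite /C' [X in (_ <= _ * (X * _))%E]EFinM -muleA.
Qed.

End ScaledSumL2.

Section TraceExists.
Context {R : realType}.
Local Notation mu := (@lebesgue_measure R).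
Variables (l1 l2 t0 : R).
Hypotheses (l1_ge0 : 0 <= l1) (l1_lt1 : l1 < 1) (l2_ge0 : 0 <= l2) (l2_lt1 : l2 < 1).
Hypothesis l12_gt0 : 0 < l1 + l2.
Hypothesis t0_gt0 : 0 < t0.

Local Notation rho := (alpha_l l1 l2 * beta_l l1 l2).
Local Notation sg := (mirror l2).
Local Notation I0 := (I_ l1 l2 t0).
Local Notation pmin := (phase_min l1 l2 t0).
Local Notation pmax := (phase_max l1 t0).
Local Notation A := (`]pmin, pmax[%classic : set R).

Let rho1 : 1 < rho. Proof. exact: period_gt1. Qed.
Let pmin0 : 0 < pmin. Proof. exact: phase_min_gt0. Qed.

(** The formula of [profile_wave_trace], for profiles with an L^2 derivative. *)
Definition profile_trace (D : R -> R) (t : R) : R :=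
  - (1 + sg) * scaled_sum pmin rho (1 / rho) D ((1 - l2) * t).

(** On a bounded time interval the number of reflections is bounded, so the
    trace is a fixed finite combination of dilates of the profile. *)
Lemma profile_trace_bound (T : R) : exists2 C : R, 0 <= C &
  forall D : R -> R, measurable_fun setT D -> (forall x, x <= pmin -> D x = 0) ->
    measurable_fun `[t0, (t0 + T)] (profile_trace D) /\
    (sqint `[t0, (t0 + T)%R] (profile_trace D) <= C%:E * sqint setT D)%E.
Proof.
have [n nT] := expr_scale_unbounded pmin0 rho1 ((1 - l2) * (t0 + T)).
have r0 : rho != 0 by rewrite gt_eqF// (lt_trans ltr01).
have k0 : 1 - l2 != 0 by rewrite gt_eqF// subr_gt0.
have [C C0 HC] := scaled_partial_sum_bound (1 / rho) n r0 k0.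
exists ((1 + sg) ^+ 2 * C); first by rewrite mulr_ge0// sqr_ge0.
move=> D mD D0; have [mS HS] := HC D mD.
set S := (fun t => \sum_(i < n) _) in mS HS.
have E : {in `[t0, (t0 + T)]%classic, profile_trace D =1 (fun t => - (1 + sg) * S t)}.
  move=> t; rewrite inE /= in_itv /= => /andP[_ tT]; rewrite /profile_trace /S.
  congr (_ * _); apply: scaled_sumE => //.
  by apply: le_trans (ltW nT); rewrite ler_pM2l ?subr_gt0.
have mSc : measurable_fun setT (fun t => - (1 + sg) * S t) by exact: measurable_funM.
have mJ : measurable (`[t0, (t0 + T)]%classic : set R) by [].
split.
  by apply: eq_measurable_fun (measurable_funTS mSc) => x xJ; rewrite E.
rewrite (eq_sqint E); apply: (@le_trans _ _ (sqint setT (fun t => - (1 + sg) * S t))).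
  exact: sqint_subset.
rewrite sqintZ// sqrrN [X in (_ <= X * _)%E]EFinM -muleA.
by apply: lee_wpmul2l => //; rewrite lee_fin sqr_ge0.
Qed.

(** The candidate is the trace formula applied to the derivative [D] of the
    limit profile; both data and trace of the C^2 approximations converge,
    being bounded by the distance of their profile to [D]. *)
Lemma trace_exists (f h : R -> R) : L2 I0 f -> L2 I0 h ->
  \int[mu]_(x in I0) f x = 0 -> exists g, is_trace l1 l2 t0 f h g.
Proof.
move=> f2 h2 fmean; pose D := data_profile l1 l2 t0 f h.
have D2 : L2 setT D by exact: data_profile_L2.
have Dv : vanishes_outside pmin pmax D by exact: data_profile_vanish.
have Dl x : x <= pmin -> D x = 0 by move=> xp; apply: Dv; left.
have mA : measurable A by [].
have D2A : L2 A D.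
  have mD : measurable_fun A D := measurable_funTS D2.1.
  split=> //; apply: le_lt_trans D2.2.
  by have := sqint_subset mA measurableT (@subsetT _ A) D2.1.
have Dm : \int[mu]_(x in A) D x = 0 by exact: data_profile_mean.
have ab : pmin < pmax.
  by apply: lt_trans (phase_min_mid _ _ _ _ _ _) (phase_mid_max _ _ _ _ _ _).
have H n : exists p : (R -> R) * (R -> R) * (R -> R),
    C2_profile pmin pmax p.1.1 p.1.2 p.2 /\
    (sqint A (fun x => (p.1.2 x - D x)%R) < (n.+1%:R^-1)%:E)%E.
  have n0 : 0 < n.+1%:R^-1 :> R by rewrite invr_gt0.
  have [g [g1 [g2 [gP gD]]]] := profile_dense ab D2A Dm n0.
  by exists (g, g1, g2).
have [p pP] := choice H.
exists (profile_trace D); split.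
  move=> T T0; have [C C0 HC] := profile_trace_bound T.
  have [mt ht] := HC D D2.1 Dl; split=> //; apply: (le_lt_trans ht).
  by rewrite lte_mul_pinfty//; exact: D2.2.
pose u n := profile_wave l1 l2 t0 (p n).1.1.
have sg0 : 0 <= 2 + 2 * sg by rewrite addr_ge0// mulr_ge0// ltW// mirror_gt0.
exists u; split.
- by move=> n; exact: profile_wave_classical (pP n).1.
- apply: (@ecvg0_squeeze _ _ (fun n => sqint A (fun x => (p n).1.2 x - D x)) (2 + 2 * sg)) => //.
  + by move=> n; exact: sqint_ge0.
  + by move=> n; case: (profile_data_error l1_ge0 l1_lt1 l2_ge0 l2_lt1 l12_gt0 t0_gt0 f2 h2 (pP n).1).
  + by move=> n; exact: sqint_ge0.
  + by move=> n; exact: (pP n).2.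
- apply: (@ecvg0_squeeze _ _ (fun n => sqint A (fun x => (p n).1.2 x - D x)) (2 + 2 * sg)) => //.
  + by move=> n; exact: sqint_ge0.
  + by move=> n; case: (profile_data_error l1_ge0 l1_lt1 l2_ge0 l2_lt1 l12_gt0 t0_gt0 f2 h2 (pP n).1).
  + by move=> n; exact: sqint_ge0.
  + by move=> n; exact: (pP n).2.
move=> T T0; have [C C0 HC] := profile_trace_bound T.
apply: (@ecvg0_squeeze _ _ (fun n => sqint A (fun x => (p n).1.2 x - D x)) C) => //.
- by move=> n; exact: sqint_ge0.
- move=> n; have [gP _] := pP n; have [_ dg1 _ gv] := gP.
  pose e x := (p n).1.2 x - D x.
  have mg1 : measurable_fun setT (p n).1.2.
    exact: continuous_measurable_fun (is_derive_continuous dg1).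
  have me : measurable_fun setT e by exact: measurable_funB mg1 D2.1.
  have ev : vanishes_outside pmin pmax e.
    by move=> x xA; rewrite /e Dv// subr0; have [] := gv x xA.
  have [_] := HC e me (fun x xp => ev x (or_introl xp)).
  have -> : sqint setT e = sqint A e.
    rewrite -(sqint_restrict A); apply: eq_sqint => x _; rewrite patchE.
    case: ifPn => //; rewrite notin_setE /= => /negP.
    by rewrite in_itv /= negb_and -!leNgt => /orP/ev.
  have -> // : profile_trace e = (fun t => dx (u n) (l2 * t) t - profile_trace D t).
  apply/funext => t; rewrite -[dx _ _ _]/(trace_on l2 (u n) t).
  rewrite (profile_wave_trace l1_lt1 l2_ge0 l2_lt1 l12_gt0 t0_gt0 gP).
  by rewrite /profile_trace /e scaled_sumB mulrBr.
- by move=> n; exact: sqint_ge0.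
- by move=> n; exact: (pP n).2.
Qed.

End TraceExists.

(** * The two inequalities for finite-energy solutions *)

Section TraceInequalities.
Context {R : realType}.
Local Notation mu := (@lebesgue_measure R).
Variables (l1 l2 t0 : R).
Hypotheses (l1_ge0 : 0 <= l1) (l1_lt1 : l1 < 1) (l2_ge0 : 0 <= l2) (l2_lt1 : l2 < 1).
Hypothesis l12_gt0 : 0 < l1 + l2.
Hypothesis t0_gt0 : 0 < t0.

Local Notation rho := (alpha_l l1 l2 * beta_l l1 l2).
Local Notation I0 := (I_ l1 l2 t0).

Definition direct_const : R := 2 / (trace_gain l2 * (1 - rho^-1)).
Definition inverse_const : R := trace_gain l2 * trace_skew l1 / 2.

Let rho_gt1 : 1 < rho. Proof. exact: period_gt1. Qed.
Let gain0 : 0 < trace_gain l2. Proof. exact: trace_gain_gt0. Qed.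

Lemma direct_const_ge0 : 0 <= direct_const.
Proof.
have r0 : 0 < rho := lt_trans ltr01 rho_gt1.
have H : 0 <= 1 - rho^-1 by rewrite subr_ge0 invf_le1 ?ltW.
exact: divr_ge0 (ler0n _ 2) (mulr_ge0 (ltW gain0) H).
Qed.

Let mI : measurable I0. Proof. exact: measurable_itv. Qed.

Let data_normE u : classical_solution l1 l2 t0 u ->
  data_norm l1 l2 t0 (dx u ^~ t0) (dt u ^~ t0) =
  (sqint I0 (dx u ^~ t0) + sqint I0 (dt u ^~ t0))%E.
Proof.
move=> cu; rewrite /data_norm /I_ !sqint_itv_cc//; apply: measurable_funTS;
  apply: continuous_measurable_fun.
  exact: initial_dt_continuous cu.
exact: initial_dx_continuous cu.
Qed.

Lemma classical_direct_open u (T : R) : classical_solution l1 l2 t0 u -> 0 <= T ->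
  (sqint `[t0, (t0 + T)%R] (trace_on l2 u) <=
    direct_const%:E * (sqint I0 (dx u ^~ t0) + sqint I0 (dt u ^~ t0)))%E.
Proof. by move=> cu T0; rewrite -data_normE//; exact: classical_direct. Qed.

Section Limits.
Variables (f h g : R -> R) (u : nat -> R -> R -> R).
Hypotheses (f2 : L2 I0 f) (h2 : L2 I0 h) (g2 : forall T : R, 0 <= T -> L2 `[t0, (t0 + T)] g).
Hypothesis cu : forall n, classical_solution l1 l2 t0 (u n).
Hypothesis cvgf : sqint I0 (fun x => dx (u n) x t0 - f x) @[n --> \oo] --> 0%E.
Hypothesis cvgh : sqint I0 (fun x => dt (u n) x t0 - h x) @[n --> \oo] --> 0%E.
Hypothesis cvgg : forall T : R, 0 <= T ->
  sqint `[t0, (t0 + T)%R] (fun t => trace_on l2 (u n) t - g t) @[n --> \oo] --> 0%E.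

Let mc (A : set R) (k : R -> R) : continuous k -> measurable_fun A k.
Proof. by move=> ck; apply: measurable_funTS; exact: continuous_measurable_fun. Qed.

Lemma trace_sqint_cvg (T : R) : 0 <= T ->
  sqint `[t0, (t0 + T)%R] (trace_on l2 (u n)) @[n --> \oo] --> sqint `[t0, (t0 + T)%R] g.
Proof.
move=> T0; apply: (@sqint_cvg R nat \oo _ _ g (fun n => trace_on l2 (u n))) => //.
- exact: g2.
- by move=> n; apply: mc; exact: right_trace_continuous (cu n).
- exact: cvgg.
Qed.

Lemma data_sqint_cvg :
  (sqint I0 (dx (u n) ^~ t0) + sqint I0 (dt (u n) ^~ t0))%E @[n --> \oo] -->
  (sqint I0 f + sqint I0 h)%E.
Proof.
have fin k : L2 I0 k -> sqint I0 k \is a fin_num.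
  by move=> [mk kk]; rewrite ge0_fin_numE// sqint_ge0.
apply: cvgeD.
- by apply: fin_num_adde_defr; exact: fin.
- apply: (@sqint_cvg R nat \oo _ _ f (fun n => dx (u n) ^~ t0)) => //.
  by move=> n; apply: mc; exact: initial_dx_continuous (cu n).
- apply: (@sqint_cvg R nat \oo _ _ h (fun n => dt (u n) ^~ t0)) => //.
  by move=> n; apply: mc; exact: initial_dt_continuous (cu n).
Qed.

Lemma trace_direct_lim (T : R) : 0 <= T ->
  (sqint `[t0, (t0 + T)%R] g <= direct_const%:E * (sqint I0 f + sqint I0 h))%E.
Proof.
move=> T0; have H1 := trace_sqint_cvg T0; have H2 := data_sqint_cvg.
have H3 := cvgeZl (isT : direct_const%:E \is a fin_num) H2.
rewrite -(cvg_lim _ H1)// -(cvg_lim _ H3)//; apply: lee_lim.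
- by apply/cvg_ex; eexists; exact: H1.
- by apply/cvg_ex; eexists; exact: H3.
- by apply: nearW => n; exact: classical_direct_open.
Qed.

Lemma trace_inverse_lim (T : R) : 0 <= T -> rho * t0 <= t0 + T ->
  (sqint I0 f + sqint I0 h <= inverse_const%:E * sqint `[t0, (t0 + T)%R] g)%E.
Proof.
move=> T0 rT; have H1 := trace_sqint_cvg T0; have H2 := data_sqint_cvg.
have H3 := cvgeZl (isT : inverse_const%:E \is a fin_num) H1.
rewrite -(cvg_lim _ H2)// -(cvg_lim _ H3)//; apply: lee_lim.
- by apply/cvg_ex; eexists; exact: H2.
- by apply/cvg_ex; eexists; exact: H3.
- by apply: nearW => n; rewrite -data_normE//; exact: classical_inverse.
Qed.

End Limits.

Lemma trace_direct (f h g : R -> R) (T : R) : L2 I0 f -> L2 I0 h ->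
  is_trace l1 l2 t0 f h g -> 0 <= T ->
  (sqint `[t0, (t0 + T)%R] g <= direct_const%:E * (sqint I0 f + sqint I0 h))%E.
Proof. by move=> f2 h2 [g2 [u [cu uf uh ug]]]; exact: (trace_direct_lim f2 h2 g2 cu uf uh ug). Qed.

Lemma trace_inverse (f h g : R -> R) (T : R) : L2 I0 f -> L2 I0 h ->
  is_trace l1 l2 t0 f h g -> 0 <= T -> rho * t0 <= t0 + T ->
  (sqint I0 f + sqint I0 h <= inverse_const%:E * sqint `[t0, (t0 + T)%R] g)%E.
Proof. by move=> f2 h2 [g2 [u [cu uf uh ug]]]; exact: (trace_inverse_lim f2 h2 g2 cu uf uh ug). Qed.

Lemma energyE (phix phit : R -> R -> R) : L2 I0 (phix ^~ t0) -> L2 I0 (phit ^~ t0) ->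
  energy l1 l2 phix phit t0 =
  (2^-1%:E * (sqint I0 (phix ^~ t0) + sqint I0 (phit ^~ t0)))%E.
Proof.
move=> [mx _] [mt _]; rewrite /energy /sqint -ge0_integralD//.
- by move=> x _; rewrite lee_fin sqr_ge0.
- exact: measurable_sqr.
- by move=> x _; rewrite lee_fin sqr_ge0.
- exact: measurable_sqr.
Qed.

(** [H10_deriv] integrates over closed intervals, while the data live on the open
    one. *)
Lemma H10_deriv_mean0 (a b : R) (f g : R -> R) : a < b -> H10_deriv a b f g ->
  \int[mu]_(x in `]a, b[) g x = 0.
Proof.
move=> ab [[g2 fE] fa fb].
have := fE b; rewrite in_itv /= lexx (ltW ab) => /(_ isT).
rewrite fa fb add0r => E.
have [ig _] := L2_integral_bound ab g2 ltr01.
have ig' : mu.-integrable `]a, b] (EFin \o g).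
  apply/integrableP; split.
    apply/measurable_EFinP; apply: measurable_fun_itv_oc; exact: g2.1.
  have mg : measurable_fun `]a, b[ (fun x => `|(EFin \o g) x|)%E.
    by apply: measurableT_comp => //; apply/measurable_EFinP; exact: g2.1.
  rewrite (@integral_itv_bndoo R a b _ false false mg).
  by case/integrableP: ig.
by rewrite (Rintegral_itv_bndo_bndc ig) (Rintegral_itv_obnd_cbnd ig') -E.
Qed.

Lemma boundary_trace_spec (phix phit : R -> R -> R) :
  (exists g, is_trace l1 l2 t0 (phix ^~ t0) (phit ^~ t0) g) ->
  is_trace l1 l2 t0 (phix ^~ t0) (phit ^~ t0) (boundary_trace l1 l2 t0 phix phit).
Proof. by move=> H; exact: (xgetPex (cst 0) H). Qed.

Lemma boundary_trace_default (phix phit : R -> R -> R) :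
  ~ (exists g, is_trace l1 l2 t0 (phix ^~ t0) (phit ^~ t0) g) ->
  boundary_trace l1 l2 t0 phix phit = cst 0.
Proof.
move=> H; rewrite /boundary_trace; case: xgetP => // g _ gP.
by exfalso; apply: H; exists g.
Qed.

Let I0_lt : - l1 * t0 < l2 * t0.
Proof. by rewrite ltr_pM2r// -subr_gt0 opprK addrC. Qed.

(** Data without a trace have boundary integral 0 by default. *)
Lemma direct_inequality (phi0 phi1 : R -> R) (phi phix phit : R -> R -> R) (T : R) :
  0 <= T -> wave_solution l1 l2 t0 phi0 phi1 phi phix phit ->
  (boundary_integral l1 l2 t0 phix phit T <=
    (2 * direct_const)%:E * energy l1 l2 phix phit t0)%E.
Proof.
move=> T0 ws; have [[x2 _] _ _] := ws_H10 ws (lexx t0).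
have t2 := ws_L2 ws (lexx t0).
rewrite energyE// muleA -EFinM mulrAC divff// mul1r.
have [H|H] := pselect (exists g, is_trace l1 l2 t0 (phix ^~ t0) (phit ^~ t0) g).
  by apply: trace_direct => //; exact: boundary_trace_spec.
rewrite /boundary_integral (boundary_trace_default H) /cst expr0n /=.
rewrite (_ : (fun=> 0%:E) = cst 0%E)// integral0 mule_ge0//; last first.
  by rewrite adde_ge0// sqint_ge0.
by rewrite lee_fin direct_const_ge0.
Qed.

(** Here the trace must exist: the displacement vanishing at both ends, its
    derivative has mean 0, and [trace_exists] applies. *)
Lemma inverse_inequality_const (T : R) : 0 <= T -> rho * t0 <= t0 + T ->
  inverse_inequality l1 l2 t0 T (inverse_const / 2).
Proof.
move=> T0 rT phi0 phi1 phi phix phit _ _ ws.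
have H10t := ws_H10 ws (lexx t0); have [[x2 _] _ _] := H10t.
have t2 := ws_L2 ws (lexx t0).
have mean := H10_deriv_mean0 I0_lt H10t.
have tr := boundary_trace_spec (trace_exists l1_ge0 l1_lt1 l2_ge0 l2_lt1 l12_gt0 t0_gt0 x2 t2 mean).
rewrite energyE// [inverse_const / 2]mulrC EFinM -muleA; apply: lee_wpmul2l => //.
exact: trace_inverse.
Qed.

End TraceInequalities.

(** * Classical solutions are finite-energy solutions *)

Section MovingStrip.
Context {R : realType}.
Local Notation mu := (@lebesgue_measure R).

Lemma plane_bounded (F : R * R -> R) (c : R) : continuous F ->
  exists2 M : R, 0 <= M & forall x t, `|x| <= c -> `|t| <= c -> `|F (x, t)| <= M.
Proof.
move=> cF; have cK : compact (F @` (`[- c, c]%classic `*` `[- c, c]%classic)).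
  apply: continuous_compact; first exact: continuous_subspaceT.
  by apply: compact_setX; exact: segment_compact.
have [M [_ MP]] := compact_bounded cK.
exists (`|M| + 1); first by rewrite addr_ge0.
move=> x t xc tc; apply: MP; first by rewrite ltr_pwDr// ler_norm.
by exists (x, t) => //=; rewrite !in_itv /= -!ler_norml.
Qed.

Lemma integral_le_indic (w : R -> R) (B S1 S2 : set R) (c d : R) :
  measurable_fun setT w -> measurable B -> measurable S1 -> measurable S2 ->
  0 <= c -> 0 <= d ->
  (forall x, w x ^+ 2 <= c * \1_B x + (d * \1_S1 x + d * \1_S2 x)) ->
  (sqint setT w <= c%:E * mu B + (d%:E * mu S1 + d%:E * mu S2))%E.
Proof.
move=> mw mB mS1 mS2 c0 d0 wle.
have i0 (k : R) (S : set R) x : 0 <= k -> (0 <= (k * \1_S x)%:E :> \bar R)%E.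
  by move=> k0; rewrite lee_fin mulr_ge0.
have mi (k : R) (S : set R) : measurable S -> measurable_fun setT (fun x => (k * \1_S x)%:E).
  move=> mS; apply/measurable_EFinP; apply: measurable_funM => //.
have iE (k : R) (S : set R) : 0 <= k -> measurable S ->
   (k%:E * mu S = \int[mu]_x (k * \1_S x)%:E)%E.
  move=> k0 mS; under eq_integral do rewrite EFinM.
  rewrite ge0_integralZl_EFin//; first by rewrite integral_indic// setIT.
  - by apply/measurable_EFinP.
have i0' (k : R) (S : set R) x : 0 <= k -> setT x -> (0 <= (k * \1_S x)%:E :> \bar R)%E.
  by move=> k0 _; exact: i0.
rewrite (iE d S1)// (iE d S2)// -ge0_integralD//;
  [|by move=> x; exact: i0'|exact: mi|by move=> x; exact: i0'|exact: mi].
have mS : measurable_fun setT (fun x => (d * \1_S1 x)%:E + (d * \1_S2 x)%:E)%E.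
  by apply: emeasurable_funD; exact: mi.
have S0 x : setT x -> (0 <= (d * \1_S1 x)%:E + (d * \1_S2 x)%:E :> \bar R)%E.
  by move=> _; apply: adde_ge0; exact: i0.
rewrite (iE c B)// -ge0_integralD//; [|by move=> x; exact: i0'|exact: mi].
apply: ge0_le_integral => //.
- by move=> x _; rewrite lee_fin sqr_ge0.
- exact: measurable_sqr.
- by apply: emeasurable_funD => //; exact: mi.
- by move=> x _; rewrite -!EFinD lee_fin.
Qed.

Section Strip.
Variables (l1 l2 t0 : R).
Hypotheses (l1_ge0 : 0 <= l1) (l1_lt1 : l1 < 1) (l2_ge0 : 0 <= l2) (l2_lt1 : l2 < 1).
Hypothesis t0_gt0 : 0 < t0.
Local Notation I := (I_ l1 l2).

Lemma moving_interval_mono s t : 0 <= s -> s <= t -> I s `<=` I t.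
Proof.
move=> s0 st x; rewrite /I_ /= !in_itv /= => /andP[H1 H2]; apply/andP.
have := ler_wpM2l l1_ge0 st; have := ler_wpM2l l2_ge0 st; split; lra.
Qed.

(** [I s] and [I t] differ by two intervals of total length
    [(l1 + l2) |s - t|], on which a mere bound suffices. *)
Lemma strip_cvg0 (w : R -> R -> R) (t K M : R) (F : set_system R) {FF : Filter F} :
  t0 <= t -> 0 <= K -> 0 <= M -> (forall s, measurable_fun setT (w s)) ->
  s @[s --> F] --> t ->
  (\forall s \near F, t0 <= s /\ forall x,
     [/\ I s x -> I t x -> `|w s x| <= K * `|s - t|,
         `|w s x| <= M &
         ~ I s x -> ~ I t x -> w s x = 0]) ->
  (\int[mu]_x ((w s x) ^+ 2)%:E)%E @[s --> F] --> 0%E.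
Proof.
move=> tt K0 M0 mw st Fw.
have t_gt0 : 0 < t by exact: lt_le_trans tt.
pose len := l2 * (t + 1) + l1 * (t + 1).
have len0 : 0 <= len by rewrite addr_ge0// mulr_ge0// ltW// ltr_wpDr.
pose bnd s := (K * `|s - t|) ^+ 2 * len + M ^+ 2 * ((l1 + l2) * `|s - t|).
have bnd0 : bnd s @[s --> F] --> (0 : R).
  have d0 : `|s - t| @[s --> F] --> (0 : R).
    rewrite -(@normr0 _ R) -[X in `|X|](subrr t).
    by apply: cvg_norm; apply: cvgB => //; exact: cvg_cst.
  have -> : (0 : R) = (K * 0) ^+ 2 * len + M ^+ 2 * ((l1 + l2) * 0) by ring.
  apply: cvgD; apply: cvgM; [|exact: cvg_cst|exact: cvg_cst|].
    by rewrite expr2; under eq_fun do rewrite expr2; apply: cvgM; (apply: cvgM; [exact: cvg_cst|]).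
  by apply: cvgM; [exact: cvg_cst|].
have near1 : \forall s \near F, (\int[mu]_x ((w s x) ^+ 2)%:E <= (bnd s)%:E)%E.
  have nt : \forall s \near F, `|s - t| <= 1.
    by move/cvgrPdist_le: st => /(_ 1 ltr01); apply: filterS => s; rewrite distrC.
  near=> s.
  have [ts wP] : t0 <= s /\ forall x,
     [/\ I s x -> I t x -> `|w s x| <= K * `|s - t|,
         `|w s x| <= M & ~ I s x -> ~ I t x -> w s x = 0] by near: s; exact: Fw.
  have st1 : `|s - t| <= 1 by near: s; exact: nt.
  have s_gt0 : 0 < s by exact: lt_le_trans ts.
  pose a := Num.min s t; pose b := Num.max s t.
  have ab : `|s - t| = b - a.
    rewrite /a /b; have [H|H] := leP s t.
      by rewrite ler0_norm ?subr_le0// opprB.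
    by rewrite gtr0_norm ?subr_gt0.
  have a0 : 0 <= a by rewrite le_min !ltW.
  have ale : a <= b by rewrite -subr_ge0 -ab.
  have bt : b <= t + 1.
    rewrite /b ge_max; move: st1; rewrite ler_norml => /andP[_ H].
    by apply/andP; split; lra.
  have IbE x : I b x -> x \in `[- l1 * (t + 1), l2 * (t + 1)].
    rewrite /I_ /= !in_itv /= => /andP[H1 H2].
    have := ler_wpM2l l1_ge0 bt; have := ler_wpM2l l2_ge0 bt.
    by move=> H3 H4; apply/andP; split; lra.
  pose B : set R := `[- l1 * (t + 1), l2 * (t + 1)]%classic.
  pose S1 : set R := `[- l1 * b, - l1 * a]%classic.
  pose S2 : set R := `[l2 * a, l2 * b]%classic.
  have Iab x : I s x \/ I t x -> I b x.
    by rewrite /b; case: (leP s t) => st' [H|H] //; [apply: (moving_interval_mono _ st') H|apply: (moving_interval_mono _ (ltW st')) H];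
      exact: ltW.
  have Iba x : I a x -> I s x /\ I t x.
    by rewrite /a; case: (leP s t) => st' H; split=> //; [apply: (moving_interval_mono _ st') H|apply: (moving_interval_mono _ (ltW st')) H];
      exact: ltW.
  have Ist x : I b x -> ~ I a x -> S1 x \/ S2 x.
    rewrite /I_ /S1 /S2 /= !in_itv /= => /andP[H1 H2] /negP; rewrite negb_and -!leNgt => /orP[H|H].
      by left; apply/andP; split; lra.
    by right; apply/andP; split; lra.
  have c0 : 0 <= (K * `|s - t|) ^+ 2 by rewrite sqr_ge0.
  have d0 : 0 <= M ^+ 2 by rewrite sqr_ge0.
  have i01 (S : set R) x : 0 <= \1_S x :> R by [].
  have sqle (y c : R) : 0 <= c -> `|y| <= c -> y ^+ 2 <= c ^+ 2.
    by move=> c1 yc; rewrite -[y ^+ 2]real_normK ?num_real// ler_sqr ?nnegrE.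
  have wle x : w s x ^+ 2 <= (K * `|s - t|) ^+ 2 * \1_B x +
      (M ^+ 2 * \1_S1 x + M ^+ 2 * \1_S2 x).
    have [w1 w2 w3] := wP x.
    have p1 := mulr_ge0 c0 (i01 B x).
    have p2 := mulr_ge0 d0 (i01 S1 x); have p3 := mulr_ge0 d0 (i01 S2 x).
    have [Ib|nIb] := pselect (I b x); last first.
      rewrite w3 ?expr0n ?addr_ge0//.
        by move=> H; apply: nIb; apply: Iab; left.
      by move=> H; apply: nIb; apply: Iab; right.
    have [Ia|nIa] := pselect (I a x).
      have [Hs Ht] := Iba x Ia.
      have -> : \1_B x = 1 :> R by rewrite indicE mem_set//; exact: IbE.
      rewrite mulr1; apply: (le_trans (sqle _ _ _ (w1 Hs Ht))); first by rewrite mulr_ge0.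
      by rewrite lerDl addr_ge0.
    have H : M ^+ 2 <= M ^+ 2 * \1_S1 x + M ^+ 2 * \1_S2 x.
      case: (Ist x Ib nIa) => HS.
        by rewrite [X in _ * X + _]indicE mem_set// mulr1 lerDl.
      by rewrite [X in _ + _ * X]indicE mem_set// mulr1 lerDr.
    apply: (le_trans (sqle _ _ M0 w2)); apply: (le_trans H).
    by rewrite lerDr.
  have muE (p q : R) : p <= q -> mu `[p, q]%classic = (q - p)%:E.
    rewrite lebesgue_measure_itv /= lte_fin; case: ltgtP => [//|//|-> _].
    by rewrite subrr.
  have H1 : - l1 * (t + 1) <= l2 * (t + 1) by rewrite -subr_ge0 mulNr opprK.
  have H2 : - l1 * b <= - l1 * a by rewrite !mulNr lerN2 ler_wpM2l.
  have H3 : l2 * a <= l2 * b by rewrite ler_wpM2l.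
  have := integral_le_indic (mw s) (measurable_itv _) (measurable_itv _)
    (measurable_itv _) c0 d0 wle.
  rewrite /sqint (muE _ _ H1) (muE _ _ H2) (muE _ _ H3) -!EFinM -!EFinD.
  move=> /le_trans; apply; rewrite lee_fin /bnd /len ab.
  by rewrite le_eqVlt; apply/orP; left; apply/eqP; ring.
apply: (@squeeze_cvge _ _ _ _ (cst 0%E) _ (EFin \o bnd)); last 2 first.
- exact: cvg_cst.
- by apply: cvg_EFin bnd0; exact: nearW.
by apply: filterS near1 => s ->; rewrite andbT; exact: sqint_ge0.
Unshelve. all: by end_near.
Qed.

End Strip.

End MovingStrip.

Section SmoothOnStrip.
Context {R : realType}.
Local Notation mu := (@lebesgue_measure R).

Lemma Rintegral_derive (F f : R -> R) (a b : R) : a <= b ->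
  (forall x : R, is_derive x 1 F (f x)) -> continuous f ->
  \int[mu]_(x in `[a, b]) f x = F b - F a.
Proof.
move=> + dF cf; rewrite le_eqVlt => /orP[/eqP <-|ab].
  by rewrite set_itv1 Rintegral_set1 subrr.
have cF := is_derive_continuous dF.
rewrite /Rintegral (@continuous_FTC2 R f F a b ab)//.
- exact: continuous_subspaceT.
- split.
  + by move=> x _; case: (dF x).
  + exact: cvg_at_right_filter (cF a).
  + exact: cvg_at_left_filter (cF b).
- by move=> x _; rewrite derive1E; case: (dF x).
Qed.

Variables (l1 l2 t0 : R).
Hypotheses (l1_ge0 : 0 <= l1) (l1_lt1 : l1 < 1) (l2_ge0 : 0 <= l2) (l2_lt1 : l2 < 1).
Hypothesis t0_gt0 : 0 < t0.
Local Notation I := (I_ l1 l2).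

Lemma continuous_L2_I (f : R -> R) (t : R) : continuous f -> L2 (I t) f.
Proof.
move=> cf; have mf : measurable_fun setT f by exact: continuous_measurable_fun.
split; first exact: measurable_funTS.
apply: (@le_lt_trans _ _ (sqint `[- l1 * t, l2 * t] f)).
  apply: sqint_subset => //; last exact: measurable_funTS.
  exact: measurable_itv.
  by move=> x; exact: subset_itv_oo_cc.
by rewrite -ge0_fin_numE ?sqint_ge0// sqint_continuous_fin.
Qed.

Variable u : R -> R -> R.

Lemma slice_x_continuous (k : nat) v t : class_C k v -> continuous (fun x : R => v x t).
Proof.
move=> Cv; have -> : (fun x => v x t) = (fun x => v (0 + 1 * x) (t + 0 * x)).
  by apply/funext => x; rewrite mul0r addr0 add0r mul1r.
exact: class_C_line_continuous (class_C_le (leq0n _) Cv).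
Qed.

Lemma smooth_H10_deriv (t : R) : class_C 1 u -> - l1 * t <= l2 * t ->
  u (- l1 * t) t = 0 -> u (l2 * t) t = 0 ->
  H10_deriv (- l1 * t) (l2 * t) (u ^~ t) (dx u ^~ t).
Proof.
move=> Cu lt u1 u2; split=> //; split.
  by apply: continuous_L2_I; exact: slice_x_continuous (class_C_dx Cu).
move=> x; rewrite in_itv /= => /andP[ax xb].
have -> := @Rintegral_derive (u ^~ t) (dx u ^~ t) _ _ ax
  (fun y => class_C_is_derive_dx y t Cu) (@slice_x_continuous 0 _ t (class_C_dx Cu)).
by rewrite addrC subrK.
Qed.

Lemma measurable_zext v t : continuous (v ^~ t) -> measurable_fun setT (zext l1 l2 v t).
Proof.
move=> cv; apply/(measurable_restrictT _ _).1 => //.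
  exact: measurable_itv.
by apply: measurable_funTS; exact: continuous_measurable_fun.
Qed.

(** The factor 2 leaves room for intermediate
    points, known only through their distance to [s]. *)
Lemma near_strip_bound v (k : nat) t : class_C k v ->
  exists2 M : R, 0 <= M & \forall s \near t, forall x r,
     I s x \/ I t x -> `|r - t| <= 2 * `|s - t| -> `|v x r| <= M.
Proof.
move=> Cv.
have [M M0 vM] := plane_bounded (`|t| + 1) (class_C_continuous Cv).
exists M => //.
have : \forall s \near t, 2 * `|s - t| <= 1.
  by apply/nbhs_ballP; exists 2^-1 => [|s] /=;
     rewrite ?invr_gt0// /ball /= distrC => H; lra.
apply: filterS => s st x r H rs.
have B y : `|y - t| <= 2 * `|s - t| -> `|y| <= `|t| + 1.
  move=> yt; rewrite -[y](subrK t); apply: (le_trans (ler_normD _ _)).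
  by rewrite addrC lerD2l (le_trans yt).
apply: (vM x r) => //; last exact: B.
have BI y : `|y| <= `|t| + 1 -> I y x -> `|x| <= `|t| + 1.
  move=> yt; rewrite /I_ /= in_itv /= => /andP[H1 H2]; apply: le_trans yt.
  have y0 : 0 <= `|y| by [].
  have n1 := ler_norm y; have n2 := ler_norm (- y); rewrite normrN in n2.
  have h1 := ler_wpM2l l1_ge0 n1; have h2 := ler_wpM2l l2_ge0 n1.
  have h3 : l1 * `|y| <= `|y| by rewrite ler_piMl// ltW.
  have h4 : l2 * `|y| <= `|y| by rewrite ler_piMl// ltW.
  by rewrite ler_norml; apply/andP; split; lra.
case: H; apply: BI; first by apply: B; rewrite ler_peMl ?ler1n.
by apply: B; rewrite subrr normr0 mulr_ge0 ?normr_ge0 ?ler0n.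
Qed.

Let zextE v s x : I s x -> zext l1 l2 v s x = v x s.
Proof. by move=> H; rewrite /zext patchE mem_set. Qed.

Let zext0 v s x : ~ I s x -> zext l1 l2 v s x = 0.
Proof. by move=> H; rewrite /zext patchE memNset. Qed.

(** Lipschitz in time on the common part of two intervals; off it the difference
    is bounded, on a set whose measure tends to 0. *)
Lemma smooth_L2_continuous v : class_C 1 v -> L2_continuous l1 l2 t0 v.
Proof.
move=> Cv t tt.
have [M M0 vM] := near_strip_bound t Cv.
have [K K0 vK] := near_strip_bound t (class_C_dt Cv).
have FF : Filter (within [set s | t0 <= s] (nbhs t)) by exact: within_filter.
have M2 : 0 <= 2 * M by rewrite mulr_ge0.
apply: (@strip_cvg0 R l1 l2 t0 l1_ge0 l2_ge0 t0_gt0 _ t K (2 * M) _ FF tt K0 M2).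
- by move=> s; apply: measurable_funB; apply: measurable_zext; exact: slice_x_continuous Cv.
- by apply: cvg_within_filter; exact: cvg_id.
have vM' : \forall s \near within [set s | t0 <= s] (nbhs t), forall x r,
     I s x \/ I t x -> `|r - t| <= 2 * `|s - t| -> `|v x r| <= M.
  by apply: cvg_within.
have vK' : \forall s \near within [set s | t0 <= s] (nbhs t), forall x r,
     I s x \/ I t x -> `|r - t| <= 2 * `|s - t| -> `|dt v x r| <= K.
  by apply: cvg_within.
have ts : \forall s \near within [set s | t0 <= s] (nbhs t), t0 <= s.
  exact: withinT.
near=> s.
split; first by near: s.
have H1 : forall x r, I s x \/ I t x -> `|r - t| <= 2 * `|s - t| -> `|v x r| <= M by near: s.
have H2 : forall x r, I s x \/ I t x -> `|r - t| <= 2 * `|s - t| -> `|dt v x r| <= K by near: s.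
move=> x; split.
- move=> Is It; rewrite !zextE//.
  have [c cs ->] := @mvt_between R (v x) (dt v x) t s
     (fun r => class_C_is_derive_dt x r Cv).
  rewrite normrM ler_wpM2r//; apply: H2; first by left.
  by apply: (le_trans cs); rewrite ler_peMl// ler1n.
- have B r : `|r - t| <= `|s - t| -> r = s \/ r = t -> `|zext l1 l2 v r x| <= M.
    move=> rs E; have [Ir|nIr] := pselect (I r x); last by rewrite zext0// normr0.
    rewrite zextE//; apply: H1; first by case: E Ir => ->; [left|right].
    by apply: (le_trans rs); rewrite ler_peMl// ler1n.
  apply: (le_trans (ler_normB _ _)).
  have -> : 2 * M = M + M by ring.
  by apply: lerD; apply: B; rewrite ?subrr ?normr0//; [left|right].
- by move=> ns nt; rewrite !zext0// subrr.
Unshelve. all: by end_near.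
Qed.

(** The intervals grow with time, with boundaries moving at constant speed; the
    crossing time is [- x / l1] or [x / l2]. *)
Lemma crossing_time x (s t : R) : I s x -> ~ I t x -> 0 <= s -> 0 <= t ->
  exists r, [/\ `|r - s| <= `|s - t|, `|r - t| <= `|s - t|, Num.min s t <= r &
    x = - l1 * r \/ x = l2 * r].
Proof.
move=> Is nIt s0 t0'.
have ts : t <= s.
  by rewrite leNgt; apply/negP => /ltW st; apply: nIt; exact: (moving_interval_mono l1_ge0 l2_ge0 s0 st).
have key r : t <= r <= s ->
    [/\ `|r - s| <= `|s - t|, `|r - t| <= `|s - t| & Num.min s t <= r].
  move=> /andP[tr rs]; rewrite min_r// (ger0_norm (_ : 0 <= s - t)) ?subr_ge0//.
  by rewrite ler0_norm ?subr_le0// ger0_norm ?subr_ge0//; split; lra.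
move: Is nIt; rewrite /I_ /= !in_itv /= => /andP[H1 H2] /negP.
rewrite negb_and -!leNgt => /orP[H|H].
- have l1p : 0 < l1.
    rewrite lt_neqAle l1_ge0 andbT eq_sym; apply/eqP => l10.
    by move: H1 H; rewrite l10; lra.
  exists (- x / l1); have [|-> -> ->] := key (- x / l1).
    by rewrite ler_pdivlMr// ler_pdivrMr//; apply/andP; split; lra.
  by split=> //; left; rewrite mulrC mulrN divfK ?gt_eqF// opprK.
- have l2p : 0 < l2.
    rewrite lt_neqAle l2_ge0 andbT eq_sym; apply/eqP => l20.
    by move: H2 H; rewrite l20; lra.
  exists (x / l2); have [|-> -> ->] := key (x / l2).
    by rewrite ler_pdivlMr// ler_pdivrMr//; apply/andP; split; lra.
  by split=> //; right; rewrite mulrC divfK ?gt_eqF.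
Qed.

(** On the common part of [I s] and [I t] the error is a second order Taylor
    remainder.  At a point of only one of them, the boundary passes at some time
    between [s] and [t], where [u] is 0; so the difference quotient is bounded
    there, on a set whose measure tends to 0. *)
Lemma smooth_L2_derivative : class_C 2 u ->
  (forall t, t0 <= t -> u (- l1 * t) t = 0 /\ u (l2 * t) t = 0) ->
  L2_derivative l1 l2 t0 u (dt u).
Proof.
move=> Cu bu t tt; have Ct := class_C_dt Cu; have Cu1 := class_C_le (leqnSn 1) Cu.
have [M M0 vM] := near_strip_bound t Ct.
have [K K0 vK] := near_strip_bound t (class_C_dt Ct).
pose F := within [set s | t0 <= s] t^'.
have FF : Filter F by exact: within_filter.
have Ft : F --> t.
  by apply: cvg_trans (cvg_within _) _; exact: cvg_within.
have M2 : 0 <= 2 * M by rewrite mulr_ge0.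
apply: (@strip_cvg0 R l1 l2 t0 l1_ge0 l2_ge0 t0_gt0 _ t K (2 * M) F FF tt K0 M2).
- move=> s; have mz r : measurable_fun setT (zext l1 l2 u r).
    by apply: measurable_zext; exact: slice_x_continuous Cu.
  apply: measurable_funB; last by apply: measurable_zext; exact: slice_x_continuous Ct.
  by apply: measurable_funM => //; exact: measurable_funB.
- exact: Ft.
have vM' : \forall s \near F, forall x r,
     I s x \/ I t x -> `|r - t| <= 2 * `|s - t| -> `|dt u x r| <= M.
  exact: Ft.
have vK' : \forall s \near F, forall x r,
     I s x \/ I t x -> `|r - t| <= 2 * `|s - t| -> `|dt (dt u) x r| <= K.
  exact: Ft.
have nts : \forall s \near F, t0 <= s by exact: withinT.
have sneq : \forall s \near F, s != t.
  have nt : \forall s \near t^', s != t by exact: nbhs_dnbhs_neq.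
  exact: (@cvg_within _ t^' _ _ _ nt).
near=> s.
have ts : t0 <= s by near: s.
have st : s != t by near: s.
have H1 : forall x r, I s x \/ I t x -> `|r - t| <= 2 * `|s - t| -> `|dt u x r| <= M by near: s.
have H2 : forall x r, I s x \/ I t x -> `|r - t| <= 2 * `|s - t| -> `|dt (dt u) x r| <= K by near: s.
have d0 : 0 < `|s - t| by rewrite normr_gt0 subr_eq0.
have le2 y : y <= `|s - t| -> y <= 2 * `|s - t|.
  by move=> /le_trans; apply; rewrite ler_peMl// ler1n.
have s_ge0 : 0 <= s by rewrite (le_trans _ ts)// ltW.
have t_ge0 : 0 <= t by rewrite (le_trans _ tt)// ltW.
have ut x r := class_C_is_derive_dt x r Cu.
have quot (y : R) : `|y| <= M * `|s - t| -> `|y / (s - t)| <= M.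
  by move=> ?; rewrite normrM normfV ler_pdivrMr.
split=> // x.
have Mx : I t x -> `|dt u x t| <= M.
  by move=> It; apply: H1; [right|rewrite subrr normr0 mulr_ge0].
have boundary0 r : Num.min s t <= r -> x = - l1 * r \/ x = l2 * r -> u x r = 0.
  move=> mr E; have t0r : t0 <= r by apply: le_trans mr; rewrite le_min ts.
  by have [] := bu r t0r; case: E => ->.
have [Is|nIs] := pselect (I s x); have [It|nIt] := pselect (I t x).
- rewrite !zextE//.
  have [c cs E] := @mvt_between R (u x) (dt u x) t s (ut x).
  have -> : (u x s - u x t) / (s - t) = dt u x c by rewrite E mulfK// subr_eq0.
  have cM : `|dt u x c| <= M by apply: H1; [left|exact: le2].
  split=> // [_ _|].
    have [c' cs' ->] := @mvt_between R (dt u x) (dt (dt u) x) t c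
     (fun r => class_C_is_derive_dt x r Ct).
    rewrite normrM; apply: ler_pM => //; apply: H2; first by left.
    by apply: le2; exact: le_trans cs' cs.
  apply: (le_trans (ler_normB _ _)).
  have -> : 2 * M = M + M by ring.
  by apply: lerD; [exact: cM|exact: Mx It].
- rewrite (zextE u Is) (zext0 u nIt) (zext0 (dt u) nIt) !subr0; split=> //.
  have [r [rs rt mr /(boundary0 _ mr) u0]] := crossing_time Is nIt s_ge0 t_ge0.
  have [c cs E] := @mvt_between R (u x) (dt u x) s r (ut x).
  apply: (@le_trans _ _ M); last by rewrite ler_peMl// ler1n.
  apply: quot.
  have -> : u x s = - (dt u x c * (r - s)) by rewrite -E u0 sub0r opprK.
  rewrite normrN normrM; apply: ler_pM => //; apply: H1; first by left.
  have -> : c - t = (c - s) + (s - t) by ring.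
  apply: (le_trans (ler_normD _ _)); have -> : 2 * `|s - t| = `|s - t| + `|s - t| by ring.
  by rewrite lerD2r (le_trans cs).
- rewrite (zext0 u nIs) (zextE u It) (zextE (dt u) It) sub0r; split=> //.
  have [r [rt rs]] := crossing_time It nIs t_ge0 s_ge0.
  rewrite [`|t - s|]distrC in rt; rewrite minC => mr /(boundary0 _ mr) u0.
  have [c cs E] := @mvt_between R (u x) (dt u x) t r (ut x).
  apply: (le_trans (ler_normB _ _)).
  have -> : 2 * M = M + M by ring.
  apply: lerD; last exact: Mx.
  apply: quot.
  have -> : - u x t = dt u x c * (r - t) by rewrite -E u0 sub0r.
  rewrite normrM; apply: ler_pM => //.
  by apply: H1; [right|apply: le2; exact: le_trans cs rt].
- by rewrite (zext0 u nIs) (zext0 u nIt) (zext0 (dt u) nIt) subrr mul0r subrr normr0; split.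
Unshelve. all: by end_near.
Qed.

End SmoothOnStrip.

Section PlaneIntegrals.
Context {R : realType}.
Local Notation mu := (@lebesgue_measure R).

(** A countable union of rectangles with rational end points. *)
Lemma plane_open_measurable (U : set (R * R)) : open U -> measurable U.
Proof.
move=> oU.
pose box (q : (rat * rat) * (rat * rat)) : set (R * R) :=
  `](ratr q.1.1), (ratr q.1.2)[%classic `*` `](ratr q.2.1), (ratr q.2.2)[%classic.
pose F q : set (R * R) := if `[< box q `<=` U >] then box q else set0.
have -> : U = \bigcup_q F q.
  apply/seteqP; split=> [[x t] Uxt|p [q _]]; last first.
    by rewrite /F; case: ifPn => // /asboolP; apply.
  have /nbhs_ballP[d /= d0 dU] : nbhs (x, t) U by exact: open_nbhs_nbhs.
  have [a ax] := @rat_in_itvoo _ (x - d) x ltac:(by rewrite ltrBlDr ltrDl).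
  have [b xb] := @rat_in_itvoo _ x (x + d) ltac:(by rewrite ltrDl).
  have [a' at'] := @rat_in_itvoo _ (t - d) t ltac:(by rewrite ltrBlDr ltrDl).
  have [b' tb] := @rat_in_itvoo _ t (t + d) ltac:(by rewrite ltrDl).
  move: ax xb at' tb; rewrite !in_itv /= => /andP[a1 a2] /andP[b1 b2] /andP[a3 a4] /andP[b3 b4].
  exists ((a, b), (a', b')) => //; rewrite /F ifT.
    by split; rewrite /= in_itv /=; apply/andP.
  apply/asboolP => -[y s] [] /=; rewrite !in_itv /= => /andP[y1 y2] /andP[s1 s2].
  by apply: dU; split; rewrite /= /ball /= ltr_norml; apply/andP; split; lra.
apply: countable_bigcupT_measurable => [|q]; first exact: countableP.
rewrite /F; case: ifP => // _.
by apply: measurableX; exact: measurable_itv.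
Qed.

Lemma plane_continuous_measurable (G : R * R -> R) : continuous G ->
  measurable_fun setT G.
Proof.
move=> /continuousP cG; apply: (measurability _ (RGenOpens.measurableE R)).
move=> _ [_ [a [b ->] <-]]; rewrite setTI; apply: plane_open_measurable.
exact/cG/interval_open.
Qed.

Section BoxSupport.
Variables (G : R * R -> R) (c : R).
Hypothesis cG : continuous G.
Hypothesis G0 : forall x t, c < `|x| \/ c < `|t| -> G (x, t) = 0.

Lemma plane_integrable : (mu \x mu)%E.-integrable setT (EFin \o G).
Proof.
pose A : set R := `[- c, c]%classic; pose B : set (R * R) := A `*` A.
have mB : measurable B by apply: measurableX; exact: measurable_itv.
have -> : EFin \o G = (EFin \o G) \_ B.
  apply/funext => -[x t]; rewrite patchE; case: ifPn => // /negP nB.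
  rewrite /= G0//; have [xc|?] := leP `|x| c; last by left.
  have [tc|?] := leP `|t| c; last by right.
  by exfalso; apply: nB; rewrite inE /B /A; split; rewrite /= in_itv /= -ler_norml.
have := @integrable_mkcond _ _ _ (mu \x mu)%E B (EFin \o G) mB.
move=> [+ _]; apply.
apply: measurable_bounded_integrable => //.
- rewrite [X in (X < _)%E](_ : _ = mu A * mu A)%E; last first.
    by apply: product_measure1E; exact: measurable_itv.
  by rewrite /A lebesgue_measure_itv /= lte_fin; case: ifP => _;
    rewrite ?mul0e ?ltry // -EFinD -EFinM ltry.
- by apply: measurable_funTS; exact: plane_continuous_measurable.
- have [M M0 GM] := plane_bounded c cG.
  exists M; split; first exact: num_real.
  move=> N MN [x t] []; rewrite /A /= !in_itv /= -!ler_norml => xc tc.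
  by apply: (le_trans (GM x t xc tc)); exact: ltW.
Qed.

Lemma plane_integral_t : (forall x, \int[mu]_t (G (x, t))%:E = 0)%E ->
  \int[(mu \x mu)%E]_p G p = 0.
Proof.
move=> H; rewrite /Rintegral -(integral12_prod_meas1 plane_integrable).
by under eq_integral do rewrite /fubini_F /= H; rewrite integral0.
Qed.

Lemma plane_integral_x : (forall t, \int[mu]_x (G (x, t))%:E = 0)%E ->
  \int[(mu \x mu)%E]_p G p = 0.
Proof.
move=> H; rewrite /Rintegral -(integral21_prod_meas1 plane_integrable).
by under eq_integral do rewrite /fubini_G /= H; rewrite integral0.
Qed.

End BoxSupport.

Lemma integral_derive_compact (W w : R -> R) (c : R) :
  (forall x : R, is_derive x 1 W (w x)) -> continuous w ->
  (forall x, c < `|x| -> W x = 0 /\ w x = 0) ->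
  (\int[mu]_x (w x)%:E = 0)%E.
Proof.
move=> dW cw W0; pose b : R := `|c| + 1; have b0 : 0 < b by rewrite ltr_wpDl.
have cb : c < `|b| by rewrite (gtr0_norm b0) (le_lt_trans (ler_norm c))// ltrDl.
have ab : - b < b by rewrite -subr_gt0 opprK addr_gt0.
have -> : (\int[mu]_x (w x)%:E = \int[mu]_(x in `[(- b)%R, b]) (w x)%:E)%E.
  rewrite [RHS]integral_mkcond; apply: eq_integral => x _; rewrite patchE.
  case: ifPn => // /negP nx; rewrite (W0 x _).2//.
  rewrite ltNge; apply/negP => xc; apply: nx; rewrite inE /= in_itv /= -ler_norml.
  by apply: (le_trans xc); rewrite (le_trans (ler_norm c))// lerDl.
have cW := is_derive_continuous dW.
rewrite (@continuous_FTC2 R w W _ _ ab).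
- by rewrite (W0 b cb).1 (W0 (- b) _).1 ?subee// normrN.
- exact: continuous_subspaceT.
- split.
  + by move=> x _; case: (dW x).
  + exact: cvg_at_right_filter (cW _).
  + exact: cvg_at_left_filter (cW _).
- by move=> x _; rewrite derive1E; case: (dW x).
Qed.

Lemma slice_x_pair (x t : R) : {for x, continuous (fun y : R => (y, t))}.
Proof. by have := cvg_pair (@cvg_id _ (nbhs x)) (@cvg_cst _ t _ (nbhs x) _); apply. Qed.

Lemma slice_t_pair (x t : R) : {for t, continuous (fun s : R => (x, s))}.
Proof. by have := cvg_pair (@cvg_cst _ x _ (nbhs t) _) (@cvg_id _ (nbhs t)); apply. Qed.

Lemma vanish_dx (K : set (R * R)) v : closed K ->
  (forall x t, ~ K (x, t) -> v x t = 0) -> forall x t, ~ K (x, t) -> dx v x t = 0.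
Proof.
move=> cK v0 x t nK.
have H : \forall y \near x, v y t = 0.
  have : \forall y \near x, (~` K) (y, t).
    by apply: slice_x_pair; apply: open_nbhs_nbhs; split=> //; exact: closed_openC.
  by apply: filterS => y; exact: v0.
have : is_derive x 1 (v ^~ t) (0 : R).
  apply: (@near_eq_is_derive R R R (cst 0)).
  by apply: filterS H => y /= ->.
by move=> [_ ?]; rewrite /dx derive1E.
Qed.

Lemma vanish_dt (K : set (R * R)) v : closed K ->
  (forall x t, ~ K (x, t) -> v x t = 0) -> forall x t, ~ K (x, t) -> dt v x t = 0.
Proof.
move=> cK v0 x t nK.
have H : \forall s \near t, v x s = 0.
  have : \forall s \near t, (~` K) (x, s).
    by apply: slice_t_pair; apply: open_nbhs_nbhs; split=> //; exact: closed_openC.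
  by apply: filterS => y; exact: v0.
have : is_derive t 1 (v x) (0 : R).
  apply: (@near_eq_is_derive R R R (cst 0)).
  by apply: filterS H => y /= ->.
by move=> [_ ?]; rewrite /dt derive1E.
Qed.

End PlaneIntegrals.

Section WeakEquation.
Context {R : realType}.
Local Notation mu := (@lebesgue_measure R).

Lemma is_derive_wronskian (f f1 f2 g g1 g2 : R -> R) (x : R) :
  is_derive x 1 f (f1 x) -> is_derive x 1 f1 (f2 x) ->
  is_derive x 1 g (g1 x) -> is_derive x 1 g1 (g2 x) ->
  is_derive x 1 (fun y => f y * g1 y - f1 y * g y) (f x * g2 x - f2 x * g x).
Proof.
move=> df df1 dg dg1.
have H := is_deriveB (is_deriveM df dg1) (is_deriveM df1 dg).
apply: is_derive_eq; rewrite /GRing.scale /=; ring.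
Qed.

Variables (l1 l2 t0 : R).
Hypotheses (l1_ge0 : 0 <= l1) (l1_lt1 : l1 < 1) (l2_ge0 : 0 <= l2) (l2_lt1 : l2 < 1).
Hypothesis t0_gt0 : 0 < t0.
Variable u : R -> R -> R.
Hypothesis Cu : class_C 2 u.
Hypothesis ueq : forall x t, wave_op u x t = 0.

(** Green's formula: [u psi_tt - u_tt psi] and [u psi_xx - u_xx psi] are
    the derivatives in [t] and in [x] of compactly supported functions, so each has
    integral 0 over the plane, and their difference is [u * wave_op psi]. *)
Lemma classical_weak psi : test_function (domain l1 l2 t0) psi ->
  \int[(mu \x mu)%E]_(p in domain l1 l2 t0) (u p.1 p.2 * wave_op psi p.1 p.2) = 0.
Proof.
move=> [Spsi [K [cK KD psi0]]].
have Cp : class_C 2 psi by exact: Spsi.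
have clK : closed K by apply: compact_closed => //; exact: norm_hausdorff.
have [c cP] : exists c : R, forall x t, c < `|x| \/ c < `|t| -> ~ K (x, t).
  have [M [_ MP]] := compact_bounded cK.
  exists (M + 1) => x t H Kxt.
  have := MP (M + 1) ltac:(by rewrite ltrDl) _ Kxt.
  by rewrite /= prod_normE /= ge_max => /andP[H1 H2]; case: H; rewrite ltNge ?H1 ?H2.
have vx := vanish_dx clK psi0; have vt := vanish_dt clK psi0.
have vxx := vanish_dx clK vx; have vtt := vanish_dt clK vt.
have Cu1 := class_C_dx Cu; have Cu2 := class_C_dt Cu.
have Cp1 := class_C_dx Cp; have Cp2 := class_C_dt Cp.
pose G1 (p : R * R) := u p.1 p.2 * dt (dt psi) p.1 p.2 - dt (dt u) p.1 p.2 * psi p.1 p.2.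
pose G2 (p : R * R) := u p.1 p.2 * dx (dx psi) p.1 p.2 - dx (dx u) p.1 p.2 * psi p.1 p.2.
have cont (k : nat) v : class_C k v -> continuous (fun p : R * R => v p.1 p.2).
  exact: class_C_continuous.
have cG1 : continuous G1.
  by move=> p; apply: cvgB; apply: cvgM; apply: cont;
    [exact: Cu|exact: class_C_dt Cp2|exact: class_C_dt Cu2|exact: Cp].
have cG2 : continuous G2.
  by move=> p; apply: cvgB; apply: cvgM; apply: cont;
    [exact: Cu|exact: class_C_dx Cp1|exact: class_C_dx Cu1|exact: Cp].
have n1 x t : ~ K (x, t) -> G1 (x, t) = 0.
  by move=> nK; rewrite /G1 /= (vtt _ _ nK) (psi0 _ _ nK) !mulr0 subrr.
have n2 x t : ~ K (x, t) -> G2 (x, t) = 0.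
  by move=> nK; rewrite /G2 /= (vxx _ _ nK) (psi0 _ _ nK) !mulr0 subrr.
have z1 x t : c < `|x| \/ c < `|t| -> G1 (x, t) = 0 by move=> /cP; exact: n1.
have z2 x t : c < `|x| \/ c < `|t| -> G2 (x, t) = 0 by move=> /cP; exact: n2.
have i1 := plane_integrable cG1 z1; have i2 := plane_integrable cG2 z2.
have E1 : \int[(mu \x mu)%E]_p G1 p = 0.
  apply: (plane_integral_t cG1 z1) => x; apply: (@integral_derive_compact _
    (fun t => u x t * dt psi x t - dt u x t * psi x t) (fun t => G1 (x, t)) c).
  + move=> t; apply: (@is_derive_wronskian (u x) (dt u x) (dt (dt u) x)
      (psi x) (dt psi x) (dt (dt psi) x)).
    * exact: class_C_is_derive_dt Cu.
    * exact: class_C_is_derive_dt Cu2.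
    * exact: class_C_is_derive_dt Cp.
    * exact: class_C_is_derive_dt Cp2.
  + move=> t; apply: (@cvg_comp _ _ _ (fun s : R => (x, s)) G1); last exact: cG1.
    exact: slice_t_pair.
  + by move=> t tc /=; have nK := cP x t (or_intror tc);
      rewrite (n1 _ _ nK) (vt _ _ nK) (psi0 _ _ nK) !mulr0 subrr.
have E2 : \int[(mu \x mu)%E]_p G2 p = 0.
  apply: (plane_integral_x cG2 z2) => t; apply: (@integral_derive_compact _
    (fun x => u x t * dx psi x t - dx u x t * psi x t) (fun x => G2 (x, t)) c).
  + move=> x; apply: (@is_derive_wronskian (u ^~ t) (dx u ^~ t) (dx (dx u) ^~ t)
      (psi ^~ t) (dx psi ^~ t) (dx (dx psi) ^~ t)).
    * exact: class_C_is_derive_dx Cu.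
    * exact: class_C_is_derive_dx Cu1.
    * exact: class_C_is_derive_dx Cp.
    * exact: class_C_is_derive_dx Cp1.
  + move=> x; apply: (@cvg_comp _ _ _ (fun y : R => (y, t)) G2); last exact: cG2.
    exact: slice_x_pair.
  + by move=> x xc /=; have nK := cP x t (or_introl xc);
      rewrite (n2 _ _ nK) (vx _ _ nK) (psi0 _ _ nK) !mulr0 subrr.
have Hf : (fun p : R * R => u p.1 p.2 * wave_op psi p.1 p.2) \_ (domain l1 l2 t0) =
    (fun p => G1 p - G2 p).
  apply/funext => -[x t]; rewrite patchE; case: ifPn => [_|/negP nD].
    rewrite /G1 /G2 /=; have := ueq x t; rewrite /wave_op.
    move: (u x t) (dt (dt u) x t) (dx (dx u) x t) (psi x t) => a b b' d.
    move: (dt (dt psi) x t) (dx (dx psi) x t) => e f /subr0_eq ->; ring.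
  have nK : ~ K (x, t) by move=> /KD H; apply: nD; rewrite inE.
  by rewrite (n1 _ _ nK) (n2 _ _ nK) subrr.
clearbody G1 G2.
rewrite Rintegral_mkcond Hf (RintegralB measurableT i1 i2) E1 E2.
exact: subrr.
Qed.

Hypothesis l12_gt0 : 0 < l1 + l2.
Hypothesis bu : forall t, t0 <= t -> u (- l1 * t) t = 0 /\ u (l2 * t) t = 0.

Lemma classical_wave_solution :
  wave_solution l1 l2 t0 (u ^~ t0) (dt u ^~ t0) u (dx u) (dt u).
Proof.
have Cu1 := class_C_dx Cu; have Cu2 := class_C_dt Cu.
split.
- move=> t tt; have [b1 b2] := bu tt.
  apply: smooth_H10_deriv => //; first exact: class_C_le Cu.
  have t_ge0 : 0 <= t by rewrite (le_trans _ tt)// ltW.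
  by rewrite -subr_ge0 mulNr opprK -mulrDl mulr_ge0// addrC ltW.
- by move=> t tt; apply: continuous_L2_I; exact: (slice_x_continuous Cu2).
- by apply: smooth_L2_continuous => //; exact: class_C_le Cu.
- by apply: smooth_L2_continuous.
- by apply: smooth_L2_continuous.
- exact: smooth_L2_derivative.
- exact: classical_weak.
- by [].
- exact: aeW.
Qed.

End WeakEquation.

(** * A wave that is not observed *)

Section Counterexample.
Context {R : realType}.
Local Notation mu := (@lebesgue_measure R).

(** The exponent 3 is the least for which the second derivative is
    continuous. *)
Lemma bump_profile (a b p q : R) : p < q -> a <= p -> q <= b ->
  C2_profile a b (bump_pow p q 3)
    (fun x => 3 * bump_pow p q 2 x * (p + q - 2 * x))
    (fun x => 3 * (2 * bump_pow p q 1 x * (p + q - 2 * x) ^+ 2 - 2 * bump_pow p q 2 x)).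
Proof.
move=> pq ap qb; split.
- by move=> y; exact: (bump_pow_is_derive p q 1 y).
- move=> y; have H := bump_pow_is_derive p q 0 y.
  have L : is_derive y 1 (fun x : R => p + q - 2 * x) (- 2).
    have L := is_deriveB (is_derive_cst (p + q) y (1 : R)) (is_deriveZ 2 (is_derive_id y (1 : R))).
    by apply: (@is_derive_eq _ _ _ _ _ _ _ _ L); rewrite sub0r -![_ *: _]/(_ * _) mulr1.
  have D := is_deriveM (is_deriveZ 3 H) L.
  apply: (@is_derive_eq _ _ _ _ _ _ _ _ D).
  rewrite -[(3 \*: bump_pow p q 2) y]/(3 * bump_pow p q 2 y) -![_ *: _]/(_ * _); ring.
- move=> x; apply: cvgM; first exact: cvg_cst.
  have cL : {for x, continuous (fun y : R => (p + q - 2 * y) ^+ 2)}.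
    have H : {for x, continuous (fun y : R => p + q - 2 * y)}.
      by apply: cvgB; [exact: cvg_cst|apply: cvgM; [exact: cvg_cst|exact: cvg_id]].
    rewrite (_ : (fun y => _) = (fun y : R => (p + q - 2 * y) * (p + q - 2 * y))); last first.
      by apply/funext => z; rewrite expr2.
    exact: (cvgM H H).
  apply: cvgB; apply: cvgM.
  + by apply: cvgM; [exact: cvg_cst|exact: bump_pow_continuous].
  + exact: cL.
  + exact: cvg_cst.
  + exact: bump_pow_continuous.
- move=> y H; have H' : y <= p \/ q <= y.
    by case: H => H; [left; exact: le_trans ap|right; exact: le_trans H].
  have v n : bump_pow p q n.+1 y = 0 by exact: (bump_pow_vanish pq n H').
  by rewrite !v !mulr0 !mul0r subrr mulr0; split.
Qed.

Variables (l1 l2 t0 : R).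
Hypotheses (l1_ge0 : 0 <= l1) (l1_lt1 : l1 < 1) (l2_ge0 : 0 <= l2) (l2_lt1 : l2 < 1).
Hypothesis l12_gt0 : 0 < l1 + l2.
Hypothesis t0_gt0 : 0 < t0.

Local Notation rho := (alpha_l l1 l2 * beta_l l1 l2).
Local Notation I0 := (I_ l1 l2 t0).
Local Notation pmin := (phase_min l1 l2 t0).
Local Notation pmid := (phase_mid l2 t0).
Local Notation pmax := (phase_max l1 t0).
Local Notation sg := (mirror l2).

(** The direct inequality, applied to the differences between [u] and classical
    solutions whose data tend to those of [u], makes their traces tend to 0 on
    the time interval. *)
Lemma trace_unique0 u g (T : R) : classical_solution l1 l2 t0 u -> 0 <= T ->
  (forall t, t0 <= t -> t <= t0 + T -> trace_on l2 u t = 0) ->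
  is_trace l1 l2 t0 (dx u ^~ t0) (dt u ^~ t0) g ->
  sqint `[t0, (t0 + T)%R] g = 0%E.
Proof.
move=> cu T0 u0 [g2 [v [cv vf vh vg]]].
have H1 := trace_sqint_cvg g2 cv vg T0.
have cd n : classical_solution l1 l2 t0 (fun x t => v n x t - u x t).
  have [Cv ev bv] := cv n; have [Cu eu bu] := cu.
  have [Cd pd] := class_CB Cv Cu; split; first exact: Cd.
    move=> x t D; have := ev x t D; have := eu x t D.
    rewrite /wave_op; have -> : dt (dt (fun x t => v n x t - u x t)) =
      (fun x t => dt (dt (v n)) x t - dt (dt u) x t) := pd [:: true; true] isT.
    have -> : dx (dx (fun x t => v n x t - u x t)) =
      (fun x t => dx (dx (v n)) x t - dx (dx u) x t) := pd [:: false; false] isT.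
    move: (dt (dt (v n)) x t) (dt (dt u) x t) (dx (dx (v n)) x t) (dx (dx u) x t) => a b c d.
    by move=> /subr0_eq -> /subr0_eq ->; rewrite subrr.
  by move=> t tt; have [-> ->] := bv t tt; have [-> ->] := bu t tt; rewrite subrr.
have H0 : sqint `[t0, (t0 + T)%R] (trace_on l2 (v n)) @[n --> \oo] --> 0%E.
  have lim : ((direct_const l1 l2)%:E * (sqint I0 (fun x => (dx (v n) x t0 - dx u x t0)%R) +
       sqint I0 (fun x => (dt (v n) x t0 - dt u x t0)%R)))%E @[n --> \oo] --> 0%E.
    have H := cvgeD (isT : ((0 : \bar R) +? 0)%E) vf vh.
    have := cvgeZl (isT : (direct_const l1 l2)%:E \is a fin_num) (H _).
    rewrite adde0 mule0; apply.
  move: lim; apply: squeeze_cvge; last exact: cvg_cst.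
  apply: nearW => n; rewrite sqint_ge0 /=.
  have [Cv _ _] := cv n; have [Cu _ _] := cu.
  have [_ pd] := class_CB Cv Cu.
  have E1 : dx (fun x t => v n x t - u x t) = (fun x t => dx (v n) x t - dx u x t)
    := pd [:: false] isT.
  have E2 : dt (fun x t => v n x t - u x t) = (fun x t => dt (v n) x t - dt u x t)
    := pd [:: true] isT.
  have := classical_direct_open l1_ge0 l1_lt1 l2_ge0 l2_lt1 l12_gt0 t0_gt0 (cd n) T0.
  rewrite E1 E2; apply: le_trans.
  rewrite le_eqVlt; apply/orP; left; apply/eqP; apply: eq_sqint => t.
  rewrite inE /= in_itv /= => /andP[t1 t2].
  by rewrite /trace_on E1 -/(trace_on l2 u t) (u0 t t1 t2) subr0.
by exact: (cvg_unique _ H1 H0).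
Qed.

Lemma sqint0_integral0 (w : R -> R) (a b : R) : a < b -> continuous w ->
  sqint `]a, b[ w = 0%E -> \int[mu]_(x in `[a, b]) w x = 0.
Proof.
move=> ab cw w0.
have iw : mu.-integrable `[a, b] (EFin \o w).
  by apply: continuous_compact_integrable; [exact: segment_compact|exact: continuous_subspaceT].
have io : mu.-integrable `]a, b[ (EFin \o w).
  by apply: integrableS iw => // x; exact: subset_itv_oo_cc.
have ioc : mu.-integrable `]a, b] (EFin \o w).
  by apply: integrableS iw => // x; exact: subset_itv_oc_cc.
rewrite -(Rintegral_itv_obnd_cbnd ioc) -(Rintegral_itv_bndo_bndc io).
have w2 : L2 `]a, b[ w.
  split; first by apply: measurable_funTS; exact: continuous_measurable_fun.
  by move: w0; rewrite /sqint => ->.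
apply/eqP; rewrite -normr_le0; apply/ler_addgt0Pl => e e0; rewrite addr0.
have ba : 0 < b - a by rewrite subr_gt0.
have [_] := L2_integral_bound ab w2 (divr_gt0 e0 ba).
by rewrite w0 /= mul0r addr0 divfK// gt_eqF.
Qed.

(** [u] vanishes at the left end point and its increments are integrals of
    [u_x]. *)
Lemma gradient0_vanish u x : classical_solution l1 l2 t0 u ->
  sqint I0 (dx u ^~ t0) = 0%E -> I0 x -> u x t0 = 0.
Proof.
move=> [Cu _ bu] u0 Ix; have [ua _] := bu t0 (lexx t0).
move: (Ix); rewrite /I_ /= in_itv /= => /andP[ax xb].
have cw : continuous (dx u ^~ t0) by exact: slice_x_continuous (class_C_dx Cu).
have w0 : sqint `](- l1 * t0), x[ (dx u ^~ t0) = 0%E.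
  apply/eqP; rewrite eq_le sqint_ge0 andbT -u0; apply: sqint_subset => //.
  - exact: measurable_itv.
  - by apply: subset_itvl; rewrite bnd_simp ltW.
  - by apply: measurable_funTS; exact: continuous_measurable_fun.
have := sqint0_integral0 ax cw w0.
rewrite (Rintegral_derive (ltW ax) (fun y => class_C_is_derive_dx y t0 Cu) cw).
by rewrite ua subr0.
Qed.

(** A profile near a phase [y < phase_mid] is seen at the endpoint at the times
    [rho ^ k * y / (1 - l2)].  For [k = 0] these are before [t0]; for [k = 1]
    they are after [t0 + T] as soon as [y] is larger than the number [c] of the
    proof, and [c < phase_mid] says that [T < T_l]. *)
Lemma unobserved_wave (T : R) : 0 <= T -> t0 + T < rho * t0 ->
  exists u, [/\ classical_solution l1 l2 t0 u, forall x t, wave_op u x t = 0,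
    forall t, t0 <= t -> t <= t0 + T -> trace_on l2 u t = 0 &
    exists2 x, I0 x & u x t0 != 0].
Proof.
move=> T0 Trho.
have rho1 : 1 < rho by exact: period_gt1.
have rho0 : 0 < rho by exact: lt_trans ltr01 rho1.
have l2m : 0 < 1 - l2 by rewrite subr_gt0.
have pm := phase_min_mid l1_ge0 l1_lt1 l2_ge0 l2_lt1 l12_gt0 t0_gt0.
have pM := phase_mid_max l1_ge0 l1_lt1 l2_ge0 l2_lt1 l12_gt0 t0_gt0.
have p0 := phase_min_gt0 l1_lt1 l2_ge0 l2_lt1 t0_gt0.
pose c := Num.max pmin ((1 - l2) * (t0 + T) / rho).
have cmid : c < pmid.
  rewrite /c gt_max pm /= ltr_pdivrMr// /phase_mid -mulrA ltr_pM2l//.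
  by rewrite [t0 * _]mulrC.
have minc : pmin <= c by rewrite /c le_max lexx.
have gP := bump_profile cmid minc (ltW pM).
set g := bump_pow c pmid 3 in gP; set g1 := (X in C2_profile _ _ _ X _) in gP.
have g0 x : x <= c \/ pmid <= x -> g x = 0 by exact: bump_pow_vanish.
have g10 x : x <= c \/ pmid <= x -> g1 x = 0.
  move=> H; have b0 : bump_pow c pmid 2 x = 0 by exact: bump_pow_vanish.
  by rewrite /g1 b0 mulr0 mul0r.
exists (profile_wave l1 l2 t0 g); split.
- exact: (profile_wave_classical l1_lt1 l2_ge0 l2_lt1 l12_gt0 t0_gt0 gP).
- exact: (profile_wave_eq l1_lt1 l2_ge0 l2_lt1 l12_gt0 t0_gt0 gP).
- move=> t t1 t2.
  rewrite (profile_wave_trace l1_lt1 l2_ge0 l2_lt1 l12_gt0 t0_gt0 gP) /scaled_sum.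
  rewrite big1 ?mulr0// => k _; rewrite g10 ?mulr0//.
  have tm : (1 - l2) * t <= (1 - l2) * (t0 + T) by rewrite ler_pM2l.
  case: k => -[|k] _ /=.
    by right; rewrite expr0 divr1 /phase_mid ler_pM2l.
  left; rewrite /c le_max; apply/orP; right.
  apply: ler_pM => //.
  + by rewrite mulr_ge0 ?ltW// (lt_le_trans t0_gt0).
  + by rewrite invr_ge0 exprn_ge0 ?ltW.
  + by rewrite lef_pV2 ?posrE ?exprn_gt0// exprS -[X in X <= _]mulr1 ler_pM2l// exprn_ege1// ltW.
- pose y := (c + pmid) / 2.
  have cy : c < y by rewrite /y; lra.
  have ym : y < pmid by rewrite /y; lra.
  have sg0 : 0 < sg by exact: mirror_gt0.
  pose x := y / sg - t0.
  have xy : sg * (t0 + x) = y by rewrite /x addrC subrK mulrC divfK ?gt_eqF.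
  have Ix : I0 x.
    apply/(mirror_initial l1 t0 l2_ge0 l2_lt1).
    by rewrite xy ym andbT (le_lt_trans minc).
  have /andP[d1 d2] := (direct_initial l1 l2 t0 x).1 Ix.
  exists x => //; rewrite /profile_wave /reflected_wave xy.
  have gl z : z <= pmin -> g z = 0 by move=> H; apply: g0; left; exact: le_trans minc.
  rewrite !scaled_sum_period0//; last 2 first.
  + by rewrite ltW// (lt_trans ym).
  + exact: ltW.
  rewrite (g0 (t0 - x)); last by right; exact: ltW.
  by rewrite sub0r oppr_eq0 gt_eqF// bump_pow_gt0.
Qed.

End Counterexample.

(** * Constants and conclusion *)

Section Sharpness.
Context {R : realType}.
Variables (l1 l2 t0 : R).
Hypotheses (l1_ge0 : 0 <= l1) (l1_lt1 : l1 < 1) (l2_ge0 : 0 <= l2) (l2_lt1 : l2 < 1).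
Hypothesis l12_gt0 : 0 < l1 + l2.
Hypothesis t0_gt0 : 0 < t0.

Lemma inverse_inequality_fails (T C : R) : 0 <= T ->
  t0 + T < alpha_l l1 l2 * beta_l l1 l2 * t0 ->
  exists (phi0 phi1 : R -> R) (phi phix phit : R -> R -> R),
    [/\ H10 (- l1 * t0) (l2 * t0) phi0, L2 (I_ l1 l2 t0) phi1,
        wave_solution l1 l2 t0 phi0 phi1 phi phix phit &
        ~ (energy l1 l2 phix phit t0
             <= C%:E * boundary_integral l1 l2 t0 phix phit T)%E].
Proof.
move=> T0 Trho.
have [u [cu ueq u0 [x Ix ux]]] :=
  unobserved_wave l1_ge0 l1_lt1 l2_ge0 l2_lt1 l12_gt0 t0_gt0 T0 Trho.
have [Cu _ bu] := cu.
have ws := classical_wave_solution l1_ge0 l1_lt1 l2_ge0 l2_lt1 t0_gt0 Cu ueq l12_gt0 bu.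
have H10t := ws_H10 ws (lexx t0); have t2 := ws_L2 ws (lexx t0).
exists (u ^~ t0), (dt u ^~ t0), u, (dx u), (dt u); split.
- by exists (dx u ^~ t0).
- exact: t2.
- exact: ws.
have x2 : L2 (I_ l1 l2 t0) (dx u ^~ t0) by case: H10t => -[].
have -> : boundary_integral l1 l2 t0 (dx u) (dt u) T = 0%E.
  have [H|H] := pselect (exists g, is_trace l1 l2 t0 (dx u ^~ t0) (dt u ^~ t0) g).
    exact: (trace_unique0 l1_ge0 l1_lt1 l2_ge0 l2_lt1 l12_gt0 t0_gt0 cu T0 u0 (boundary_trace_spec H)).
  rewrite /boundary_integral (boundary_trace_default H) /cst expr0n /=.
  by rewrite (_ : (fun=> 0%:E) = cst 0%E)// integral0.
rewrite mule0 (energyE x2 t2) => E0.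
move/eqP: ux; apply; apply: (gradient0_vanish cu _ Ix).
apply/eqP; rewrite eq_le sqint_ge0 andbT.
have h : (sqint (I_ l1 l2 t0) (dx u ^~ t0) + sqint (I_ l1 l2 t0) (dt u ^~ t0) <= 0)%E.
  by rewrite -(@lee_pmul2l _ (2^-1)%:E) ?mule0// lte_fin invr_gt0.
by apply: le_trans h; rewrite leeDl// sqint_ge0.
Qed.

Lemma T_lE (L0 : R) : t0 = L0 / (l1 + l2) ->
  T_l l1 l2 L0 = (alpha_l l1 l2 * beta_l l1 l2 - 1) * t0.
Proof.
move=> ->; rewrite /T_l /alpha_l /beta_l.
have h1 : 1 - l1 != 0 by rewrite gt_eqF ?subr_gt0.
have h2 : 1 - l2 != 0 by rewrite gt_eqF ?subr_gt0.
have h3 : l1 + l2 != 0 by rewrite gt_eqF.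
by field; rewrite h1 h2 h3.
Qed.

Lemma inverse_const_gt0 : 0 < inverse_const l1 l2.
Proof.
apply: divr_gt0 => //; apply: mulr_gt0; first exact: trace_gain_gt0.
exact: lt_le_trans ltr01 (trace_skew_ge1 l1_ge0 l1_lt1).
Qed.

(** The quotient of the two constants is [(1 + l2) / (1 - max l1 l2)]. *)
Lemma inverse_const_le : inverse_const l1 l2 / 2 <= obs_const l1 l2.
Proof.
have h1 : 0 < 1 - l1 by rewrite subr_gt0.
have h2 : 0 < 1 - l2 by rewrite subr_gt0.
have hL : 0 < 1 - Num.max l1 l2 by rewrite subr_gt0 gt_max l1_lt1.
have E : obs_const l1 l2 =
    inverse_const l1 l2 / 2 * ((1 + l2) / (1 - Num.max l1 l2)).
  rewrite /obs_const /inverse_const /trace_gain /trace_skew /alpha_l /beta_l.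
  move: hL; set m := Num.max _ _ => hL.
  by field; rewrite !gt_eqF.
rewrite E ler_peMr//.
  exact: divr_ge0 (ltW inverse_const_gt0) _.
rewrite ler_pdivlMr// mul1r.
have : l2 <= Num.max l1 l2 by rewrite le_max lexx orbT.
by move: (l2_ge0) => ?; lra.
Qed.

Lemma obs_const_gt0 : 0 < obs_const l1 l2.
Proof.
apply: lt_le_trans inverse_const_le; exact: divr_gt0 inverse_const_gt0 _.
Qed.

Lemma inverse_inequality_le (T C C' : R) : C <= C' ->
  inverse_inequality l1 l2 t0 T C -> inverse_inequality l1 l2 t0 T C'.
Proof.
move=> CC H phi0 phi1 phi phix phit h1 h2 ws.
apply: (le_trans (H phi0 phi1 phi phix phit h1 h2 ws)).
by apply: lee_wpmul2r; [exact: sqint_ge0|rewrite lee_fin].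
Qed.

End Sharpness.

Theorem theorem3 (R : realType) (l1 l2 : R)
    (hl1 : 0 <= l1 < 1) (hl2 : 0 <= l2 < 1) (hl : 0 < l1 + l2) :
  (forall T : R, 0 <= T ->
     exists K : R, forall L0 : R, 0 < L0 ->
       let t0 := L0 / (l1 + l2) in
       forall (phi0 phi1 : R -> R) (phi phix phit : R -> R -> R),
         H10 (- l1 * t0) (l2 * t0) phi0 -> L2 (I_ l1 l2 t0) phi1 ->
         wave_solution l1 l2 t0 phi0 phi1 phi phix phit ->
         (boundary_integral l1 l2 t0 phix phit T
            <= K%:E * energy l1 l2 phix phit t0)%E)
  /\
  (forall L0 : R, 0 < L0 ->
     let t0 := L0 / (l1 + l2) in
     (forall T : R, T_l l1 l2 L0 <= T ->
        observable l1 l2 t0 T /\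
        inverse_inequality l1 l2 t0 T (obs_const l1 l2)) /\
     (forall T : R, 0 <= T < T_l l1 l2 L0 ->
        exists (phi0 phi1 : R -> R) (phi phix phit : R -> R -> R),
          [/\ H10 (- l1 * t0) (l2 * t0) phi0, L2 (I_ l1 l2 t0) phi1,
              wave_solution l1 l2 t0 phi0 phi1 phi phix phit &
              ~ (energy l1 l2 phix phit t0
                   <= (obs_const l1 l2)%:E
                      * boundary_integral l1 l2 t0 phix phit T)%E])).
Proof.
have [l1_ge0 l1_lt1] := andP hl1; have [l2_ge0 l2_lt1] := andP hl2.
have t0_gt0 L0 : 0 < L0 -> 0 < L0 / (l1 + l2) by move=> ?; rewrite divr_gt0.
split.
  move=> T T0; exists (2 * direct_const l1 l2) => L0 L00 t0 phi0 phi1 phi phix phit _ _.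
  exact: direct_inequality (t0_gt0 _ L00) _ _ _ _ _ _ T0.
move=> L0 L00 t0; have t00 : 0 < t0 := t0_gt0 _ L00.
have TE := @T_lE R l1 l2 t0 l1_lt1 l2_lt1 hl L0 erefl.
have rE : (alpha_l l1 l2 * beta_l l1 l2) * t0 = t0 + T_l l1 l2 L0.
  by rewrite TE mulrBl mul1r addrC subrK.
split=> T.
  move=> TT.
  have T0 : 0 <= T.
    apply: le_trans TT; rewrite TE mulr_ge0 ?subr_ge0 ?(ltW t00)//.
    exact: ltW (period_gt1 l1_lt1 l2_lt1 hl).
  have H : inverse_inequality l1 l2 t0 T (obs_const l1 l2).
    apply: inverse_inequality_le (inverse_const_le l1_ge0 l1_lt1 l2_ge0 l2_lt1) _.
    by apply: inverse_inequality_const => //; rewrite rE lerD2l.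
  by split=> //; exists (obs_const l1 l2) => //; exact: obs_const_gt0.
move=> /andP[T0 TT]; apply: inverse_inequality_fails => //.
by rewrite rE ltrD2l.
Qed.
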